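(* Let $q>1$, $\zeta,\eta\in\mathbb{T}$, $X=L^1((0,1))$, $Q=\mathcal{L}_{\zeta,q}\mathcal{L}_{\eta,q}$ on $X$, and $\mathbb{D}=\{\lambda\in\mathbb{C}:|\lambda|<1\}$. Define $$\sigma_{\mathrm{e,F}}(Q;X)=\{\lambda\in\mathbb{C}:Q-\lambda I\text{ is not Fredholm on }X\}.$$ Then $$\sigma(Q;X)=\sigma_{\mathrm{e,F}}(Q;X)=\overline{\mathbb{D}}.$$ The range $\operatorname{Ran}(I-Q)$ is not closed in $X$. More precisely, $$\overline{\operatorname{Ran}(I-Q)}=\ker\Pi=\begin{cases}X,&(\zeta,\eta)\ne(1,1),\\ \{g\in X:\int_0^1g(x)\,dx=0\},&(\zeta,\eta)=(1,1),\end{cases}$$ and $\operatorname{Ran}(I-Q)$ is a proper dense subspace of the displayed space.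
   Context: $\mathbb{T}=\{z\in\mathbb{C}:|z|=1\}$. For $\omega\in\mathbb{T}$ and $h\in L^1((0,1))$ (extended by zero outside $(0,1)$), $$(\mathcal{L}_{\omega,q}h)(x)=\sum_{n\ge1}\omega^n\frac{q}{(n+x)^2}h\Big(\frac{q}{n+x}\Big),\quad 0<x<1,$$ a contraction of $L^1((0,1))$. Let $\rho_q$ be the unique function in $BV((0,1))$ with $\mathcal{L}_{1,q}\rho_q=\rho_q$, $\rho_q>0$ a.e., $\int_0^1\rho_q\,dx=1$. The bounded projection $\Pi:X\to X$ is $\Pi h=0$ if $(\zeta,\eta)\ne(1,1)$, and $\Pi h=\big(\int_0^1h(x)\,dx\big)\rho_q$ if $(\zeta,\eta)=(1,1)$. $\sigma(Q;X)$ is the spectrum of $Q$ on $X$, and $\operatorname{Ran}(I-Q)=(I-Q)X$. *)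

(* Defs.v *)
From HB Require Import structures.
From mathcomp Require Import all_boot all_order all_algebra.
From mathcomp Require Import ring_quotient.
From mathcomp Require Import complex.
From mathcomp Require Import all_classical all_reals all_analysis.
From mathcomp Require Import measurable_realfun.

Set Implicit Arguments.
Unset Strict Implicit.
Unset Printing Implicit Defensive.

Import Order.TTheory GRing.Theory Num.Theory.
Import numFieldNormedType.Exports.
Import Normc.

Local Open Scope classical_set_scope.
Local Open Scope ring_scope.
Local Open Scope complex_scope.
Local Open Scope quotient_scope.

Section OperatorTheory.
Context {K : numFieldType} {X : normedModType K}.
Implicit Types (T : X -> X) (V W : set X).

Definition subspace V :=
  V 0 /\ forall (a : K) (x y : X), V x -> V y -> V (a *: x + y).

Definition proper_dense_subspace W V :=
  [/\ subspace W, W `<` V & V `<=` closure W].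

Definition ker T : set X := [set x | T x = 0].

(* For a subspace V: V is contained in the span of a finite family. *)
Definition finite_dim V :=
  exists (n : nat) (e : 'I_n -> X), forall v, V v ->
    exists c : 'I_n -> K, v = \sum_(i < n) c i *: e i.

(* For a subspace W: X is the sum of W and the span of a finite family,
   i.e. dim (X / W) is finite. *)
Definition finite_codim W :=
  exists (n : nat) (e : 'I_n -> X), forall x,
    exists2 w, W w & exists c : 'I_n -> K, x = w + \sum_(i < n) c i *: e i.

(* [fredholm], [spectrum] and [fredholm_spectrum] are meant for bounded
   linear operators on a Banach space. *)
Definition fredholm T :=
  [/\ finite_dim (ker T), closed (range T) & finite_codim (range T)].

Definition boundedly_invertible T :=
  exists S : {linear X -> X}, [/\ continuous S, cancel T S & cancel S T].

Definition spectrum T : set K :=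
  [set l | ~ boundedly_invertible (fun x => T x - l *: x)].

Definition fredholm_spectrum T : set K :=
  [set l | ~ fredholm (fun x => T x - l *: x)].

End OperatorTheory.

(* The complex Banach space L^1((0,1)). Representatives are functions on the
   whole line of which only the restriction to (0,1) matters. *)
Section L1.
Context {R : realType}.
Local Notation C := R[i].
Local Notation mu := (@lebesgue_measure R).
Local Notation D := (`]0, 1[%classic : set R).
Implicit Types f g : R -> C.

Definition cintegrable : {pred R -> C} := fun f =>
  `[< mu.-integrable D (fun x => (complex.Re (f x))%:E) /\
      mu.-integrable D (fun x => (complex.Im (f x))%:E) >].

Lemma cintegrableP f : reflect
  (mu.-integrable D (fun x => (complex.Re (f x))%:E) /\
   mu.-integrable D (fun x => (complex.Im (f x))%:E)) (f \in cintegrable).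
Proof. exact: asboolP. Qed.

Let mD : @measurable _ (measurableTypeR R) D. Proof. exact: measurable_itv. Qed.

Lemma cintegrable_zmod_closed : zmod_closed cintegrable.
Proof.
split; first by apply/cintegrableP; split; exact: integrable0.
move=> f g /cintegrableP[f1 f2] /cintegrableP[g1 g2].
apply/cintegrableP; split.
- have := integrableB mD f1 g1; apply: eq_integrable => // x _ /=.
  by rewrite raddfB.
- have := integrableB mD f2 g2; apply: eq_integrable => // x _ /=.
  by rewrite raddfB.
Qed.
HB.instance Definition _ :=
  GRing.isZmodClosed.Build _ cintegrable cintegrable_zmod_closed.

Lemma cintegrableZ (a : C) f :
  f \in cintegrable -> (fun x => a * f x) \in cintegrable.
Proof.
case: a => a1 a2 /cintegrableP[f1 f2]; apply/cintegrableP; split.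
- have := integrableB mD (integrableZl mD a1 f1) (integrableZl mD a2 f2); apply: eq_integrable => // x _ /=.
  by case: (f x).
- have := integrableD mD (integrableZl mD a1 f2) (integrableZl mD a2 f1); apply: eq_integrable => // x _ /=.
  by case: (f x).
Qed.

Lemma integrable_normc f :
  f \in cintegrable -> mu.-integrable D (fun x => (normc (f x))%:E).
Proof.
move=> /cintegrableP[f1 f2].
have mf1 : measurable_fun D (fun x => complex.Re (f x)).
  by apply/measurable_EFinP; exact: measurable_int f1.
have mf2 : measurable_fun D (fun x => complex.Im (f x)).
  by apply/measurable_EFinP; exact: measurable_int f2.
have normcE z : normc z = Num.sqrt (complex.Re z ^+ 2 + complex.Im z ^+ 2).
  by case: z.
apply: (@le_integrable _ _ _ _ _ mD _
    (fun x => (`|(complex.Re (f x))%:E| + `|(complex.Im (f x))%:E|)%E)).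
- apply/measurable_EFinP.
  rewrite (_ : (fun x => normc (f x)) = (fun x =>
    Num.sqrt (complex.Re (f x) ^+ 2 + complex.Im (f x) ^+ 2))); last first.
    by apply/funext => x; rewrite normcE.
  apply: (@measurableT_comp _ _ _ _ _ _ (@Num.sqrt R)).
    by apply: continuous_measurable_fun; exact: sqrt_continuous.
  by apply: measurable_funD; exact: measurable_funX.
- move=> x _; rewrite -EFinD/= lee_fin normcE ger0_norm ?sqrtr_ge0//.
  rewrite -[X in _ <= X]sqrtr_sqr ler_sqrt ?sqr_ge0//.
  rewrite sqrrD -!normrX !(ger0_norm (sqr_ge0 _)).
  by rewrite lerD2r lerDl mulrn_wge0// mulr_ge0.
- apply: integrableD => //; exact: integrable_abse.
Qed.

Record L1fun := MkL1fun { L1val :> R -> C ; _ : L1val \in cintegrable }.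
HB.instance Definition _ := [isSub for L1val].
HB.instance Definition _ := [Choice of L1fun by <:].
HB.instance Definition _ := [SubChoice_isSubZmodule of L1fun by <:].

Lemma L1fun_int (h : L1fun) : (h : R -> C) \in cintegrable.
Proof. exact: (valP h). Qed.

#[local] Instance ae_mu_filter : Filter (nbhs (almost_everywhere mu)).
Proof. exact: (ae_filter_ringOfSetsType mu). Qed.

Definition L1null : {pred L1fun} := fun h =>
  `[< {ae mu, forall x, D x -> h x = 0} >].

Lemma L1nullP (h : L1fun) :
  reflect {ae mu, forall x, D x -> h x = 0} (h \in L1null).
Proof. exact: asboolP. Qed.

Lemma L1null_zmod_closed : zmod_closed L1null.
Proof.
split; first by apply/L1nullP; exact: aeW.
move=> f g /L1nullP f0 /L1nullP g0; apply/L1nullP.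
apply: filterS2 f0 g0 => x /[swap] + /[swap] Dx.
move=> /(_ Dx) gx /(_ Dx) fx.
rewrite (_ : L1val (f - g) x = f x - g x)//.
by rewrite fx// gx// subrr.
Qed.
HB.instance Definition _ :=
  GRing.isZmodClosed.Build _ L1null L1null_zmod_closed.

Definition L1 := Quotient.quot L1null.
HB.instance Definition _ := GRing.Zmodule.on L1.
HB.instance Definition _ := EqQuotient.on L1.

Lemma L1_eqP (f g : L1fun) :
  \pi_L1 f = \pi_L1 g <-> {ae mu, forall x, D x -> f x = g x}.
Proof.
have -> : (\pi_L1 f = \pi_L1 g) <-> (f - g \in L1null).
  by rewrite Quotient.idealrBE; split => /eqP.
split=> [/L1nullP|fg].
  apply: filterS => x /[apply].
  by rewrite (_ : L1val (f - g) x = f x - g x)// => /eqP; rewrite subr_eq0 => /eqP.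
apply/L1nullP; apply: filterS fg => x /[apply] fg.
by rewrite (_ : L1val (f - g) x = f x - g x)// fg subrr.
Qed.

Lemma L1_repr (f : L1fun) :
  {ae mu, forall x, D x -> (repr (\pi_L1 f) : L1fun) x = f x}.
Proof. by apply/L1_eqP; rewrite reprK. Qed.

Definition L1fun_scale (a : C) (h : L1fun) : L1fun :=
  MkL1fun (cintegrableZ a (L1fun_int h)).

Definition L1_scale (a : C) (h : L1) : L1 := \pi_L1 (L1fun_scale a (repr h)).

Lemma L1_scaleE a (f : L1fun) : L1_scale a (\pi_L1 f) = \pi_L1 (L1fun_scale a f).
Proof.
by apply/L1_eqP; apply: filterS (L1_repr f) => x /[apply] /= ->.
Qed.

Let L1_ind (P : L1 -> Prop) : (forall f : L1fun, P (\pi_L1 f)) -> forall h, P h.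
Proof. by move=> Pf h; rewrite -[h]reprK. Qed.

Fact L1_scaleA a b h : L1_scale a (L1_scale b h) = L1_scale (a * b) h.
Proof.
elim/L1_ind: h => f; rewrite !L1_scaleE; congr (\pi_L1 _).
by apply/val_inj/funext => x /=; rewrite mulrA.
Qed.

Fact L1_scale1 : left_id 1 L1_scale.
Proof.
elim/L1_ind => f; rewrite L1_scaleE; congr (\pi_L1 _).
by apply/val_inj/funext => x /=; rewrite mul1r.
Qed.

Fact L1_scaleDr : right_distributive L1_scale +%R.
Proof.
move=> a; elim/L1_ind => f; elim/L1_ind => g.
rewrite -raddfD !L1_scaleE -raddfD; congr (\pi_L1 _).
by apply/val_inj/funext => x; exact: mulrDr.
Qed.

Fact L1_scaleDl h : {morph L1_scale^~ h : a b / a + b}.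
Proof.
move=> a b; elim/L1_ind: h => f; rewrite !L1_scaleE -raddfD; congr (\pi_L1 _).
by apply/val_inj/funext => x; exact: mulrDl.
Qed.

HB.instance Definition _ := GRing.Zmodule_isLmodule.Build C L1
  L1_scaleA L1_scale1 L1_scaleDr L1_scaleDl.

Definition L1norm (h : L1) : C :=
  (\int[mu]_(x in D) normc ((repr h : L1fun) x))%:C.

Lemma L1normE (f : L1fun) :
  L1norm (\pi_L1 f) = (\int[mu]_(x in D) normc (f x))%:C.
Proof.
congr (_%:C); congr fine; apply: ae_eq_integral => //.
- exact: measurable_int (integrable_normc (L1fun_int _)).
- exact: measurable_int (integrable_normc (L1fun_int _)).
- by apply: filterS (L1_repr f) => x /[apply] ->.
Qed.

Fact ler_L1normD (g h : L1) : L1norm (g + h) <= L1norm g + L1norm h.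
Proof.
elim/L1_ind: g => f; elim/L1_ind: h => g.
rewrite -raddfD !L1normE -raddfD lecR -RintegralD//;
  [|exact: integrable_normc (L1fun_int _)..].
apply: le_Rintegral => //.
- exact: integrable_normc (L1fun_int _).
- exact: (integrableD mD (integrable_normc (L1fun_int f))
                         (integrable_normc (L1fun_int g))).
- by move=> x _; exact: le_normcD.
Qed.

Fact L1normZ (a : C) h : L1norm (a *: h) = `|a| * L1norm h.
Proof.
elim/L1_ind: h => f; rewrite [X in L1norm X]L1_scaleE !L1normE.
rewrite (_ : `|a| = (normc a)%:C); last by case: a.
rewrite -rmorphM -RintegralZl//; last exact: integrable_normc (L1fun_int _).
by congr (_%:C); apply: eq_Rintegral => x _ /=; rewrite normcM.
Qed.

Fact L1norm0_eq0 h : L1norm h = 0 -> h = 0.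
Proof.
elim/L1_ind: h => f; rewrite L1normE => /eqP.
rewrite (_ : 0 = 0%:C)// => /eqP/complexI f0.
rewrite -[RHS](raddf0 \pi_L1); apply/L1_eqP.
have intf := integrable_normc (L1fun_int f).
have mf := measurable_int _ intf.
have {}f0 : (\int[mu]_(x in D) `|(normc (f x))%:E| = 0)%E.
  have n0 (z : C) : (0 <= (normc z)%:E)%E.
    by case: z => a b; rewrite lee_fin; exact: sqrtr_ge0.
  under eq_integral do rewrite gee0_abs//.
  by rewrite -[LHS]fineK ?integrable_fin_num//; rewrite [fine _]f0.
have {f0} ae0 : {ae mu, forall x, D x -> (normc (f x))%:E = 0%E}.
  by have /(ae_eq_integral_abs _ mD mf) := f0.
by apply: filterS ae0 => x /[apply] -[]; exact: eq0_normc.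
Qed.

HB.instance Definition _ := @Lmodule_isNormed.Build C L1
  L1norm ler_L1normD L1normZ L1norm0_eq0.

Definition L1val_of (h : L1) : R -> C := (repr h : L1fun).

(* The class of f if f is integrable on (0,1), and 0 otherwise. *)
Definition L1class (f : R -> C) : L1 := \pi_L1 (insubd (0 : L1fun) f).

Lemma L1classK (f : R -> C) : f \in cintegrable ->
  {ae mu, forall x, D x -> L1val_of (L1class f) x = f x}.
Proof.
move=> intf; have fE : L1val (insubd 0 f) = f by rewrite [LHS]val_insubd intf.
by rewrite -[X in {ae mu, forall x, D x -> _ = X x}]fE; exact: L1_repr.
Qed.

Definition L1int (h : L1) : C :=
  (\int[mu]_(x in D) complex.Re (L1val_of h x)) +i*
  (\int[mu]_(x in D) complex.Im (L1val_of h x)).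

End L1.
Arguments L1 : clear implicits.

Section Transfer.
Context {R : realType}.
Local Notation C := R[i].
Local Notation mu := (@lebesgue_measure R).
Local Notation D := (`]0, 1[%classic : set R).
Implicit Types (w zeta eta : C) (q : R) (h : L1 R).

Definition transfer_series w q (f : R -> C) (x : R) : C^o :=
  limn (series (fun n => w ^+ n.+1 * (q / (n.+1%:R + x) ^+ 2)%:C *
                         patch (fun=> 0) D f (q / (n.+1%:R + x)) : C^o)).

(* For `|w| = 1 and q > 0 the series converges absolutely for almost every x
   in (0,1), its sum is integrable (so the default value 0 of [L1class] is not
   used), and its class does not depend on the representative of h. *)
Definition transfer w q h : L1 R := L1class (transfer_series w q (L1val_of h)).

(* f has bounded variation on the open interval (0,1). *)
Definition BV01 (f : R -> R) :=
  exists M : R, forall a b : R, 0 < a -> a <= b -> b < 1 ->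
    (total_variation a b f <= M%:E)%E.

(* Membership of a class in BV((0,1)): some representative has bounded
   variation; an invariant density being real-valued, real representatives
   suffice. *)
Definition L1_BV h :=
  exists2 f : R -> R, BV01 f & {ae mu, forall x, D x -> L1val_of h x = (f x)%:C}.

Definition invariant_density q h :=
  [/\ L1_BV h, transfer 1 q h = h,
      {ae mu, forall x, D x -> 0 < L1val_of h x} & L1int h = 1].

Definition Pi zeta eta (rho : L1 R) h : L1 R :=
  if (zeta == 1) && (eta == 1) then L1int h *: rho else 0.

End Transfer.

(* Main.v *)
From HB Require Import structures.
Require Import Defs.
From mathcomp Require Import all_boot all_order all_algebra.
From mathcomp Require Import complex ring lra zify.
From mathcomp Require Import all_classical all_reals all_analysis.
From mathcomp Require Import measurable_realfun.

Import Order.TTheory GRing.Theory Num.Theory.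
Import numFieldNormedType.Exports.
Import Normc.

(** Write the inverse branches of the map x |-> q/x mod 1 as y_n(x) = q/(n + x).
The operator with parameter w sums w^n q/(n + x)^2 h(y_n(x)), and the weight
q/(n + x)^2 is the Jacobian of y_n.  So a transfer operator moves the mass
that h has on the image of each branch, rotates it by w^n and adds up the
pieces ([integral_branch], [integral_Pe]).  It contracts L^1, with a loss of
mass exactly where the pieces interfere, and the theorem measures both ends of
this: functions on which there is no interference, which give the spectrum, and
functions on which interference is unavoidable, which give the closure of the
range.

Spectrum.  Outside the closed unit disc the Neumann series inverts Q - l
([invertible_outside]).  For n >= q the image of y_n lies inside (0,1), and
carrying h to that image by the inverse branch is an isometric right inverse of
the operator ([transfer_sec]).  Different n give disjoint supports.  Hence there
are S with Q S = 1 and Dl with Q Dl = 0 whose values have disjoint supports.  If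
|l| < 1, the series of l^k S^k Dl x is an eigenvector for l, and these series
form an infinite-dimensional space ([kernel_infinite]).  If |l| = 1, the partial
sums of l^k S^k Dl u / (k + 1) have images under Q - l that converge, although
the sums themselves diverge like the harmonic series; the iterates of Q / l
forbid a preimage of the limit ([range_not_closed]).  Both exclude the Fredholm
property, so the spectrum and the Fredholm spectrum are the closed disc.

Closure of the range.  If Q^n h tends to 0, then h is the limit of
h - Q^n h, which lies in the range of 1 - Q.  So it is enough that Q^n h tends
to 0 on a dense set, namely on step functions, of integral 0 when
zeta = eta = 1 ([decays_V]).  The Lasota-Yorke inequality [lasota_yorke] keeps
the variation of the iterates of such a function bounded.  A nonnegative function of mass at least 1/2 and
bounded variation is at least 1/4 on one interval of a fixed partition, and the
images of an interval under the expanding map cover (0,1), so that a fixed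
iterate of the positive operator brings it above a fixed constant
([lower_bound]).  Therefore, as long as the norms of the iterates stay away
from 0, mass is lost at a uniform rate.  If a parameter
differs from 1, then on two consecutive branches the phases differ while the
function is nearly constant ([loss], [word_loss]).  If both are 1, the positive
and negative parts of a real function of integral 0 overlap ([real_contraction]).
Iterating gives the decay ([decay]).  In the case zeta = eta = 1 the range
cannot be larger, because the operator preserves integrals
([int_rlf_transfer]). *)

Set Implicit Arguments.
Unset Strict Implicit.
Unset Printing Implicit Defensive.

Local Open Scope classical_set_scope.
Local Open Scope ring_scope.
Local Open Scope complex_scope.
Local Open Scope quotient_scope.

(** * Measures with a density *)

Section DensityMeasure.
Context {R : realType}.
Local Notation mu := (@lebesgue_measure R).
Local Open Scope ereal_scope.

(** The hypotheses are arguments, so that the structure of measure is inferred. *)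
Definition dens (w : R -> R) (mw : measurable_fun setT w)
    (w0 : forall x, (0 <= w x)%R) : set (measurableTypeR R) -> \bar R :=
  fun U => \int[mu]_(x in U) (w x)%:E.

Variables (w : R -> R) (mw : measurable_fun setT w)
  (w0 : forall x, (0 <= w x)%R).

Let dens0 : dens mw w0 set0 = 0.
Proof. by rewrite /dens integral_set0. Qed.

Let dens_ge0 U : 0 <= dens mw w0 U.
Proof. by apply: integral_ge0 => x _; rewrite lee_fin. Qed.

Let dens_sigma_additive : semi_sigma_additive (dens mw w0).
Proof.
move=> /= F mF tF mUF; rewrite /dens; apply: cvg_toP.
  apply: ereal_nondecreasing_is_cvgn => m n mn.
  apply: lee_sum_nneg_natr => // k _ _.
  by apply: integral_ge0 => /= x _; rewrite lee_fin.
rewrite ge0_integral_bigcup//=.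
- by apply/measurable_EFinP; exact: measurable_funTS.
- by move=> x _; rewrite lee_fin.
Qed.

HB.instance Definition _ := isMeasure.Build _ _ _ (dens mw w0)
  dens0 dens_ge0 dens_sigma_additive.

Import HBNNSimple.

Let integral_dens_nnsfun (f : {nnsfun (measurableTypeR R) >-> R}) :
  \int[dens mw w0]_x (f x)%:E = \int[mu]_x ((w x)%:E * (f x)%:E).
Proof.
have mf r : measurable (f @^-1` [set r]) by exact: measurable_funPTI.
have term_ge0 r x : 0 <= (w x)%:E * (r * \1_(f @^-1` [set r]) x)%:E.
  by rewrite mule_ge0 ?lee_fin// -lee_fin EFinM nnfun_muleindic_ge0.
transitivity (\sum_(r \in range f) \int[mu]_x ((w x)%:E * (r * \1_(f @^-1` [set r]) x)%:E)).
  rewrite integralT_nnsfun sintegralE; apply: eq_fsbigr => r; rewrite inE => -[y _ <-].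
  rewrite [X in _ * X]integral_mkcond -ge0_integralZl//; last 3 first.
  - apply: (measurable_restrictT _ _).1; first exact: mf.
    exact/measurable_EFinP/measurable_funTS.
  - by move=> x _; rewrite patchE; case: ifP => // _; rewrite lee_fin.
  - by rewrite lee_fin.
  apply: eq_integral => x _; rewrite patchE indicE.
  by case: ifP => _; rewrite ?mulr1 ?mulr0 ?mule0// muleC.
rewrite -ge0_integral_fsum//; last first.
  move=> r; apply: emeasurable_funM; first exact/measurable_EFinP.
  by apply/measurable_EFinP/measurable_funM => //; exact: measurable_indic.
apply: eq_integral => x _; rewrite [in RHS](fimfunE f) -fsumEFin// ge0_mule_fsumr// => r.
by rewrite EFinM nnfun_muleindic_ge0.
Qed.

(** Both sides are additive and continuous along increasing sequences, so that
it is enough to compare them on simple functions. *)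
Lemma integral_dens (f : R -> \bar R) :
  measurable_fun setT f -> (forall x, 0 <= f x) ->
  \int[dens mw w0]_x f x = \int[mu]_x ((w x)%:E * f x).
Proof.
move=> mf f0.
pose f_ := @nnsfun_approx _ (measurableTypeR R) R setT measurableT f mf.
transitivity (lim (\int[dens mw w0]_x (f_ n x)%:E @[n --> \oo])).
  rewrite -monotone_convergence//=.
  - apply: eq_integral => ? /[!inE] xD; apply/esym/cvg_lim => //=.
    exact: cvg_nnsfun_approx.
  - by move=> n; exact/measurable_EFinP.
  - by move=> n ? _; rewrite lee_fin.
  - by move=> ? _ ? ? mn; rewrite lee_fin; exact/lefP/nd_nnsfun_approx.
under eq_fun do rewrite integral_dens_nnsfun.
rewrite -monotone_convergence//=.
- apply: eq_integral => x _; apply/cvg_lim => //; apply: cvgeZl => //.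
  exact: cvg_nnsfun_approx.
- by move=> n; apply: emeasurable_funM; exact/measurable_EFinP.
- by move=> n x _; rewrite mule_ge0// lee_fin.
- move=> x _ m n mn; rewrite lee_wpmul2l ?lee_fin//.
  exact/lefP/nd_nnsfun_approx.
Qed.

End DensityMeasure.

(** * Inverse branches *)

Section Branches.
Context {R : realType}.
Local Notation mu := (@lebesgue_measure R).
Local Notation D := (`]0, 1[%classic : set R).

(** The index is shifted by one: branch n here is x |-> q / (n + 1 + x). *)
Definition invbr (q : R) (n : nat) (x : R) : R := q / (n.+1%:R + x).
(** The absolute value of the derivative of the branch. *)
Definition wt (q : R) (n : nat) (x : R) : R := q / (n.+1%:R + x) ^+ 2.
(** The image of (0,1) under branch n; for n + 1 < q it sticks out of (0,1). *)
Definition cell (q : R) (n : nat) : set R :=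
  `]q / n.+2%:R, q / n.+1%:R[%classic.

Lemma measurable_D : measurable (D : set (measurableTypeR R)).
Proof. exact: measurable_itv. Qed.

Lemma measurable_cell q n : measurable (cell q n : set (measurableTypeR R)).
Proof. exact: measurable_itv. Qed.

Variable q : R.
Hypothesis q0 : 0 < q.

Lemma addS_gt0 (n : nat) (x : R) : 0 <= x -> 0 < n.+1%:R + x.
Proof. by move=> x0; rewrite ltr_wpDr// ltr0Sn. Qed.

Lemma wt_ge0 n x : 0 <= wt q n x.
Proof. by rewrite /wt divr_ge0// ?sqr_ge0// ltW. Qed.

Lemma invbr_cell n x : D x -> cell q n (invbr q n x).
Proof.
rewrite /cell /= !in_itv/= => /andP[x0 x1]; rewrite /invbr.
have n1 : (0 : R) < n.+1%:R by rewrite ltr0Sn.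
have h := addS_gt0 n (ltW x0).
rewrite !ltr_pM2l// !ltf_pV2 ?posrE ?ltr0Sn//.
by rewrite ltrDl x0 /= -[X in _ < X]natr1 ltrD2l x1.
Qed.

Lemma continuous_invbr n x : 0 <= x -> {for x, continuous (invbr q n)}.
Proof.
move=> x0; apply: cvgM; first exact: cvg_cst.
apply: cvgV; first by rewrite gt_eqF// addS_gt0.
by apply: cvgD; [exact: cvg_cst|exact: cvg_id].
Qed.

Lemma continuous_wt n x : 0 <= x -> {for x, continuous (wt q n)}.
Proof.
move=> x0; apply: cvgM; first exact: cvg_cst.
apply: cvgV; first by rewrite gt_eqF// exprn_gt0// addS_gt0.
apply: (@cvg_comp _ _ _ (fun x => n.+1%:R + x) (fun x => x ^+ 2)
  _ (nbhs (n.+1%:R + x))); last exact: exprn_continuous.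
by apply: cvgD; [exact: cvg_cst|exact: cvg_id].
Qed.

Lemma measurable_invbr n : measurable_fun D (invbr q n).
Proof.
apply: open_continuous_measurable_fun => //.
move=> x; rewrite inE/= in_itv/= => /andP[x0 _].
exact: continuous_invbr (ltW x0).
Qed.

Lemma measurable_wt n : measurable_fun D (wt q n).
Proof.
apply: open_continuous_measurable_fun => //.
move=> x; rewrite inE/= in_itv/= => /andP[x0 _].
exact: continuous_wt (ltW x0).
Qed.

Lemma integral_wt n (t : R) : 0 <= t ->
  (\int[mu]_(x in `]0%R, t[) (wt q n x)%:E =
   (q / n.+1%:R - q / (n.+1%:R + t))%:E)%E.
Proof.
rewrite le_eqVlt => /predU1P[<-|t0].
  by rewrite addr0 subrr set_itvoo0 integral_set0.
have cw : {within `[0, t], continuous (wt q n)}.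
  apply/continuous_in_subspaceT => x; rewrite inE/= in_itv/= => /andP[x0 _].
  exact: continuous_wt.
pose F (x : R) : R := - invbr q n x.
have dF (x : R) : 0 <= x -> is_derive x (1 : R) F (wt q n x).
  move=> x0; rewrite /F /invbr.
  have nx : n.+1%:R + x != 0 by rewrite gt_eqF// addS_gt0.
  have h1 : is_derive x (1 : R) (fun y : R => n.+1%:R + y) 1.
    have -> : (fun y : R => n.+1%:R + y) = (cst n.+1%:R + id) by [].
    rewrite -[X in is_derive _ _ _ X]add0r; apply: is_deriveD.
  have h2 : is_derive x (1 : R) F _ := is_deriveN (is_deriveZ q (is_deriveV nx h1)).
  apply: is_derive_eq h2 _.
  by rewrite /wt /GRing.scale/= mulr1 mulrN opprK.
rewrite -(@integral_itv_bndoo _ _ _ _ true false); last first.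
  apply/measurable_EFinP; apply: open_continuous_measurable_fun => //.
  move=> x; rewrite inE/= in_itv/= => /andP[x0 _].
  exact: continuous_wt (ltW x0).
rewrite (@continuous_FTC2 _ _ F)//.
- by rewrite -EFinB /F /invbr addr0 opprK addrC.
- split.
  + by move=> x; rewrite in_itv/= => /andP[x0 _]; have [] := dF _ (ltW x0).
  + apply: cvg_at_right_filter; apply: cvgN; exact: continuous_invbr.
  + apply: cvg_at_left_filter; apply: cvgN; apply: continuous_invbr.
    exact: ltW.
- move=> x; rewrite in_itv/= => /andP[x0 _].
  by have [_] := dF _ (ltW x0); rewrite derive1E.
Qed.

End Branches.

(** * Change of variables along an inverse branch *)

Section ChangeOfVariables.
Context {R : realType}.
Local Notation mu := (@lebesgue_measure R).
Local Notation D := (`]0, 1[%classic : set R).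
Variables (q : R) (q0 : 0 < q) (n : nat).

Let mD : measurable (D : set (measurableTypeR R)) := @measurable_D R.

Let w : R -> R := wt q n \_ D.
Let phi : R -> R := invbr q n \_ D.

Let mw : measurable_fun setT w.
Proof.
by apply: (measurable_restrictT _ _).1; [exact: measurable_itv|exact: measurable_wt].
Qed.

Let mphi : measurable_fun setT phi.
Proof.
by apply: (measurable_restrictT _ _).1; [exact: measurable_itv|exact: measurable_invbr].
Qed.

Let w0 x : 0 <= w x.
Proof. by rewrite /w patchE; case: ifP => // _; exact: wt_ge0. Qed.

Let ic : R -> R := \1_(cell q n).

Let mic : measurable_fun setT ic.
Proof. by apply: measurable_indic; exact: measurable_cell. Qed.

Let ic0 x : 0 <= ic x. Proof. by rewrite /ic indicE. Qed.

Let rays (a : R) :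
  pushforward (dens mw w0) phi `]a, +oo[%classic = dens mic ic0 `]a, +oo[%classic.
Proof.
set c := q / n.+2%:R; set d := q / n.+1%:R.
have n1 : (0 : R) < n.+1%:R by rewrite ltr0Sn.
have n2 : (0 : R) < n.+2%:R by rewrite ltr0Sn.
have c0 : 0 < c by rewrite divr_gt0.
have cd : c < d.
  by rewrite /c /d ltr_pM2l// ltf_pV2 ?posrE// ltr_nat.
pose a' := Num.max c (Num.min a d).
have ca' : c <= a' by rewrite le_max lexx.
have a'd : a' <= d by rewrite ge_max ltW//= ge_min lexx orbT.
have a'0 : 0 < a' by exact: lt_le_trans ca'.
pose t := q / a' - n.+1%:R.
have t0 : 0 <= t.
  by rewrite subr_ge0 ler_pdivlMr// mulrC -ler_pdivlMr.
have qa' : q / (n.+1%:R + t) = a'.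
  by rewrite /t addrC subrK invf_div mulrCA divff ?mulr1// gt_eqF.
have t1 : t <= 1.
  by rewrite lerBlDr addrC natr1 ler_pdivrMr// mulrC -ler_pdivrMr.
rewrite /pushforward /dens.
transitivity (d - a')%:E.
  rewrite -[in RHS]qa' -integral_wt// [LHS]integral_mkcond [RHS]integral_mkcond.
  apply: eq_integral => x _; rewrite !patchE/= /w patchE.
  have [xt|xt] := boolP (x \in `]0%R, t[%classic).
    have Dx : x \in D.
      move: xt; rewrite !inE/= !in_itv/= => /andP[-> xt]/=.
      exact: lt_le_trans t1.
    rewrite Dx mem_set//= in_itv/= andbT /phi patchE Dx.
    move: xt; rewrite inE/= in_itv/= => /andP[x0 xt].
    have : a' < invbr q n x.
      rewrite -qa' /invbr ltr_pM2l// ltf_pV2 ?posrE ?ltrD2l//.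
        exact: addS_gt0.
      by apply: addS_gt0; exact: ltW.
    have : invbr q n x < d.
      have /(invbr_cell q0 n) : D x by move: Dx; rewrite inE.
      by rewrite /cell/= in_itv/= => /andP[].
    move=> h; rewrite gt_max gt_min => /andP[_ /orP[//|]].
    by rewrite ltNge (ltW h).
  case: ifPn => // xp; case: ifPn => // Dx; exfalso.
  move: xp; rewrite inE/= in_itv/= andbT /phi patchE Dx => ax.
  have := Dx; rewrite inE/= in_itv/= => /andP[x0 x1].
  move/negP: xt; apply; rewrite inE/= in_itv/= x0/=.
  have : a' < invbr q n x.
    have /(invbr_cell q0 n) : D x by move: Dx; rewrite inE.
    rewrite /cell/= in_itv/= => /andP[cx _].
    by rewrite gt_max cx/= gt_min ax.
  rewrite -[X in X < _]qa' /invbr ltr_pM2l// ltf_pV2 ?posrE ?ltrD2l//.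
    exact: addS_gt0.
  by apply: addS_gt0; exact: ltW.
have -> : (\int[mu]_(x in `]a, +oo[) (ic x)%:E = mu `]a', d[)%E.
  rewrite integral_indic//; [|exact: measurable_itv..].
  congr (mu _); apply/seteqP; split => x; rewrite /cell/= !in_itv/= andbT.
    by move=> [/andP[cx xd] ax]; rewrite gt_max cx/= gt_min ax xd.
  move=> /andP[]; rewrite gt_max gt_min => /andP[-> /orP[ax|dx]] xd.
    by rewrite xd ax.
  by move: dx; rewrite ltNge (ltW xd).
rewrite lebesgue_measure_itv/= lte_fin; case: ifPn => [_|]; first by rewrite EFinB.
by rewrite -leNgt => da; rewrite (_ : d = a') ?subrr//; apply/eqP; rewrite eq_le da a'd.
Qed.

Let rays_sets : set (set (measurableTypeR R)) := [set A | exists x, A = `]x, +oo[%classic].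

(** The push-forward of the density wt along the branch and Lebesgue measure
on the cell agree on the rays ]a, +oo[, by [integral_wt]; the rays are stable
under intersection and generate the Borel sets. *)
Lemma pushforward_branch (U : set (measurableTypeR R)) : measurable U ->
  pushforward (dens mw w0) phi U = dens mic ic0 U.
Proof.
pose m1 := [the {measure set (measurableTypeR R) -> \bar R} of
  pushforward (dens mw w0) (phi : measurableTypeR R -> measurableTypeR R)].
pose m2 := [the {measure set (measurableTypeR R) -> \bar R} of dens mic ic0].
move=> mU; rewrite -[LHS]/(m1 mphi U) -[RHS]/(m2 U).
apply: (@measure_unique _ R (measurableTypeR R) rays_sets
  (fun k => `](- k%:R), +oo[%classic : set R)) mU.
- exact: RGenOInfty.measurableE.
- move=> _ _ [x ->] [y ->]; exists (Num.max x y).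
  apply/seteqP; split => z/=; rewrite !in_itv/= !andbT gt_max.
    by move=> [-> ->].
  by move=> /andP[-> ->].
- by move=> k; eexists; reflexivity.
- apply/seteqP; split => // x _.
  exists (Num.bound `|x|) => //=; rewrite in_itv/= andbT ltrNl.
  by apply: le_lt_trans (archi_boundP (normr_ge0 _)); rewrite -normrN ler_norm.
- by move=> _ [x ->]; exact: rays.
- move=> k; rewrite [X in (X < _)%E](_ : _ = dens mic ic0 `](- k%:R), +oo[%classic); last exact: rays.
  rewrite /dens; apply: (@le_lt_trans _ _ (mu (cell q n))).
    rewrite integral_indic//; [|exact: measurable_itv..].
    by apply: le_measure; rewrite ?inE//; [apply: measurableI|]; exact: measurable_itv.
  by rewrite /cell lebesgue_measure_itv/=; case: ifP => // _; rewrite -EFinB ltry.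
Qed.

(** The weight is the Jacobian of the branch. *)
Lemma integral_branch (g : R -> \bar R) :
  measurable_fun setT g -> (forall x, 0 <= g x)%E ->
  (\int[mu]_(x in D) ((wt q n x)%:E * g (invbr q n x)) =
   \int[mu]_(y in cell q n) g y)%E.
Proof.
move=> mg g0.
transitivity (\int[mu]_x ((w x)%:E * g (phi x)))%E.
  rewrite integral_mkcond; apply: eq_integral => x _.
  by rewrite /w /phi !patchE; case: ifPn => // _; rewrite mul0e.
rewrite -(integral_dens mw w0)//; last first.
  by apply: measurableT_comp.
transitivity (\int[pushforward (dens mw w0) (phi : measurableTypeR R -> measurableTypeR R)]_x g x)%E.
  rewrite ge0_integral_pushforward//.
transitivity (\int[dens mic ic0]_x g x)%E.
  apply: eq_measure_integral => A mA _; exact: pushforward_branch.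
rewrite integral_dens// [RHS]integral_mkcond; apply: eq_integral => x _.
by rewrite patchE /ic indicE; case: ifPn => _; rewrite ?mul1e ?mul0e.
Qed.

End ChangeOfVariables.

(** * Complex series *)

Section ComplexSeries.
Context {R : realType}.
Local Notation C := R[i].

Lemma normCE (z : C) : `|z| = (normc z)%:C.
Proof. by case: z. Qed.

Lemma normc_ge0 (z : C) : 0 <= normc z.
Proof. by case: z => a b; exact: sqrtr_ge0. Qed.

Lemma normcR (x : R) : normc x%:C = `|x|.
Proof. by rewrite /normc/= expr0n/= addr0 sqrtr_sqr. Qed.

Lemma normcX (z : C) n : normc (z ^+ n) = normc z ^+ n.
Proof.
elim: n => [|n IH]; first by rewrite !expr0 normc1.
by rewrite !exprS normcM IH.
Qed.

Lemma normc_Re (z : C) : `|complex.Re z| <= normc z.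
Proof.
case: z => a b /=; rewrite -sqrtr_sqr ler_sqrt ?addr_ge0 ?sqr_ge0//.
by rewrite lerDl sqr_ge0.
Qed.

Lemma normc_Im (z : C) : `|complex.Im z| <= normc z.
Proof.
case: z => a b /=; rewrite -sqrtr_sqr ler_sqrt ?addr_ge0 ?sqr_ge0//.
by rewrite lerDr sqr_ge0.
Qed.

Lemma normc_ReIm (z : C) : normc z <= `|complex.Re z| + `|complex.Im z|.
Proof.
case: z => a b /=; rewrite -[leRHS]ger0_norm ?addr_ge0// -sqrtr_sqr.
rewrite ler_sqrt ?sqr_ge0// sqrrD !real_normK ?num_real//.
by rewrite addrAC lerDl mulrn_wge0 ?mulr_ge0.
Qed.

Lemma normcBC (x y : C) : normc (x - y) = normc (y - x).
Proof. by rewrite -normcN opprB. Qed.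

Lemma le_normc_sum (I : Type) (r : seq I) (P : pred I) (F : I -> C) :
  normc (\sum_(i <- r | P i) F i) <= \sum_(i <- r | P i) normc (F i).
Proof.
elim/big_ind2 : _ => //; first by rewrite normc0.
by move=> x1 x2 y1 y2 h1 h2; apply: le_trans (le_normcD _ _) (lerD h1 h2).
Qed.

Lemma cvgC_normcP (u : nat -> C^o) (l : C^o) :
  (u @ \oo --> l) <->
  (forall e : R, 0 < e -> \forall n \near \oo, normc (l - u n : C) < e).
Proof.
split=> [/cvgrPdist_lt h e e0|h].
  have := h e%:C; rewrite ltcR => /(_ e0).
  by apply: filterS => n; rewrite normCE ltcR.
apply/cvgrPdist_lt => e; rewrite ltcE/= => /andP[/eqP e0 e1].
have := h _ e1; apply: filterS => n hn.
rewrite normCE (_ : e = (complex.Re e)%:C) ?ltcR//.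
by move: e0; case: (e) => a b /= ->.
Qed.

Lemma cvgC_ReImP (u : nat -> C^o) (l : C^o) :
  (u @ \oo --> l) <->
  ((fun n => complex.Re (u n)) @ \oo --> complex.Re l) /\
  ((fun n => complex.Im (u n)) @ \oo --> complex.Im l).
Proof.
split.
  move=> /cvgC_normcP h; split; apply/cvgrPdist_lt => e e0;
    have := h e e0; apply: filterS => n; apply: le_lt_trans.
    by rewrite -raddfB; exact: normc_Re.
  by rewrite -raddfB; exact: normc_Im.
move=> [/cvgrPdist_lt hr /cvgrPdist_lt hi]; apply/cvgC_normcP => e e0.
have e2 : 0 < e / 2 by rewrite divr_gt0.
near=> n; apply: le_lt_trans (normc_ReIm _) _.
rewrite [ltRHS]splitr !raddfB ltrD//; near: n; [exact: hr|exact: hi].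
Unshelve. all: by end_near. Qed.

Lemma Re_series (u : nat -> C^o) n :
  complex.Re (series u n) = series (fun k => complex.Re (u k)) n.
Proof. by rewrite /series/= raddf_sum. Qed.

Lemma Im_series (u : nat -> C^o) n :
  complex.Im (series u n) = series (fun k => complex.Im (u k)) n.
Proof. by rewrite /series/= raddf_sum. Qed.

Lemma is_cvgC_ReIm (u : nat -> C^o) :
  cvgn u <-> cvgn (fun n => complex.Re (u n)) /\ cvgn (fun n => complex.Im (u n)).
Proof.
split.
  move=> /cvg_ex[l /cvgC_ReImP[h1 h2]].
  by split; apply/cvg_ex; [exists (complex.Re l)|exists (complex.Im l)].
move=> [/cvg_ex[a ha] /cvg_ex[b hb]]; apply/cvg_ex; exists (a +i* b)%C.
exact/cvgC_ReImP.
Qed.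

Lemma hausdorffC : hausdorff_space C^o.
Proof. exact: norm_hausdorff. Qed.

Lemma limC (u : nat -> C^o) : cvgn u ->
  limn u = (limn (fun n => complex.Re (u n)) +i* limn (fun n => complex.Im (u n)))%C.
Proof.
move=> cu; apply: (@cvg_lim C^o hausdorffC); apply/cvgC_ReImP.
by have /is_cvgC_ReIm[] := cu.
Qed.

Lemma cvgC_lin (a : C) (u v : nat -> C^o) (l m : C^o) :
  u @ \oo --> l -> v @ \oo --> m ->
  (fun n => a * u n + v n : C^o) @ \oo --> (a * l + m : C^o).
Proof.
move=> /cvgC_ReImP[u1 u2] /cvgC_ReImP[v1 v2]; apply/cvgC_ReImP.
have ReE (z y : C) : complex.Re (a * z + y) =
    complex.Re a * complex.Re z - complex.Im a * complex.Im z + complex.Re y.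
  by case: (a) => a1 a2; case: z => z1 z2; case: y.
have ImE (z y : C) : complex.Im (a * z + y) =
    complex.Re a * complex.Im z + complex.Im a * complex.Re z + complex.Im y.
  by case: (a) => a1 a2; case: z => z1 z2; case: y.
split.
  under eq_fun do rewrite ReE; rewrite ReE.
  by apply: cvgD => //; apply: cvgB; apply: cvgM => //; exact: cvg_cst.
under eq_fun do rewrite ImE; rewrite ImE.
by apply: cvgD => //; apply: cvgD; apply: cvgM => //; exact: cvg_cst.
Qed.

Lemma normc_lim_le (u : nat -> C^o) (l : C^o) (b : nat -> R) (c : R) :
  u @ \oo --> l -> b @ \oo --> c -> (forall n, normc (u n : C) <= b n) ->
  normc (l : C) <= c.
Proof.
move=> /cvgC_normcP hu /cvgrPdist_lt hb ub; rewrite leNgt; apply/negP => lc.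
have e0 : 0 < (normc (l : C) - c) / 2 by rewrite divr_gt0// subr_gt0.
have [n [h1 h2]] := filter_ex (filterI (hu _ e0) (hb _ e0)).
have h3 := ub n.
have h4 : normc (l : C) <= normc (l - u n : C) + normc (u n : C).
  by apply: le_trans (le_normcD _ _); rewrite subrK.
move: h1 h2; move: (normc (l - u n)) h4 => d h4 h1; rewrite ltr_distl => /andP[].
lra.
Qed.

Lemma nneseries_fin (v : nat -> R) : (forall n, 0 <= v n) ->
  (\sum_(n <oo) (v n)%:E < +oo)%E ->
  cvgn (series v) /\ (\sum_(n <oo) (v n)%:E = (limn (series v))%:E)%E.
Proof.
move=> v0 fin.
have cn : cvgn (series v).
  apply: nondecreasing_is_cvgn; first by apply: nondecreasing_series.
  exists (fine (\sum_(n <oo) (v n)%:E)%E) => _ [n _ <-].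
  rewrite -lee_fin fineK; last first.
    by rewrite ge0_fin_numE//; apply: nneseries_ge0 => k _ _; rewrite lee_fin.
  rewrite /series/= -sumEFin; apply: nneseries_lim_ge => k _.
  by rewrite lee_fin.
split=> //.
rewrite -EFin_lim//; apply: congr_lim; apply/funext => n /=.
by rewrite /series/= sumEFin.
Qed.

(** The real and imaginary parts are dominated by the modulus. *)
Lemma abs_cvgC (u : nat -> C^o) :
  (\sum_(n <oo) (normc (u n : C))%:E < +oo)%E ->
  cvgn (series u) /\
  ((normc (limn (series u) : C))%:E <= \sum_(n <oo) (normc (u n : C))%:E)%E.
Proof.
move=> fin.
have [cn cE] := nneseries_fin (fun n => normc_ge0 (u n)) fin.
have cvg : cvgn (series u).
  apply/is_cvgC_ReIm; split.
    under eq_fun do rewrite Re_series.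
    apply: normed_cvg; apply: series_le_cvg cn => n/=; first [exact: normr_ge0|exact: normc_ge0|exact: normc_Re].
  under eq_fun do rewrite Im_series.
  apply: normed_cvg; apply: series_le_cvg cn => n/=; first [exact: normr_ge0|exact: normc_ge0|exact: normc_Im].
split=> //.
rewrite cE lee_fin; apply: normc_lim_le cvg cn _ => n.
exact: le_normc_sum.
Qed.

End ComplexSeries.

(** * Measurability of pointwise limits *)

Section ConvergenceSet.
Context {R : realType}.

(** The Cauchy criterion with only countable quantifiers, from which the
measurability of the set of convergence can be read off. *)
Lemma cvgn_CauchyP (s : nat -> R) : cvgn s <->
  forall k : nat, exists N : nat, forall m n : nat,
    `|s (N + m)%N - s (N + n)%N| <= k.+1%:R^-1.
Proof.
split=> [/cvg_ex[l /cvgrPdist_le sl] k|H].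
  have e0 : (0 : R) < k.+1%:R^-1 / 2 by rewrite divr_gt0// invr_gt0.
  have [N _ HN] := sl _ e0; exists N => m n.
  have h1 := HN (N + m)%N (leq_addr _ _); have h2 := HN (N + n)%N (leq_addr _ _).
  rewrite [leRHS]splitr; apply: le_trans (ler_distD l _ _) (lerD _ h2).
  by rewrite distrC.
apply/cauchy_cvgP; apply: cauchy_exP => e e0.
have [k ke] : exists k : nat, k.+1%:R^-1 < e.
  exists (Num.bound e^-1); rewrite invf_plt ?posrE//.
  by apply: lt_le_trans (archi_boundP _) _; rewrite ?ler_nat// ltW// invr_gt0.
have [N HN] := H k; exists (s N); exists N => // m /= Nm.
rewrite /ball/=; have := HN 0%N (m - N)%N; rewrite addn0 subnKC// => h.
exact: le_lt_trans h ke.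
Qed.

Lemma measurable_cvgn (D : set (measurableTypeR R)) (s : nat -> R -> R) :
  measurable D -> (forall n, measurable_fun D (s n)) ->
  measurable (D `&` [set x | cvgn (s^~ x)]).
Proof.
move=> mD ms.
rewrite (_ : _ `&` _ = \bigcap_k \bigcup_N \bigcap_m \bigcap_n
   (D `&` [set x | `|s (N + m)%N x - s (N + n)%N x| <= k.+1%:R^-1])).
  apply: bigcapT_measurable => k; apply: bigcupT_measurable => N.
  apply: bigcapT_measurable => m; apply: bigcapT_measurable => n.
  rewrite -[X in _ `&` X](_ : (fun x => `|s (N + m)%N x - s (N + n)%N x|) @^-1`
    `]-oo, k.+1%:R^-1] = _); last by apply/seteqP; split => x/=; rewrite in_itv.
  have mf : measurable_fun D (fun x => `|s (N + m)%N x - s (N + n)%N x|).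
    by apply: measurableT_comp => //; exact: measurable_funB.
  by apply: mf => //; exact: measurable_itv.
apply/seteqP; split=> [x [Dx /cvgn_CauchyP H] k _|x H].
  by have [N HN] := H k; exists N => // m _ n _; split=> //=.
split.
  by have [N _ /(_ 0%N I 0%N I)[]] := H 0%N I.
by apply/cvgn_CauchyP => k; have [N _ HN] := H k I; exists N => m n;
  have [] := HN m I n I.
Qed.

(** A series of functions need not converge everywhere, and its limit then has
a default value; this is how measurability survives. *)
Lemma measurable_limn_if (D : set (measurableTypeR R)) (s : nat -> R -> R) (P : set R) (c : R) :
  measurable D -> (forall n, measurable_fun D (s n)) ->
  measurable (D `&` P) -> (forall x, D x -> P x -> cvgn (s^~ x)) ->
  measurable_fun D (fun x => if `[< P x >] then limn (s^~ x) else c).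
Proof.
move=> mD ms mP sP.
pose s' n x := if `[< P x >] then s n x else c.
apply: (@measurable_fun_cvg _ _ _ _ s').
- move=> n; apply: measurable_fun_if => //.
  + apply: (measurable_fun_bool true); rewrite (_ : _ @^-1` _ = P)//.
    by apply/seteqP; split => x /=; [move=> /asboolP|move=> Px; apply/asboolP].
  + exact: (measurable_funS mD (@subIsetl _ _ _) (ms n)).
- move=> x Dx; rewrite /s'; case: asboolP => [Px|_]; last exact: cvg_cst.
  exact: sP.
Qed.

End ConvergenceSet.

(** * The transfer operator on functions *)

Section Transfer.
Context {R : realType}.
Local Notation C := R[i].
Local Notation mu := (@lebesgue_measure R).
Local Notation D := (`]0, 1[%classic : set R).
Variables (q : R) (q0 : 0 < q).

Let mD : measurable (D : set (measurableTypeR R)) := @measurable_D R.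

Lemma wt_gt0 n (x : R) : 0 <= x -> 0 < wt q n x.
Proof. by move=> x0; rewrite /wt divr_gt0// exprn_gt0// addS_gt0. Qed.

Definition nf (f : R -> C) : R -> \bar R := fun x => (normc (f x))%:E.

Lemma nf_ge0 f x : (0 <= nf f x)%E.
Proof. by rewrite lee_fin normc_ge0. Qed.

(** The untwisted operator on nonnegative functions.  It takes values in the
extended reals, so that it is defined pointwise and can be iterated without any
question of convergence; it dominates every twisted operator
([transfer_series_le]). *)
Definition Pe (u : R -> \bar R) (x : R) : \bar R :=
  (\sum_(n <oo) (wt q n x)%:E * (u \_ D) (invbr q n x))%E.

Lemma restrict_ge0 (u : R -> \bar R) y :
  (forall x, D x -> 0 <= u x)%E -> (0 <= (u \_ D) y)%E.
Proof. by move=> u0; rewrite patchE; case: ifP => // /set_mem; exact: u0. Qed.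

Lemma Pe_term_ge0 (u : R -> \bar R) n x : (forall x, D x -> 0 <= u x)%E ->
  (0 <= (wt q n x)%:E * (u \_ D) (invbr q n x))%E.
Proof.
by move=> u0; rewrite mule_ge0// ?lee_fin ?wt_ge0//; exact: restrict_ge0.
Qed.

Lemma Pe_ge0 (u : R -> \bar R) x : (forall x, D x -> 0 <= u x)%E -> (0 <= Pe u x)%E.
Proof. by move=> u0; apply: nneseries_ge0 => n _ _; exact: Pe_term_ge0. Qed.

Lemma le_Pe (u v : R -> \bar R) x : (forall x, D x -> 0 <= u x)%E ->
  (forall x, D x -> u x <= v x)%E -> (Pe u x <= Pe v x)%E.
Proof.
move=> u0 uv; apply: lee_nneseries => [n _ _|n _]; first exact: Pe_term_ge0.
rewrite lee_wpmul2l ?lee_fin ?wt_ge0// !patchE.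
by case: ifP => // /set_mem; exact: uv.
Qed.

Lemma Pe_ge_term (u : R -> \bar R) n x : (forall x, D x -> 0 <= u x)%E ->
  ((wt q n x)%:E * (u \_ D) (invbr q n x) <= Pe u x)%E.
Proof.
move=> u0; apply: le_trans; last first.
  by apply: (nneseries_lim_ge n.+1) => k _ _; exact: Pe_term_ge0.
rewrite big_nat_recr//= leeDr//; apply: sume_ge0 => k _; exact: Pe_term_ge0.
Qed.

Lemma measurable_Pe_term (u : R -> \bar R) n : measurable_fun D u ->
  measurable_fun D (fun x => (wt q n x)%:E * (u \_ D) (invbr q n x))%E.
Proof.
move=> mu; apply: emeasurable_funM.
  by apply/measurable_EFinP; exact: measurable_wt.
apply: (@measurableT_comp _ _ _ _ _ _ (u \_ D)); last exact: measurable_invbr.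
by apply: (measurable_restrictT _ _).1.
Qed.

Lemma measurable_Pe (u : R -> \bar R) : (forall x, D x -> 0 <= u x)%E ->
  measurable_fun D u -> measurable_fun D (Pe u).
Proof.
move=> u0 mu; apply: ge0_emeasurable_sum => [n x Dx _|n _].
  exact: Pe_term_ge0.
exact: measurable_Pe_term.
Qed.

Lemma trivIset_cell : trivIset setT (cell q).
Proof.
apply: ltn_trivIset => j i ij; apply/seteqP; split => // y [].
rewrite /cell/= !in_itv/= => /andP[h1 h2] /andP[h3 h4].
have : q / j.+1%:R <= q / i.+2%:R.
  by rewrite ler_pM2l// lef_pV2 ?posrE ?ltr0Sn// ler_nat.
by rewrite leNgt (lt_trans h1 h4).
Qed.

Lemma cell_cover (y : R) : 1 < q -> D y ->
  (exists n, y = q / n.+1%:R) \/ exists n, cell q n y.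
Proof.
move=> q1; rewrite /= in_itv/= => /andP[y0 y1].
have qy1 : 1 < q / y by rewrite ltr_pdivlMr// mul1r (lt_trans y1).
have := truncn_itv (ltW (lt_trans ltr01 qy1)).
set m := Num.truncn _ => /andP[h1 h2].
have m0 : (0 < m)%N.
  by rewrite -ltnS -(ltr_nat R); exact: lt_trans qy1 h2.
move: h1; rewrite le_eqVlt => /predU1P[h|h].
  left; exists m.-1; rewrite prednK// h invf_div mulrCA divff ?mulr1//.
  by rewrite gt_eqF// (lt_trans _ q1).
right; exists m.-1; rewrite /cell/= in_itv/= prednK//; apply/andP; split.
  by rewrite ltr_pdivrMr// mulrC -ltr_pdivrMr.
by rewrite ltr_pdivlMr ?ltr0n// mulrC -ltr_pdivlMr.
Qed.

(** Each branch carries the mass of its cell to (0,1), and the cells form a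
partition of (0,1) up to a countable set. *)
Lemma integral_Pe (u : R -> \bar R) : 1 < q -> (forall x, D x -> 0 <= u x)%E ->
  measurable_fun D u -> (\int[mu]_(x in D) Pe u x = \int[mu]_(x in D) u x)%E.
Proof.
move=> q1 u0 mu'.
have mr : measurable_fun setT (u \_ D) by apply: (measurable_restrictT _ _).1.
rewrite integral_nneseries//; last 2 first.
- by move=> n; exact: measurable_Pe_term.
- by move=> n x _; exact: Pe_term_ge0.
transitivity (\sum_(n <oo) \int[mu]_(y in cell q n) (u \_ D) y)%E.
  by apply: eq_eseriesr => n _; rewrite integral_branch// => x; exact: restrict_ge0.
have mc k : measurable (cell q k : set (measurableTypeR R)) by exact: measurable_cell.
rewrite -ge0_integral_bigcup//; last 3 first.
- exact: measurable_funTS.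
- by move=> x _; exact: restrict_ge0.
- exact: trivIset_cell.
pose N := range (fun n => q / n.+1%:R) : set (measurableTypeR R).
have cN : countable N by apply: sub_countable (card_image_le _ _) _.
have mN : measurable N by exact: countable_measurable.
rewrite -integral_mkcondr [RHS](@ge0_negligible_integral _ _ _ _ _ N)//; last first.
  exact: countable_lebesgue_measure0.
congr (integral _ _ _); apply/seteqP; split => y.
  move=> [[n _ yn] Dy]; split=> // -[k _ ky].
  move: yn; rewrite /cell/= in_itv/= -ky !ltr_pM2l// !ltf_pV2 ?posrE ?ltr0Sn//.
  by rewrite !ltr_nat !ltnS => /andP[h1]; rewrite ltnNge h1.
move=> [Dy Ny]; split=> //; have [[n yn]|[n yn]] := cell_cover q1 Dy.
  by exfalso; apply: Ny; exists n.
by exists n.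
Qed.
Definition tterm (w : C) (f : R -> C) (x : R) (n : nat) : C^o :=
  w ^+ n.+1 * (wt q n x)%:C * patch (fun=> 0) D f (invbr q n x).

Lemma transfer_seriesE w f x : transfer_series w q f x = limn (series (tterm w f x)).
Proof. by []. Qed.

Lemma normc_tterm w f x n : normc w = 1 ->
  (normc (tterm w f x n : C))%:E =
  ((wt q n x)%:E * (nf f \_ D) (invbr q n x))%E.
Proof.
move=> w1; rewrite /tterm !normcM normcX w1 expr1n mul1r normcR.
rewrite ger0_norm ?wt_ge0// EFinM; congr (_ * _)%E.
by rewrite /restrict /patch; case: ifP => // _; congr EFin; exact: normc0.
Qed.

Lemma transfer_series_cvg w f x : normc w = 1 -> (Pe (nf f) x < +oo)%E ->
  cvgn (series (tterm w f x)).
Proof.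
move=> w1 fin; apply: (abs_cvgC _).1.
by under eq_eseriesr do rewrite normc_tterm//.
Qed.

Lemma transfer_series_le w f x : normc w = 1 ->
  (nf (transfer_series w q f) x <= Pe (nf f) x)%E.
Proof.
move=> w1; have [->|fin] := eqVneq (Pe (nf f) x) +oo%E; first by rewrite leey.
rewrite -ltey in fin.
rewrite /nf transfer_seriesE; apply: le_trans (abs_cvgC _).2 _.
  by under eq_eseriesr do rewrite normc_tterm//.
by under eq_eseriesr do rewrite normc_tterm//.
Qed.

Lemma measurable_tterm w f n :
  measurable_fun D (fun x => complex.Re (f x)) ->
  measurable_fun D (fun x => complex.Im (f x)) ->
  measurable_fun D (fun x => complex.Re (tterm w f x n : C)) /\
  measurable_fun D (fun x => complex.Im (tterm w f x n : C)).
Proof.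
move=> mr mi.
have mD' := mD.
have mRe : measurable_fun D (fun x => ((fun x => complex.Re (f x)) \_ D) (invbr q n x)).
  apply: (@measurableT_comp _ _ _ _ _ _ ((fun x => complex.Re (f x)) \_ D)); last exact: measurable_invbr.
  by apply: (measurable_restrictT _ _).1.
have mIm : measurable_fun D (fun x => ((fun x => complex.Im (f x)) \_ D) (invbr q n x)).
  apply: (@measurableT_comp _ _ _ _ _ _ ((fun x => complex.Im (f x)) \_ D)); last exact: measurable_invbr.
  by apply: (measurable_restrictT _ _).1.
have mw : measurable_fun D (wt q n) by exact: measurable_wt.
case E : (w ^+ n.+1) => [a b].
split.
  rewrite (_ : (fun x => _) = (fun x => (a * wt q n x) * ((fun x => complex.Re (f x)) \_ D) (invbr q n x) -
     (b * wt q n x) * ((fun x => complex.Im (f x)) \_ D) (invbr q n x))).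
    apply: measurable_funB; apply: measurable_funM => //; exact: measurable_funM.
  apply/funext => x; rewrite /tterm E /restrict /patch; case: ifP => _; last by rewrite mulr0/= !mulr0 subr0.
  by case: (f _) => c d /=; rewrite !mulr0 subr0 add0r.
rewrite (_ : (fun x => _) = (fun x => (a * wt q n x) * ((fun x => complex.Im (f x)) \_ D) (invbr q n x) +
     (b * wt q n x) * ((fun x => complex.Re (f x)) \_ D) (invbr q n x))).
  apply: measurable_funD; apply: measurable_funM => //; exact: measurable_funM.
apply/funext => x; rewrite /tterm E /restrict /patch; case: ifP => _; last by rewrite mulr0/= !mulr0 addr0.
by case: (f _) => c d /=; rewrite !mulr0 subr0 add0r.
Qed.

Lemma measurable_limn_series (t : nat -> R -> C^o) :
  (forall n, measurable_fun D (fun x => complex.Re (t n x : C)) /\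
             measurable_fun D (fun x => complex.Im (t n x : C))) ->
  measurable_fun D (fun x => complex.Re (limn (series (t^~ x)) : C)) /\
  measurable_fun D (fun x => complex.Im (limn (series (t^~ x)) : C)).
Proof.
move=> mt.
pose sr n x := series (fun k => complex.Re (t k x : C)) n.
pose si n x := series (fun k => complex.Im (t k x : C)) n.
have msr n : measurable_fun D (sr n) by apply: measurable_sum => k; have [] := mt k.
have msi n : measurable_fun D (si n) by apply: measurable_sum => k; have [] := mt k.
pose P := [set x | cvgn (series (t^~ x))].
have PE : D `&` P = (D `&` [set x | cvgn (sr^~ x)]) `&` (D `&` [set x | cvgn (si^~ x)]).
  rewrite setIACA setIid; congr (_ `&` _); apply/seteqP; split=> x /=.
    move=> /is_cvgC_ReIm; rewrite /sr /si.
    by under eq_fun do rewrite Re_series; under [X in _ /\ cvgn X]eq_fun do rewrite Im_series.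
  move=> [h1 h2]; apply/is_cvgC_ReIm.
  by under eq_fun do rewrite Re_series; under [X in _ /\ cvgn X]eq_fun do rewrite Im_series.
have mP : measurable (D `&` P).
  by rewrite PE; apply: measurableI; exact: measurable_cvgn.
have PP x : D x -> P x -> cvgn (sr^~ x) /\ cvgn (si^~ x).
  by move=> Dx Px; have : (D `&` P) x by []; rewrite PE => -[[_ ?] [_ ?]].
have lE x : limn (series (t^~ x)) = if `[< P x >] then
    (limn (sr^~ x) +i* limn (si^~ x))%C else (point : C^o).
  case: asboolP => [Px|nP].
    rewrite limC//.
    have -> : (fun n => complex.Re (series (t^~ x) n)) = sr^~ x.
      by apply/funext => n; rewrite Re_series.
    by have -> : (fun n => complex.Im (series (t^~ x) n)) = si^~ x
      by apply/funext => n; rewrite Im_series.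
  exact: dvgP.
split.
  rewrite (_ : (fun x => _) = (fun x => if `[< P x >] then limn (sr^~ x)
     else complex.Re (point : C^o))).
    by apply: measurable_limn_if => // x Dx Px; have [] := PP _ Dx Px.
  by apply/funext => x; rewrite lE; case: ifP.
rewrite (_ : (fun x => _) = (fun x => if `[< P x >] then limn (si^~ x)
     else complex.Im (point : C^o))).
  by apply: measurable_limn_if => // x Dx Px; have [] := PP _ Dx Px.
by apply/funext => x; rewrite lE; case: ifP.
Qed.

Lemma measurable_transfer_series w (f : R -> C) :
  measurable_fun D (fun x => complex.Re (f x)) ->
  measurable_fun D (fun x => complex.Im (f x)) ->
  measurable_fun D (fun x => complex.Re (transfer_series w q f x : C)) /\
  measurable_fun D (fun x => complex.Im (transfer_series w q f x : C)).
Proof.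
move=> mr mi; apply: (@measurable_limn_series (fun n x => tterm w f x n)) => n.
exact: measurable_tterm.
Qed.

End Transfer.

(** * The norm and the classes of L^1((0,1)) *)

Section L1Facts.
Context {R : realType}.
Local Notation C := R[i].
Local Notation mu := (@lebesgue_measure R).
Local Notation D := (`]0, 1[%classic : set R).
Local Notation Rn f := (fun x => complex.Re (f x)).
Local Notation In f := (fun x => complex.Im (f x)).

Let mD : measurable (D : set (measurableTypeR R)) := @measurable_D R.

#[local] Instance ae_filter : Filter (nbhs (almost_everywhere mu)).
Proof. exact: (ae_filter_ringOfSetsType mu). Qed.

Definition N1 (f : R -> C) : R := \int[mu]_(x in D) normc (f x).

(** The norm of L^1 takes its values in the complex numbers; this is the same
number as a real. *)
Definition nR (h : L1 R) : R := N1 (L1val_of h).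

Lemma normL1E (h : L1 R) : `|h| = (nR h)%:C.
Proof. by []. Qed.

Lemma nR_ge0 h : 0 <= nR h.
Proof. by apply: Rintegral_ge0 => x _; exact: normc_ge0. Qed.

Lemma nR_triangle g h : nR (g + h) <= nR g + nR h.
Proof. by have := ler_normD g h; rewrite !normL1E -rmorphD lecR. Qed.

Lemma nRZ (a : C) h : nR (a *: h) = normc a * nR h.
Proof.
by have := normrZ a h; rewrite !normL1E normCE -rmorphM => /complexI.
Qed.

Lemma nRN h : nR (- h) = nR h.
Proof. by have := normrN h; rewrite !normL1E => /complexI. Qed.

Lemma nR0 : nR 0 = 0.
Proof. by have := normr0 (L1 R); rewrite normL1E => /complexI. Qed.

Lemma nR_eq0 h : nR h = 0 -> h = 0.
Proof. by move=> h0; apply/normr0_eq0; rewrite normL1E h0. Qed.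

Lemma nRBC g h : nR (g - h) = nR (h - g).
Proof. by rewrite -nRN opprB. Qed.

Lemma nR_triangleB g h : nR (g - h) <= nR g + nR h.
Proof. by apply: le_trans (nR_triangle _ _) _; rewrite nRN. Qed.

Lemma nR_dist h f g : nR (f - g) <= nR (f - h) + nR (h - g).
Proof. by have := nR_triangle (f - h) (h - g); rewrite addrA subrK. Qed.

Lemma cvgL1P (u : nat -> L1 R) (l : L1 R) :
  (u @ \oo --> l) <-> ((fun n => nR (l - u n)) @ \oo --> (0 : R)).
Proof.
split=> [/cvgrPdist_lt h|/cvgrPdist_lt h].
  apply/cvgrPdist_lt => e e0; have := h e%:C; rewrite ltcR => /(_ e0).
  apply: filterS => n; rewrite normL1E ltcR sub0r normrN ger0_norm ?nR_ge0//.
apply/cvgrPdist_lt => e; rewrite ltcE/= => /andP[/eqP e0 e1].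
have := h _ e1; apply: filterS => n; rewrite sub0r normrN ger0_norm ?nR_ge0// => hn.
rewrite normL1E (_ : e = (complex.Re e)%:C) ?ltcR//.
by move: e0; case: (e) => a b /= ->.
Qed.

Lemma closureL1P (A : set (L1 R)) (x : L1 R) :
  closure A x <-> forall e : R, 0 < e -> exists2 a, A a & nR (x - a) < e.
Proof.
split=> [cA e e0|H].
  have e0' : (0 : C) < e%:C by rewrite ltcR.
  have [a [Aa ]] := cA _ (nbhsx_ballx x _ e0').
  rewrite -ball_normE/= normL1E ltcR; exists a => //.
move=> B /nbhs_ballP[e /= e0 eB].
have e1 : 0 < complex.Re e by move: e0; rewrite ltcE/= => /andP[].
have [a Aa xa] := H _ e1; exists a; split=> //; apply: eB.
rewrite -ball_normE/= normL1E (_ : e = (complex.Re e)%:C) ?ltcR//.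
by move: e0; rewrite ltcE/= => /andP[/eqP]; case: (e) => a' b /= ->.
Qed.

Lemma L1val_int (h : L1 R) : L1val_of h \in cintegrable.
Proof. exact: L1fun_int. Qed.

Lemma L1class_val (h : L1 R) : L1class (L1val_of h) = h.
Proof.
rewrite /L1class; have -> : insubd (0 : L1fun) (L1val_of h) = repr h.
  by apply/val_inj; rewrite val_insubd L1val_int.
exact: reprK.
Qed.

Lemma L1class_pi (f : R -> C) (hf : f \in cintegrable) :
  L1class f = \pi_(L1 R) (MkL1fun hf).
Proof.
rewrite /L1class; congr (\pi_(L1 R) _); apply/val_inj.
by rewrite val_insubd hf.
Qed.

(** Lets statements on L^1 be proved on functions. *)
Lemma L1class_ind (P : L1 R -> Prop) :
  (forall f, f \in cintegrable -> P (L1class f)) -> forall h, P h.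
Proof. by move=> H h; rewrite -(L1class_val h); apply: H; exact: L1val_int. Qed.

Lemma L1class_eq (f g : R -> C) : f \in cintegrable -> g \in cintegrable ->
  (L1class f = L1class g) <-> {ae mu, forall x, D x -> f x = g x}.
Proof. by move=> hf hg; rewrite !L1class_pi L1_eqP. Qed.

Lemma cintegrable0 : (fun=> 0 : C) \in @cintegrable R.
Proof. exact: rpred0. Qed.

Lemma L1class0 : L1class (fun=> 0 : C) = 0 :> L1 R.
Proof.
rewrite (L1class_pi cintegrable0) -[RHS](raddf0 \pi_(L1 R)).
by congr (\pi_(L1 R) _); exact/val_inj.
Qed.

Lemma L1classD (f g : R -> C) : f \in cintegrable -> g \in cintegrable ->
  L1class (fun x => f x + g x) = L1class f + L1class g.
Proof.
move=> hf hg; have hfg : (fun x => f x + g x) \in cintegrable by exact: rpredD hf hg.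
rewrite !L1class_pi -raddfD; congr (\pi_(L1 R) _); exact/val_inj.
Qed.

Lemma L1classZ (a : C) (f : R -> C) : f \in cintegrable ->
  L1class (fun x => a * f x) = a *: L1class f.
Proof.
move=> hf; have haf : (fun x => a * f x) \in cintegrable by exact: cintegrableZ.
rewrite !L1class_pi -[RHS]/(L1_scale a _) L1_scaleE.
by congr (\pi_(L1 R) _); exact/val_inj.
Qed.

Lemma L1classB (f g : R -> C) : f \in cintegrable -> g \in cintegrable ->
  L1class (fun x => f x - g x) = L1class f - L1class g.
Proof.
move=> hf hg; have hfg : (fun x => f x - g x) \in cintegrable by exact: rpredB hf hg.
rewrite !L1class_pi -raddfB; congr (\pi_(L1 R) _); exact/val_inj.
Qed.

Lemma nR_class f : f \in cintegrable -> nR (L1class f) = N1 f.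
Proof.
move=> hf; apply: complexI; rewrite -normL1E L1class_pi.
exact: L1normE.
Qed.

Lemma N1E f : f \in cintegrable -> (N1 f)%:E = (\int[mu]_(x in D) nf f x)%E.
Proof.
move=> hf; rewrite /N1 /Rintegral fineK//.
exact: integrable_fin_num (integrable_normc hf).
Qed.

Lemma cintegrable_measurable (f : R -> C) : f \in cintegrable ->
  measurable_fun D (Rn f) /\ measurable_fun D (In f).
Proof.
by move=> /cintegrableP[h1 h2]; split; apply/measurable_EFinP;
   [exact: measurable_int h1|exact: measurable_int h2].
Qed.

Lemma measurable_normc (f : R -> C) : measurable_fun D (Rn f) -> measurable_fun D (In f) ->
  measurable_fun D (fun x => normc (f x)).
Proof.
move=> m1 m2.
rewrite (_ : (fun x => normc (f x)) = (fun x =>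
    Num.sqrt (complex.Re (f x) ^+ 2 + complex.Im (f x) ^+ 2))); last first.
  by apply/funext => x; case: (f x).
apply: (@measurableT_comp _ _ _ _ _ _ (@Num.sqrt R)).
  by apply: continuous_measurable_fun; exact: sqrt_continuous.
by apply: measurable_funD; exact: measurable_funX.
Qed.

Lemma cintegrable_dom (f : R -> C) (u : R -> \bar R) :
  measurable_fun D (Rn f) -> measurable_fun D (In f) ->
  mu.-integrable D u -> (forall x, D x -> 0 <= u x)%E ->
  (forall x, D x -> nf f x <= u x)%E -> f \in cintegrable.
Proof.
move=> m1 m2 iu u0 fu; apply/cintegrableP; split.
  apply: (le_integrable mD _ _ iu); first exact/measurable_EFinP.
  move=> x Dx; rewrite (gee0_abs (u0 _ Dx)); apply: le_trans (fu _ Dx).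
  by rewrite /= lee_fin normc_Re.
apply: (le_integrable mD _ _ iu); first exact/measurable_EFinP.
move=> x Dx; rewrite (gee0_abs (u0 _ Dx)); apply: le_trans (fu _ Dx).
by rewrite /= lee_fin normc_Im.
Qed.

End L1Facts.

(** * The transfer operator on L^1((0,1)) *)

Section TransferL1.
Context {R : realType}.
Local Notation C := R[i].
Local Notation mu := (@lebesgue_measure R).
Local Notation D := (`]0, 1[%classic : set R).
Variables (q : R) (q1 : 1 < q).

Let q0 : 0 < q. Proof. exact: lt_trans ltr01 q1. Qed.

Let mD : measurable (D : set (measurableTypeR R)) := @measurable_D R.

#[local] Instance ae_filter' : Filter (nbhs (almost_everywhere mu)).
Proof. exact: (ae_filter_ringOfSetsType mu). Qed.

Variables (w : C) (w1 : normc w = 1).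

Lemma measurable_nf (f : R -> C) : f \in cintegrable -> measurable_fun D (nf f).
Proof.
move=> /cintegrable_measurable[m1 m2]; apply/measurable_EFinP.
exact: measurable_normc.
Qed.

Lemma integrable_Pe (f : R -> C) : f \in cintegrable ->
  mu.-integrable D (Pe q (nf f)).
Proof.
move=> hf; have mf := measurable_nf hf.
have n0 x : D x -> (0 <= nf f x)%E by move=> _; exact: nf_ge0.
apply/integrableP; split; first exact: measurable_Pe.
under eq_integral do rewrite gee0_abs ?Pe_ge0//.
rewrite integral_Pe// -N1E//; exact: ltry.
Qed.

(** The defining series converges absolutely almost everywhere, because its sum
of moduli has finite integral. *)
Lemma ae_Pe_fin (f : R -> C) : f \in cintegrable ->
  {ae mu, forall x, D x -> (Pe q (nf f) x < +oo)%E}.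
Proof.
move=> hf; have := integrable_ae mD (integrable_Pe hf).
by apply: filterS => x /[apply]; rewrite fin_numE ltey => /andP[].
Qed.

Lemma transfer_series_int (f : R -> C) : f \in cintegrable ->
  transfer_series w q f \in cintegrable.
Proof.
move=> hf; have [m1 m2] := cintegrable_measurable hf.
have [m3 m4] := measurable_transfer_series q w m1 m2.
apply: (cintegrable_dom m3 m4 (integrable_Pe hf)) => x _.
  by apply: Pe_ge0 => // y _; exact: nf_ge0.
exact: transfer_series_le.
Qed.

Lemma N1_transfer_series (f : R -> C) : f \in cintegrable ->
  N1 (transfer_series w q f) <= N1 f.
Proof.
move=> hf; have hg := transfer_series_int hf.
have n0 x : D x -> (0 <= nf f x)%E by move=> _; exact: nf_ge0.
rewrite -lee_fin !N1E// -[leRHS](integral_Pe q0)//; last exact: measurable_nf.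
apply: ge0_le_integral => //.
- by move=> x _; exact: nf_ge0.
- exact: measurable_nf.
- by apply: measurable_Pe => //; exact: measurable_nf.
- by move=> x _; exact: transfer_series_le.
Qed.

Lemma transfer_series_lin (a : C) (f g : R -> C) x :
  (Pe q (nf f) x < +oo)%E -> (Pe q (nf g) x < +oo)%E ->
  transfer_series w q (fun y => a * f y + g y) x =
  a * transfer_series w q f x + transfer_series w q g x :> C.
Proof.
move=> ff fg; have cf := transfer_series_cvg q0 w1 ff.
have cg := transfer_series_cvg q0 w1 fg.
rewrite !transfer_seriesE; apply: (@cvg_lim C^o hausdorffC).
have -> : series (tterm q w (fun y => a * f y + g y) x) =
   (fun n => a * (series (tterm q w f x) n : C^o) + series (tterm q w g x) n : C^o).
  apply/funext => n; rewrite /series/= mulr_sumr -big_split/=.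
  apply: eq_bigr => i _; rewrite /tterm /patch; case: ifP => _.
    by rewrite mulrDr mulrCA.
  by rewrite !mulr0 addr0.
exact: cvgC_lin cf cg.
Qed.

(** The operator is linear where the series converge and contracts the norm, so
that it maps the difference of two representatives to a function of norm 0. *)
Lemma transfer_series_ae (f g : R -> C) : f \in cintegrable -> g \in cintegrable ->
  {ae mu, forall x, D x -> f x = g x} ->
  {ae mu, forall x, D x -> transfer_series w q f x = transfer_series w q g x}.
Proof.
move=> hf hg fg.
have hd : (fun x => f x - g x) \in cintegrable by exact: rpredB hf hg.
have N0 : N1 (fun x => f x - g x) = 0.
  rewrite -nR_class// L1classB//; have /L1class_eq -> // : {ae mu, forall x, D x -> f x = g x} by [].
  by rewrite subrr nR0.
have hts := transfer_series_int hd.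
have {}N0 : N1 (transfer_series w q (fun x => f x - g x)) = 0.
  apply/eqP; rewrite eq_le -{1}N0 N1_transfer_series//=.
  by apply: Rintegral_ge0 => x _; exact: normc_ge0.
have h0 : L1class (transfer_series w q (fun x => f x - g x)) = L1class (fun=> 0).
  by rewrite L1class0; apply: nR_eq0; rewrite nR_class.
have h1 := (L1class_eq hts (cintegrable0 (R := R))).1 h0.
apply: filterS (filterI h1 (filterI (ae_Pe_fin hf) (ae_Pe_fin hg))) => x [h2 [h3 h4]] Dx.
have := h2 Dx; have -> : (fun x => f x - g x) = (fun x => (-1) * g x + f x).
  by apply/funext => y; rewrite mulN1r addrC.
rewrite transfer_series_lin ?h4 ?h3// mulN1r addrC => /eqP.
by rewrite subr_eq0 => /eqP.
Qed.

Lemma transfer_class (f : R -> C) : f \in cintegrable ->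
  transfer w q (L1class f) = L1class (transfer_series w q f).
Proof.
move=> hf; rewrite /transfer; apply/L1class_eq.
- by apply: transfer_series_int; exact: L1val_int.
- exact: transfer_series_int.
- by apply: transfer_series_ae => //; [exact: L1val_int|exact: L1classK].
Qed.

Lemma transferP (a : C) (g h : L1 R) :
  transfer w q (a *: g + h) = a *: transfer w q g + transfer w q h.
Proof.
move: g h; apply: L1class_ind => g hg; apply: L1class_ind => h hh.
have hag : (fun x => a * g x) \in cintegrable by exact: cintegrableZ.
have hs : (fun x => a * g x + h x) \in cintegrable by exact: rpredD hag hh.
have ig := transfer_series_int hg; have ih := transfer_series_int hh.
have iag : (fun x => a * transfer_series w q g x) \in cintegrable by exact: cintegrableZ.
rewrite -L1classZ// -L1classD// !transfer_class// -L1classZ// -L1classD//.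
apply/L1class_eq; first exact: transfer_series_int.
  exact: rpredD iag ih.
apply: filterS (filterI (ae_Pe_fin hg) (ae_Pe_fin hh)) => x [h1 h2] Dx.
by rewrite transfer_series_lin ?h1 ?h2.
Qed.

Lemma nR_transfer (h : L1 R) : nR (transfer w q h) <= nR h.
Proof.
move: h; apply: L1class_ind => h hh; rewrite transfer_class// !nR_class//.
  exact: N1_transfer_series.
exact: transfer_series_int.
Qed.

End TransferL1.

(** * Completeness of L^1((0,1)) *)

Section Completeness.
Context {R : realType}.
Local Notation C := R[i].
Local Notation mu := (@lebesgue_measure R).
Local Notation D := (`]0, 1[%classic : set R).

Let mD : measurable (D : set (measurableTypeR R)) := @measurable_D R.

#[local] Instance ae_filter9 : Filter (nbhs (almost_everywhere mu)).
Proof. exact: (ae_filter_ringOfSetsType mu). Qed.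

Lemma nneseries_le (v : nat -> R) (B : R) : (forall n, 0 <= v n) ->
  (forall n, series v n <= B) -> (\sum_(n <oo) (v n)%:E <= B%:E)%E.
Proof.
move=> v0 vB; apply: lime_le.
  by apply: is_cvg_nneseries => n _ _; rewrite lee_fin.
by apply: nearW => n; rewrite sumEFin lee_fin; exact: vB.
Qed.

Lemma series_shift (V : zmodType) (u : nat -> V) n m :
  series (fun k => u (n + k)%N) m = series u (n + m)%N - series u n.
Proof.
rewrite /series/= [X in X - _](big_cat_nat _ _ (n := n))//=; last exact: leq_addr.
rewrite addrAC subrr add0r -[X in _ = \sum_(X <= _ < _) _]add0n big_addn addKn.
by apply: eq_bigr => i _; rewrite addnC.
Qed.

(** The Riesz-Fischer argument: the sum of the moduli has finite integral,
hence is finite almost everywhere, the series converges there, and the tails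
of the sum of moduli control the distance to the partial sums. *)
Lemma L1_series_cvg (u : nat -> L1 R) (B : R) :
  (forall n, \sum_(0 <= k < n) nR (u k) <= B) ->
  exists s : L1 R, series u @ \oo --> s.
Proof.
move=> uB; pose f k := L1val_of (u k).
have fi k : f k \in cintegrable by exact: L1val_int.
have mn k : measurable_fun D (nf (f k)) by exact: measurable_nf.
have aE k : (\int[mu]_(x in D) nf (f k) x = (nR (u k))%:E)%E by rewrite -N1E.
pose U n (x : R) := (\sum_(k <oo) nf (f (n + k)%N) x)%E.
have U0 n x : (0 <= U n x)%E by apply: nneseries_ge0 => k _ _; exact: nf_ge0.
have mU n : measurable_fun D (U n).
  by apply: ge0_emeasurable_sum => [k x _ _|k _]; [exact: nf_ge0|exact: mn].
pose a := (fun k => nR (u k)).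
have a0 k : 0 <= a k by exact: nR_ge0.
have [ca sa] : cvgn (series a) /\ (\sum_(k <oo) (a k)%:E = (limn (series a))%:E)%E.
  apply: nneseries_fin => //; apply: le_lt_trans (nneseries_le _ uB) (ltry _).
  by move=> n; exact: a0.
have iU n : (\int[mu]_(x in D) U n x <= (limn (series a) - series a n)%:E)%E.
  rewrite integral_nneseries//; last 2 first.
  - by move=> k; exact: mn.
  - by move=> k x _; exact: nf_ge0.
  under eq_eseriesr do rewrite aE.
  apply: (@nneseries_le (fun k => nR (u (n + k)%N))) => [k|m]; first exact: nR_ge0.
  rewrite (@series_shift R a) lerD2r.
  apply: nondecreasing_cvgn_le ca _.
  exact: nondecreasing_series.
have finU n : mu.-integrable D (U n).
  apply/integrableP; split; first exact: mU.
  under eq_integral do rewrite gee0_abs//.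
  exact: le_lt_trans (iU n) (ltry _).
pose F x : C := limn (series (fun k => f k x : C^o)).
have [mF1 mF2] : measurable_fun D (fun x => complex.Re (F x)) /\
                 measurable_fun D (fun x => complex.Im (F x)).
  by apply: (@measurable_limn_series _ (fun k x => f k x : C^o)) => k;
     exact: cintegrable_measurable (fi k).
have FU (n : nat) (x : R) : (U 0%N x < +oo)%E -> cvgn (series (fun k => f k x : C^o)) /\
    (nf (fun y => (F y - \sum_(0 <= k < n) f k y)%R) x <= U n x)%E.
  move=> Ux; have [cs _] := abs_cvgC Ux; split=> //.
  have hl : series (fun k => f (n + k)%N x : C^o) @ \oo -->
      (F x - series (fun k => f k x : C^o) n : C^o).
    have -> : series (fun k => f (n + k)%N x : C^o) =
      (fun m => series (fun k => f k x : C^o) (n + m)%N - series (fun k => f k x : C^o) n).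
      by apply/funext => m; rewrite (@series_shift C (fun k => f k x)).
    apply: cvgB; last exact: cvg_cst.
    exact: (cvg_comp _ _ (cvg_addnl n) cs).
  have [->|fn] := eqVneq (U n x) +oo%E; first by rewrite leey.
  rewrite -ltey in fn; have [_] := abs_cvgC fn.
  by rewrite (@cvg_lim C^o hausdorffC _ _ _ _ _ hl).
have hF : F \in cintegrable.
  apply: (cintegrable_dom mF1 mF2 (finU 0%N)) => // x _.
  have [->|fn] := eqVneq (U 0%N x) +oo%E; first by rewrite leey.
  rewrite -ltey in fn; have [_] := FU 0%N x fn.
  by rewrite /nf big_geq// subr0.
exists (L1class F); apply/cvgL1P.
have SE n : series u n = L1class (fun x => \sum_(0 <= k < n) f k x) /\
    (fun x => \sum_(0 <= k < n) f k x) \in cintegrable.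
  elim: n => [|n [IH1 IH2]].
    rewrite /series/= big_geq//.
    have -> : (fun x : R => \sum_(0 <= k < 0) f k x) = (fun=> 0 : C).
      by apply/funext => x; rewrite big_geq.
    by split; [rewrite L1class0|exact: cintegrable0].
  have -> : (fun x : R => \sum_(0 <= k < n.+1) f k x) =
     (fun x => \sum_(0 <= k < n) f k x + f n x).
    by apply/funext => x; rewrite big_nat_recr.
  split; last exact: rpredD IH2 (fi n).
  by rewrite L1classD// -IH1 L1class_val /series/= big_nat_recr.
(* The tails of the sum of moduli bound the tails of the series. *)
have bnd n : nR (L1class F - series u n) <= limn (series a) - series a n.
  have [-> hs] := SE n; rewrite -L1classB//.
  have hd : (fun x => F x - \sum_(0 <= k < n) f k x) \in cintegrable by exact: rpredB hF hs.
  rewrite nR_class// -lee_fin N1E//; apply: le_trans (iU n).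
  apply: ae_ge0_le_integral => //.
  - by move=> x _; exact: nf_ge0.
  - exact: measurable_nf.
  - exact: mU.
  - have := integrable_ae mD (finU 0%N); apply: filterS => x /[apply].
    by rewrite fin_numE -ltey => /andP[_ h]; exact: (FU n x h).2.
apply: (squeeze_cvgr (f := fun=> 0) (h := fun n => limn (series a) - series a n)).
- by apply: nearW => n; rewrite nR_ge0 bnd.
- exact: cvg_cst.
- rewrite -[X in _ --> X](subrr (limn (series a))).
  by apply: cvgB => //; exact: cvg_cst.
Qed.

End Completeness.

(** * Linear contractions outside the unit disc *)

Section SpectralAbstract.
Context {R : realType}.
Local Notation C := R[i].
Local Notation X := (L1 R).

Lemma invertible_fredholm (T : X -> X) : boundedly_invertible T -> fredholm T.
Proof.
move=> [S [cS TK SK]].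
have rT : range T = setT.
  by apply/seteqP; split => // x _; exists (S x).
split.
- exists 0%N, (fun=> 0) => v Tv; exists (fun=> 0).
  by rewrite big_ord0 -(TK v) Tv linear0.
- by rewrite rT; exact: closedT.
- exists 0%N, (fun=> 0) => x; exists x; first by rewrite rT.
  by exists (fun=> 0); rewrite big_ord0 addr0.
Qed.

Lemma nR_small_eq0 (x : X) : (forall e : R, 0 < e -> nR x <= e) -> x = 0.
Proof.
move=> H; apply: nR_eq0; apply/eqP; rewrite eq_le nR_ge0 andbT.
by apply/ler_addgt0Pl => e e0; rewrite addr0; exact: H.
Qed.

Lemma cvgL1_ex (u : nat -> X) (l : X) (e : R) : u @ \oo --> l -> 0 < e ->
  exists N : nat, forall n, (N <= n)%N -> nR (l - u n) < e.
Proof.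
move=> /cvgL1P /cvgrPdist_lt h e0; have [N _ HN] := h _ e0.
exists N => n Nn; have := HN _ Nn.
by rewrite /= sub0r normrN ger0_norm ?nR_ge0.
Qed.

Lemma big_nat_scale_geo (r : R) n : 0 <= r -> r < 1 ->
  \sum_(0 <= k < n) r ^+ k <= (1 - r)^-1.
Proof.
move=> r0 r1; have r1' : 0 < 1 - r by rewrite subr_gt0.
rewrite -[leRHS]mul1r ler_pdivlMr// mulrC.
have -> : (1 - r) * (\sum_(0 <= k < n) r ^+ k) = 1 - r ^+ n.
  elim: n => [|n IH]; first by rewrite big_geq// expr0 mulr0 subrr.
  by rewrite big_nat_recr//= mulrDr IH exprS; ring.
by rewrite gerBl exprn_ge0.
Qed.

Lemma harmonic_unbounded (B : R) : exists n : nat, B < \sum_(0 <= k < n) k.+1%:R^-1.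
Proof.
apply/not_existsP => H; apply: (@dvg_harmonic R).
apply: nondecreasing_is_cvgn.
  by apply: nondecreasing_series => n _ _; rewrite /= invr_ge0.
exists B => _ [n _ <-]; rewrite leNgt; apply/negP => Bn; apply: (H n).
exact: Bn.
Qed.

Variable Q : X -> X.
Hypothesis Qlin : forall (a : C) g h, Q (a *: g + h) = a *: Q g + Q h.
Hypothesis Qle : forall h, nR (Q h) <= nR h.

Lemma op0 : Q 0 = 0.
Proof. by have := Qlin (-1) 0 0; rewrite scaleN1r oppr0 addr0 scaleN1r addNr. Qed.

Lemma opD g h : Q (g + h) = Q g + Q h.
Proof. by have := Qlin 1 g h; rewrite !scale1r. Qed.

Lemma opZ a g : Q (a *: g) = a *: Q g.
Proof. by have := Qlin a g 0; rewrite addr0 op0 addr0. Qed.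

Lemma opB g h : Q (g - h) = Q g - Q h.
Proof. by rewrite -[- h]scaleN1r opD opZ scaleN1r. Qed.

(** Minus the Neumann series of l^(-k-1) Q^k inverts Q - l.  The lower bound
(|l| - 1) |x| <= |Q x - l x| gives injectivity and the continuity of the inverse. *)
Lemma invertible_outside (l : C) : 1 < normc l ->
  boundedly_invertible (fun x => Q x - l *: x).
Proof.
move=> l1; have l0 : l != 0 by apply/eqP => l0; move: l1; rewrite l0 normc0 ltr10.
have nl0 : 0 < normc l by exact: lt_trans l1.
set T := (fun x => Q x - l *: x).
have lb x : (normc l - 1) * nR x <= nR (T x).
  have := nR_triangleB (Q x) (T x); rewrite /T subKr nRZ.
  by have := Qle x; lra.
have inj x : T x = 0 -> x = 0.
  move=> Tx; apply: nR_eq0; apply/eqP; rewrite eq_le nR_ge0 andbT.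
  have := lb x; rewrite Tx nR0 pmulr_rle0// subr_gt0//.
have Tlin (a : C) x y : T (a *: x + y) = a *: T x + T y.
  rewrite /T Qlin scalerDr scalerBr !scalerA [l * a]mulrC.
  by rewrite opprD addrACA.
have surj y : exists x, T x = y.
  pose u k := - (l ^- k.+1) *: iter k Q y.
  have nu k : nR (u k) <= (normc l)^-1 ^+ k * nR y.
    rewrite /u nRZ normcN normcV normcX.
    have h : nR (iter k Q y) <= nR y.
      by elim: k => //= k IH; exact: le_trans (Qle _) IH.
    apply: ler_pM => //; [by rewrite invr_ge0 exprn_ge0// ltW|exact: nR_ge0|].
    rewrite -exprVn exprS ler_piMl//; first by rewrite exprn_ge0// invr_ge0 ltW.
    by rewrite invf_le1// ltW.
  have [s us] : exists s : X, series u @ \oo --> s.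
    apply: (@L1_series_cvg _ u ((1 - (normc l)^-1)^-1 * nR y)) => n.
    apply: le_trans (ler_sum _ (fun k _ => nu k)) _.
    rewrite -mulr_suml ler_wpM2r ?nR_ge0//; apply: big_nat_scale_geo.
      by rewrite invr_ge0 ltW.
    by rewrite invf_lt1.
  exists s; apply/eqP; rewrite -subr_eq0; apply/eqP; apply: nR_small_eq0 => e e0.
  have Tser n : T (series u n) = y - l ^- n *: iter n Q y.
    elim: n => [|n IH].
      by rewrite /series/= big_geq// expr0 invr1 scale1r subrr /T op0 scaler0 subrr.
    have -> : series u n.+1 = 1 *: u n + series u n.
      by rewrite scale1r addrC /series/= big_nat_recr.
    have Tu : T (u n) = l ^- n *: iter n Q y - l ^- n.+1 *: iter n.+1 Q y.
      rewrite /T /u opZ !scaleNr scalerN scalerA opprK addrC.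
      by rewrite [l * _](_ : _ = l ^- n)// exprS invfM mulVKf.
    by rewrite Tlin IH scale1r Tu addrC addrA subrK.
  have d0 : 0 < e / (2 * (1 + normc l)).
    by rewrite divr_gt0// mulr_gt0// ltr_wpDr// ltW.
  have [N1' HN1] := cvgL1_ex us d0.
  have cg : (fun n => (normc l)^-1 ^+ n * nR y) @ \oo --> (0 * nR y : R).
    apply: cvgMl; apply: cvg_expr; rewrite ger0_norm ?invr_ge0 ?ltW//.
    by rewrite invf_lt1.
  rewrite mul0r in cg; move/cvgrPdist_lt : cg => /(_ (e / 2)).
  rewrite divr_gt0// => /(_ isT)[N2 _ HN2].
  pose n := maxn N1' N2.
  have h1 := HN1 n (leq_maxl _ _); have h2 := HN2 n (leq_maxr _ _).
  have -> : T s - y = T (s - series u n) - l ^- n *: iter n Q y.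
    have -> : s - series u n = (-1) *: series u n + s by rewrite scaleN1r addrC.
    have aux (a b c : X) : a - b + c - a = c - b.
      by rewrite [a - b]addrC -!addrA [a + _]addrCA subrr addr0 addrC.
    by rewrite Tlin Tser scaleN1r opprB aux.
  apply: le_trans (nR_triangleB _ _) _.
  have h3 : nR (T (s - series u n)) <= (1 + normc l) * nR (s - series u n).
    apply: le_trans (nR_triangleB _ _) _; rewrite nRZ mulrDl mul1r lerD2r.
    exact: Qle.
  have h4 : nR (l ^- n *: iter n Q y) <= (normc l)^-1 ^+ n * nR y.
    rewrite nRZ normcV normcX exprVn; apply: ler_wpM2l.
      by rewrite invr_ge0 exprn_ge0// ltW.
    by elim: (n) => //= k IH; exact: le_trans (Qle _) IH.
  move: h2; rewrite /= sub0r normrN ger0_norm; last first.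
    by rewrite mulr_ge0 ?nR_ge0// exprn_ge0// invr_ge0 ltW.
  move=> h2; rewrite [leRHS]splitr; apply: lerD; last exact: le_trans h4 (ltW h2).
  apply: le_trans h3 _; rewrite -ler_pdivlMl; last by rewrite ltr_wpDr// ltW.
  apply: le_trans (ltW h1) _; rewrite invfM mulrA.
  by rewrite [leRHS]mulrC.
pose S y := xget 0 [set x | T x = y].
have TS y : T (S y) = y.
  rewrite /S; case: xgetP => [x _ //|H]; exfalso; have [x xy] := surj y.
  exact: H x xy.
have ST x : S (T x) = x.
  apply/eqP; rewrite -subr_eq0; apply/eqP; apply: inj.
  have -> : S (T x) - x = (-1) *: x + S (T x) by rewrite scaleN1r addrC.
  by rewrite Tlin TS scaleN1r addNr.
have Slin : linear S.
  move=> a x y; rewrite -[RHS]ST; congr S.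
  by rewrite Tlin !TS.
pose Sl : {linear X -> X} := HB.pack S (GRing.isLinear.Build _ _ _ _ S Slin).
exists Sl; split=> //.
have Sb x : nR (S x) <= (normc l - 1)^-1 * nR x.
  by rewrite ler_pdivlMl ?subr_gt0// -{2}(TS x).
move=> x B /nbhs_ballP[e /= ep eB]; move: (ep); rewrite ltcE/= => /andP[/eqP e0 e1].
have eE : e = (complex.Re e)%:C by move: e0; case: (e) => a b /= ->.
have d0 : (0 : C) < ((normc l - 1) * complex.Re e)%:C.
  by rewrite ltcR mulr_gt0// subr_gt0.
apply/nbhs_ballP; exists ((normc l - 1) * complex.Re e)%:C => //= y.
rewrite -ball_normE/= => hy; apply: eB; rewrite -ball_normE/=.
rewrite eE normL1E ltcR.
have -> : S x - S y = S (x - y).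
  have -> : x - y = (-1) *: y + x by rewrite scaleN1r addrC.
  by rewrite Slin scaleN1r addrC.
apply: le_lt_trans (Sb _) _; rewrite ltr_pdivrMl ?subr_gt0// -ltcR -normL1E.
exact: hy.
Qed.

End SpectralAbstract.

(** * Linear contractions with isometric right inverses *)

(** The values of S and Dl have disjoint supports, and Dl h is made of two
disjoint copies of h that Q sends to opposite values: this explains the factor 2
in the hypothesis on the norm of Dl g + S h, and the hypothesis that Q kills Dl. *)
Section ShiftAbstract.
Context {R : realType}.
Local Notation C := R[i].
Local Notation X := (L1 R).

Variables (Q S Dl : X -> X).
Hypothesis Qlin : forall (a : C) g h, Q (a *: g + h) = a *: Q g + Q h.
Hypothesis Qle : forall h, nR (Q h) <= nR h.
Hypothesis Slin : forall (a : C) g h, S (a *: g + h) = a *: S g + S h.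
Hypothesis Dlin : forall (a : C) g h, Dl (a *: g + h) = a *: Dl g + Dl h.
Hypothesis QS : forall h, Q (S h) = h.
Hypothesis QD0 : forall h, Q (Dl h) = 0.
Hypothesis DS : forall g h, nR (Dl g + S h) = 2 * nR g + nR h.
Variable u : X.
Hypothesis u0 : 0 < nR u.

Let S0 : S 0 = 0 := op0 Slin.
Let D0 : Dl 0 = 0 := op0 Dlin.

Lemma nR_S h : nR (S h) = nR h.
Proof. by have := DS 0 h; rewrite D0 add0r nR0 mulr0 add0r. Qed.

Lemma nR_D h : nR (Dl h) = 2 * nR h.
Proof. by have := DS h 0; rewrite S0 addr0 nR0 addr0. Qed.

Definition comb (b : nat -> C) (m : nat) : X :=
  \sum_(k < m) b k *: iter k S (Dl u).

Lemma S_sum (I : Type) (r : seq I) (F : I -> X) :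
  S (\sum_(i <- r) F i) = \sum_(i <- r) S (F i).
Proof.
elim: r => [|i r IH]; first by rewrite !big_nil S0.
by rewrite !big_cons (opD Slin) IH.
Qed.

(** Q acts on these combinations as a backward shift, see [Q_comb]: Q kills the
summand in the image of Dl and undoes S. *)
Lemma combS b m : comb b m.+1 = Dl (b 0%N *: u) + S (comb (fun k => b k.+1) m).
Proof.
rewrite /comb big_ord_recl/= (opZ Dlin) S_sum; congr (_ + _).
by apply: eq_bigr => k _; rewrite (opZ Slin).
Qed.

Lemma nR_comb b m : nR (comb b m) = (\sum_(k < m) normc (b k)) * (2 * nR u).
Proof.
elim: m b => [|m IH] b; first by rewrite /comb !big_ord0 nR0 mul0r.
by rewrite combS DS IH nRZ big_ord_recl/=; ring.
Qed.

Lemma Q_comb b m : Q (comb b m.+1) = comb (fun k => b k.+1) m.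
Proof. by rewrite combS (opD Qlin) QD0 QS add0r. Qed.

Lemma comb_rcons b m : comb b m.+1 = comb b m + b m *: iter m S (Dl u).
Proof. by rewrite /comb big_ord_recr. Qed.

(** The series of l^k S^k Dl x converges as |l| < 1 and S is isometric; it is
multiplied by l when Q shifts it back. *)
Lemma eigenvector (l : C) (x : X) : normc l < 1 ->
  exists2 h : X, Q h = l *: h & h = Dl x + l *: S h.
Proof.
move=> l1.
pose v k := l ^+ k *: iter k S (Dl x).
have nv k : nR (v k) = normc l ^+ k * (2 * nR x).
  rewrite /v nRZ normcX; congr (_ * _).
  by elim: k => [|k IH] /=; rewrite ?nR_D// nR_S.
have [h vh] : exists h : X, series v @ \oo --> h.
  apply: (@L1_series_cvg _ v ((1 - normc l)^-1 * (2 * nR x))) => n.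
  under eq_bigr do rewrite nv.
  rewrite -mulr_suml ler_wpM2r ?mulr_ge0 ?nR_ge0//.
  by apply: big_nat_scale_geo => //; exact: normc_ge0.
have hE : h = Dl x + l *: S h.
  apply/eqP; rewrite -subr_eq0; apply/eqP; apply: nR_small_eq0 => e e0.
  have e2 : 0 < e / 2 by rewrite divr_gt0.
  have [N HN] := cvgL1_ex vh e2.
  have sE n : series v n.+1 = Dl x + l *: S (series v n).
    rewrite /series/= big_nat_recl//= /v expr0 scale1r; congr (_ + _).
    rewrite S_sum scaler_sumr; apply: eq_bigr => k _.
    by rewrite (opZ Slin) scalerA -exprS.
  have h1 := HN N (leqnn _); have h2 := HN N.+1 (leqnSn _).
  have -> : h - (Dl x + l *: S h) =
      (h - series v N.+1) - l *: S (h - series v N).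
    rewrite sE (opB Slin) scalerBr; set a := Dl x; set b := l *: S h.
    set c := l *: S _; rewrite opprB !opprD !addrA; congr (_ - _).
    by rewrite subrK.
  apply: le_trans (nR_triangleB _ _) _; rewrite nRZ nR_S [leRHS]splitr.
  apply: lerD; first exact: ltW.
  apply: le_trans (ltW h1); rewrite ler_piMl ?nR_ge0//; exact: ltW.
exists h => //.
by rewrite {1}hE (opD Qlin) QD0 (opZ Qlin) QS add0r.
Qed.

(** The matrix of coefficients has more rows than columns, hence a nonzero left
kernel; the vectors e need not be independent. *)
Lemma dependent_family (n : nat) (e : 'I_n -> X) (h : 'I_n.+1 -> X) :
  (forall j, exists c : 'I_n -> C, h j = \sum_(i < n) c i *: e i) ->
  exists a : 'I_n.+1 -> C, (exists j, a j != 0) /\ \sum_j a j *: h j = 0.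
Proof.
move=> H; have [c Hc] := choice H.
pose M : 'M[C]_(n.+1, n) := \matrix_(j, i) c j i.
have /rowV0Pn[v vM v0] : kermx M != 0.
  rewrite -mxrank_eq0 mxrank_ker -lt0n subn_gt0 ltnS.
  exact: rank_leq_col.
exists (v 0); split.
  have [j vj] : exists j, v 0 j != 0.
    apply/existsP; apply: contraNT v0; rewrite negb_exists => /forallP v0.
    by apply/eqP/rowP => j; rewrite mxE; apply/eqP; have := v0 j; rewrite negbK.
  by exists j.
have vM0 : v *m M = 0 by apply/sub_kermxP.
under eq_bigr do rewrite Hc scaler_sumr.
rewrite exchange_big/=; apply: big1 => i _.
under eq_bigr do rewrite scalerA.
rewrite -scaler_suml; have := congr1 (fun A : 'rV_n => A 0 i) vM0.
rewrite !mxE => E; rewrite (_ : \sum_(_ < _) _ = 0) ?scale0r// -[RHS]E.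
by apply: eq_bigr => j _; rewrite mxE.
Qed.

Lemma D_sum (I : Type) (r : seq I) (F : I -> X) :
  Dl (\sum_(i <- r) F i) = \sum_(i <- r) Dl (F i).
Proof.
elim: r => [|i r IH]; first by rewrite !big_nil D0.
by rewrite !big_cons (opD Dlin) IH.
Qed.

(** The eigenvectors h_j attached to x = S^j Dl u are independent.  A relation
between them gives, by h = Dl x + l S h and disjointness of supports, the same
relation between the S^j Dl u, which have disjoint supports. *)
Lemma kernel_infinite (l : C) : normc l < 1 ->
  ~ finite_dim (ker (fun x => Q x - l *: x)).
Proof.
move=> l1 [n [e He]].
have /choice[h Hh] : forall j : 'I_n.+1, exists h : X,
    Q h = l *: h /\ h = Dl (iter j S (Dl u)) + l *: S h.
  by move=> j; have [h h1 h2] := eigenvector (iter j S (Dl u)) l1; exists h.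
have [|a [[j aj] ah]] := @dependent_family n e h.
  move=> j; apply: He; rewrite /ker/=; have [-> _] := Hh j.
  by rewrite subrr.
pose b k := a (inord k).
have yE : \sum_(j < n.+1) a j *: iter j S (Dl u) = comb b n.+1.
  by apply: eq_bigr => i _; rewrite /b inord_val.
have : \sum_j a j *: h j = Dl (comb b n.+1) + l *: S (\sum_j a j *: h j).
  rewrite -yE D_sum S_sum scaler_sumr -big_split/=; apply: eq_bigr => i _.
  rewrite {1}(Hh i).2 scalerDr (opZ Dlin) (opZ Slin) !scalerA.
  by rewrite [l * _]mulrC.
rewrite ah S0 scaler0 addr0 => /(congr1 (@nR R)).
rewrite nR0 nR_D nR_comb => /esym/eqP.
rewrite !mulf_eq0 (gt_eqF u0) !pnatr_eq0/= orbF psumr_eq0; last first.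
  by move=> i _; exact: normc_ge0.
move=> /allP/(_ j); rewrite mem_index_enum => /(_ isT)/= /eqP bj.
by move/eqP: aj; apply; apply: eq0_normc; move: bj; rewrite /b inord_val.
Qed.

(** With e_k = S^k Dl u and b_k = l^k / (k + 1), the image of the sum of the
b_k e_k over k <= K is, up to the factor -l, a summation by parts: a convergent
series in (1/(k+1) - 1/(k+2)) l^k e_k plus a small boundary term.  If the limit g
were f - Q' f with Q' = Q / l, then n iterations of Q' would move
the partial sum h by at most 2 |f| + 1, for K large.  But they shift off the first
n terms of h, of total norm 2 |u| (1 + 1/2 + ... + 1/n). *)
Lemma range_not_closed (l : C) : normc l = 1 ->
  ~ closed (range (fun x => Q x - l *: x)).
Proof.
move=> l1 cl.
have l0 : l != 0 by apply/eqP => l0; move: l1; rewrite l0 normc0 => /esym/eqP; rewrite oner_eq0.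
pose c := 2 * nR u.
have c0 : 0 < c by rewrite mulr_gt0.
pose a k : R := k.+1%:R^-1.
have a0 k : 0 <= a k by rewrite invr_ge0.
have ad k : a k.+1 <= a k by rewrite lef_pV2 ?posrE ?ltr0Sn// ler_nat.
pose b k : C := (a k)%:C * l ^+ k.
pose d k : C := (a k - a k.+1)%:C * l ^+ k.
have nb k : normc (b k) = a k.
  by rewrite /b normcM normcR normcX l1 expr1n mulr1 ger0_norm.
have nd k : normc (d k) = a k - a k.+1.
  by rewrite /d normcM normcR normcX l1 expr1n mulr1 ger0_norm// subr_ge0.
pose e k := iter k S (Dl u).
have ne k : nR (e k) = c.
  by rewrite /e; elim: k => [|k IH] /=; rewrite ?nR_D// nR_S.
have sd n : \sum_(0 <= k < n) (a k - a k.+1) = a 0%N - a n.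
  elim: n => [|n IH]; first by rewrite big_geq// subrr.
  by rewrite big_nat_recr//= IH addrA subrK.
have [g dg] : exists g : X, series (fun k => d k *: e k) @ \oo --> g.
  apply: (@L1_series_cvg _ _ c) => n.
  under eq_bigr do rewrite nRZ nd ne.
  rewrite -mulr_suml sd ler_piMl ?(ltW c0)//.
  by rewrite /a invr1 lerBlDr lerDl.
have serE n : series (fun k => d k *: e k) n = comb d n.
  by rewrite /series/= big_mkord.
(* the elements of the range that converge to a multiple of g *)
have TK K : Q (comb b K.+1) - l *: comb b K.+1 = - (l *: (comb d K + b K *: e K)).
  rewrite Q_comb comb_rcons -/(e K) !scalerDr !opprD addrA; congr (_ + _).
  rewrite /comb !scaler_sumr -sumrB -sumrN; apply: eq_bigr => k _.
  rewrite -/(e k) !scalerA -scalerBl -[RHS]scaleNr; congr (_ *: _).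
  by rewrite /b /d rmorphB exprS; ring.
have small (r : R) : 0 < r -> exists N : nat, forall K, (N <= K)%N ->
    nR (g - (comb d K + b K *: e K)) < r.
  move=> r0; have r2 : 0 < r / 2 by rewrite divr_gt0.
  have [N1' H1] := cvgL1_ex dg r2.
  have [N2 H2] : exists N : nat, forall K, (N <= K)%N -> a K * c < r / 2.
    exists (Num.bound (c / (r / 2))) => K NK.
    rewrite /a mulrC ltr_pdivrMr ?ltr0Sn// mulrC -ltr_pdivrMr//.
    apply: lt_le_trans (archi_boundP _) _; first by rewrite divr_ge0// ltW.
    by rewrite ler_nat; exact: leqW.
  exists (maxn N1' N2) => K; rewrite geq_max => /andP[K1 K2].
  rewrite opprD addrA; apply: le_lt_trans (nR_triangleB _ _) _.
  rewrite nRZ nb ne [ltRHS]splitr; apply: ltrD; last exact: H2.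
  by rewrite -serE; exact: H1.
have [f _ fg] : range (fun x => Q x - l *: x) (- (l *: g)).
  apply: cl; apply/closureL1P => r r0; have [N HN] := small _ r0.
  exists (Q (comb b N.+1) - l *: comb b N.+1); first by exists (comb b N.+1).
  rewrite TK opprK addrC -scalerBr nRZ l1 mul1r nRBC.
  exact: HN.
(* Division by l turns the equation for f into g = f - Q' f with a contraction Q'. *)
pose Q' x := l^-1 *: Q x.
have Q'B x y : Q' (x - y) = Q' x - Q' y by rewrite /Q' (opB Qlin) scalerBr.
have Q'le x : nR (Q' x) <= nR x.
  by rewrite /Q' nRZ normcV l1 invr1 mul1r.
have gE : g = f - Q' f.
  have /(congr1 (fun x => - (l^-1 *: x))) := fg.
  rewrite /= scalerBr scalerN opprK !scalerA mulVf// !scale1r => <-.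
  by rewrite opprB.
have dE K : comb d K + b K *: e K = comb b K.+1 - Q' (comb b K.+1).
  have /(congr1 (fun x => - (l^-1 *: x))) := TK K.
  rewrite /= scalerBr scalerN opprK !scalerA mulVf// !scale1r => <-.
  by rewrite opprB.
have Q'iter n x : nR (x - iter n Q' x) <= n%:R * nR (x - Q' x).
  elim: n => [|n IH]; first by rewrite /= subrr nR0 mul0r.
  rewrite iterS; apply: le_trans (nR_dist (Q' x) _ _) _.
  rewrite -natr1 mulrDl mul1r addrC lerD2r -Q'B.
  exact: le_trans (Q'le _) IH.
have Q'iterle n x : nR (iter n Q' x) <= nR x.
  by elim: n => //= n IH; exact: le_trans (Q'le _) IH.
have Q'iterB n x y : iter n Q' (x - y) = iter n Q' x - iter n Q' y.
  by elim: n => //= n ->; rewrite Q'B.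
have Q'comb n m (b' : nat -> R) :
    iter n Q' (comb (fun k => (b' k)%:C * l ^+ k) (n + m)) =
    comb (fun k => (b' (n + k)%N)%:C * l ^+ k) m.
  elim: n b' => [//|n IH] b'; rewrite iterSr addSn /Q' Q_comb.
  have -> : l^-1 *: comb (fun k => (b' k.+1)%:C * l ^+ k.+1) (n + m) =
      comb (fun k => (b' k.+1)%:C * l ^+ k) (n + m).
    rewrite /comb scaler_sumr; apply: eq_bigr => k _; rewrite scalerA.
    by congr (_ *: _); rewrite exprS mulrCA mulKf.
  by rewrite (IH (fun k => b' k.+1)).
(* The harmonic sums would be bounded by the norm of the preimage f. *)
have main n : c * \sum_(0 <= k < n) a k <= 2 * nR f + 1.
  have n0 : 0 < (n.+1%:R : R)^-1 by rewrite invr_gt0.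
  have [N HN] := small _ n0.
  pose K := (n + N)%N; have := HN K (leq_addl _ _).
  rewrite dE {1}gE => sm.
  pose h := comb b K.+1; pose phi := f - h.
  have phiE : nR (phi - iter n Q' phi) <= 1.
    apply: le_trans (Q'iter _ _) _; rewrite Q'B.
    rewrite (_ : f - h - (Q' f - Q' h) = f - Q' f - (h - Q' h)); last first.
      by rewrite !opprB [Q' h - _]addrC addrACA [- h + _]addrC.
    apply: le_trans (ler_wpM2l _ (ltW sm)) _ => //.
    by rewrite ler_pdivrMr ?ltr0Sn// mul1r ler_nat.
  have hE : nR (h - iter n Q' h) <= 2 * nR f + 1.
    have -> : h - iter n Q' h = (f - iter n Q' f) - (phi - iter n Q' phi).
      have aux (x y z t : X) : z - t = x - y - (x - z - (y - t)).
        rewrite [- (x - z - _)]opprB addrA addrA subrK [- (x - z)]opprB.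
        by rewrite addrC addrA subrK.
      by rewrite /phi Q'iterB -aux.
    apply: le_trans (nR_triangleB _ _) _; rewrite mulrDl mul1r.
    by apply: lerD => //; apply: le_trans (nR_triangleB _ _) _; rewrite lerD2l.
  have h1 : nR h = (\sum_(0 <= k < K.+1) a k) * c.
    by rewrite /h nR_comb big_mkord; congr (_ * _); apply: eq_bigr => k _.
  have h2 : nR (iter n Q' h) = (\sum_(n <= k < K.+1) a k) * c.
    rewrite /h /K -addnS Q'comb nR_comb -[X in \sum_(X <= _ < _) _]add0n.
    rewrite big_addn addKn big_mkord; congr (_ * _); apply: eq_bigr => k _.
    by rewrite normcM normcR normcX l1 expr1n mulr1 ger0_norm// addnC.
  have h3 : nR h <= nR (h - iter n Q' h) + nR (iter n Q' h).
    by apply: le_trans (nR_triangle _ _); rewrite subrK.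
  have h4 : \sum_(0 <= k < K.+1) a k = \sum_(0 <= k < n) a k + \sum_(n <= k < K.+1) a k.
    by rewrite -big_cat_nat//= /K; exact: leqW (leq_addr _ _).
  move: h3; rewrite h1 h2 h4 mulrDl lerD2r mulrC => h3.
  exact: le_trans h3 hE.
have [n] := harmonic_unbounded ((2 * nR f + 1) / c).
rewrite ltr_pdivrMr// => h; have := main n.
by rewrite [c * _]mulrC leNgt h.
Qed.

End ShiftAbstract.

(** * Right inverses of the transfer operator *)

Section Sections.
Context {R : realType}.
Local Notation C := R[i].
Local Notation mu := (@lebesgue_measure R).
Local Notation D := (`]0, 1[%classic : set R).
Variables (q : R) (q1 : 1 < q).

Let q0 : 0 < q. Proof. exact: lt_trans ltr01 q1. Qed.

Let mD : measurable (D : set (measurableTypeR R)) := @measurable_D R.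

(** The function f carried to cell n by the inverse of branch n, with the
Jacobian and the phase that the transfer operator takes away again. *)
Definition secfun (w : C) (n : nat) (f : R -> C) (y : R) : C :=
  if y \in cell q n then
    w ^- n.+1 * (q / y ^+ 2)%:C * f (q / y - n.+1%:R)
  else 0.

(** The branches with n + 1 >= q are the ones whose whole image can carry a
function on (0,1). *)
Lemma cell_sub_D n : q <= n.+1%:R -> cell q n `<=` D.
Proof.
move=> qn y; rewrite /cell/= !in_itv/= => /andP[h1 h2]; apply/andP; split.
  by apply: lt_trans h1; rewrite divr_gt0// ltr0Sn.
by apply: lt_le_trans h2 _; rewrite ler_pdivrMr ?ltr0Sn// mul1r.
Qed.

Lemma cell_fwd n y : cell q n y -> D (q / y - n.+1%:R).
Proof.
rewrite /cell/= !in_itv/= => /andP[h1 h2].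
have y0 : 0 < y by apply: lt_trans h1; rewrite divr_gt0// ltr0Sn.
apply/andP; split.
  by rewrite subr_gt0 ltr_pdivlMr// mulrC -ltr_pdivlMr ?ltr0Sn.
by rewrite ltrBlDr addrC natr1 ltr_pdivrMr// mulrC -ltr_pdivrMr ?ltr0Sn.
Qed.

Variables (w : C) (w1 : normc w = 1).

Let w0 : w != 0.
Proof. by apply/eqP => w0; move: w1; rewrite w0 normc0 => /esym/eqP; rewrite oner_eq0. Qed.

Lemma secfun_invbr n f x : D x ->
  secfun w n f (invbr q n x) = w ^- n.+1 * ((wt q n x)^-1)%:C * f x.
Proof.
move=> Dx; rewrite /secfun mem_set; last exact: invbr_cell.
have x0 : 0 < x by move: Dx; rewrite /= in_itv/= => /andP[].
have nx : n.+1%:R + x != 0 by rewrite gt_eqF// addS_gt0// ltW.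
congr (_ * _%:C * f _).
  rewrite /invbr /wt; field; by rewrite nat1r nx gt_eqF.
by rewrite /invbr invf_div mulrCA divff ?gt_eqF// mulr1 addrC addKr.
Qed.

Lemma measurable_fwd (f : R -> R) n : measurable_fun D f ->
  measurable_fun (cell q n) (fun y => f (q / y - n.+1%:R)).
Proof.
move=> mf.
have mT : measurable_fun (cell q n) (fun y : R => q / y - n.+1%:R).
  apply: open_continuous_measurable_fun => //.
  move=> y; rewrite inE => cy.
  have y0 : y != 0.
    move: cy; rewrite /cell/= in_itv/= => /andP[h1 _].
    by rewrite gt_eqF//; apply: lt_trans h1; rewrite divr_gt0// ltr0Sn.
  apply: cvgB; last exact: cvg_cst.
  apply: cvgM; first exact: cvg_cst.
  by apply: cvgV => //; exact: cvg_id.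
have mfD : measurable_fun setT (f \_ D) by apply: (measurable_restrictT _ _).1.
have h := measurableT_comp mfD mT.
apply: eq_measurable_fun h => y; rewrite inE => cy.
by rewrite /= patchE mem_set//; exact: cell_fwd.
Qed.

Lemma measurable_if_cell (f : R -> R) n : measurable_fun (cell q n) f ->
  measurable_fun setT (fun y => if y \in cell q n then f y else 0).
Proof.
move=> mf; have -> : (fun y => if y \in cell q n then f y else 0) = f \_ (cell q n).
  by apply/funext => y; rewrite /restrict /patch.
by apply: (measurable_restrictT _ _).1 => //; exact: measurable_cell.
Qed.

Lemma measurable_secfun n (f : R -> C) :
  measurable_fun D (fun x => complex.Re (f x)) ->
  measurable_fun D (fun x => complex.Im (f x)) ->
  measurable_fun setT (fun x => complex.Re (secfun w n f x)) /\
  measurable_fun setT (fun x => complex.Im (secfun w n f x)).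
Proof.
move=> mr mi; case E : (w ^- n.+1) => [a b].
have m1 := measurable_fwd (n := n) mr; have m2 := measurable_fwd (n := n) mi.
have m3 : measurable_fun (cell q n) (fun y : R => q / y ^+ 2).
  apply: open_continuous_measurable_fun => //.
  move=> y; rewrite inE => cy.
  have y0 : y != 0.
    move: cy; rewrite /cell/= in_itv/= => /andP[h1 _].
    by rewrite gt_eqF//; apply: lt_trans h1; rewrite divr_gt0// ltr0Sn.
  apply: cvgM; first exact: cvg_cst.
  by apply: cvgV; [rewrite expf_neq0|exact: exprn_continuous].
split.
  rewrite (_ : (fun x => _) = (fun y => if y \in cell q n then
     a * (q / y ^+ 2) * complex.Re (f (q / y - n.+1%:R)) -
     b * (q / y ^+ 2) * complex.Im (f (q / y - n.+1%:R)) else 0)); last first.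
    apply/funext => y; rewrite /secfun E; case: ifP => // _.
    by case: (f _) => c d /=; rewrite !mulr0 subr0 add0r.
  apply: measurable_if_cell; apply: measurable_funB; apply: measurable_funM => //;
    exact: measurable_funM.
rewrite (_ : (fun x => _) = (fun y => if y \in cell q n then
   a * (q / y ^+ 2) * complex.Im (f (q / y - n.+1%:R)) +
   b * (q / y ^+ 2) * complex.Re (f (q / y - n.+1%:R)) else 0)); last first.
  apply/funext => y; rewrite /secfun E; case: ifP => // _.
  by case: (f _) => c d /=; rewrite !mulr0 subr0 add0r.
apply: measurable_if_cell; apply: measurable_funD; apply: measurable_funM => //;
  exact: measurable_funM.
Qed.

Lemma integral_secfun n (f : R -> C) : q <= n.+1%:R ->
  measurable_fun D (fun x => complex.Re (f x)) ->
  measurable_fun D (fun x => complex.Im (f x)) ->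
  (\int[mu]_(x in D) nf (secfun w n f) x = \int[mu]_(x in D) nf f x)%E.
Proof.
move=> qn mr mi; have [m1 m2] := measurable_secfun n mr mi.
transitivity (\int[mu]_(x in cell q n) nf (secfun w n f) x)%E.
  have -> : cell q n = D `&` cell q n by rewrite setIidr//; exact: cell_sub_D.
  rewrite integral_mkcondr; apply: eq_integral => x _; rewrite patchE.
  by case: ifPn => // xc; rewrite /nf /secfun (negbTE xc) [normc _]normc0.
rewrite -(integral_branch q0)//.
- apply: eq_integral => x; rewrite inE => Dx; rewrite /nf secfun_invbr//.
  have x0 : 0 <= x by move: Dx; rewrite /= in_itv/= => /andP[/ltW].
  rewrite -EFinM !normcM normcR normcV normcX w1 expr1n invr1 mul1r.
  rewrite ger0_norm ?invr_ge0 ?wt_ge0// mulVKf//.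
  by rewrite gt_eqF// wt_gt0.
- apply/measurable_EFinP.
  rewrite (_ : (fun x => normc (secfun w n f x)) = (fun x =>
    Num.sqrt (complex.Re (secfun w n f x) ^+ 2 + complex.Im (secfun w n f x) ^+ 2))).
    apply: (@measurableT_comp _ _ _ _ _ _ (@Num.sqrt R)).
      by apply: continuous_measurable_fun; exact: sqrt_continuous.
    by apply: measurable_funD; exact: measurable_funX.
  by apply/funext => x; case: (secfun _ _ _ x).
- by move=> x; exact: nf_ge0.
Qed.

Lemma secfun_int n (f : R -> C) : q <= n.+1%:R -> f \in cintegrable ->
  secfun w n f \in cintegrable.
Proof.
move=> qn hf; have [mr mi] := cintegrable_measurable hf.
have [m1 m2] := measurable_secfun n mr mi.
have m1' : measurable_fun D (fun x => complex.Re (secfun w n f x)) by exact: measurable_funTS.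
have m2' : measurable_fun D (fun x => complex.Im (secfun w n f x)) by exact: measurable_funTS.
apply: (cintegrable_dom (u := nf (secfun w n f))) => // [|x _]; last exact: nf_ge0.
apply/integrableP; split.
  by apply/measurable_EFinP; exact: measurable_normc.
under eq_integral do rewrite gee0_abs ?nf_ge0//.
by rewrite integral_secfun// -N1E// ltry.
Qed.

Lemma N1_secfun n (f : R -> C) : q <= n.+1%:R -> f \in cintegrable ->
  N1 (secfun w n f) = N1 f.
Proof.
move=> qn hf; apply: EFin_inj; rewrite !N1E//; last exact: secfun_int.
by have [mr mi] := cintegrable_measurable hf; exact: integral_secfun.
Qed.

Lemma secfun_lin n (a : C) f g :
  secfun w n (fun x => a * f x + g x) =
  (fun y => a * secfun w n f y + secfun w n g y).
Proof.
apply/funext => y; rewrite /secfun; case: ifP => _; last by rewrite mulr0 addr0.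
by rewrite mulrDr mulrCA.
Qed.

Definition sec (n : nat) (h : L1 R) : L1 R := L1class (secfun w n (L1val_of h)).

Lemma sec_class n (f : R -> C) : q <= n.+1%:R -> f \in cintegrable ->
  sec n (L1class f) = L1class (secfun w n f).
Proof.
move=> qn hf; have hv := L1val_int (L1class f).
have hd : (fun x => -1 * f x + L1val_of (L1class f) x) \in cintegrable.
  by apply: rpredD hv; exact: cintegrableZ.
have h1 := secfun_int qn hf; have h2 := secfun_int qn hv.
apply/eqP; rewrite -subr_eq0; apply/eqP; apply: nR_eq0.
rewrite -L1classB// nR_class; last exact: rpredB h2 h1.
have -> : (fun x => secfun w n (L1val_of (L1class f)) x - secfun w n f x) =
   secfun w n (fun x => -1 * f x + L1val_of (L1class f) x).
  by rewrite secfun_lin; apply/funext => x; rewrite mulN1r addrC.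
rewrite N1_secfun// -nR_class// L1classD ?L1classZ ?cintegrableZ// L1class_val.
by rewrite scaleN1r addNr nR0.
Qed.

Lemma sec_lin n : q <= n.+1%:R -> forall (a : C) g h,
  sec n (a *: g + h) = a *: sec n g + sec n h.
Proof.
move=> qn a; apply: L1class_ind => g hg; apply: L1class_ind => h hh.
have hag : (fun x => a * g x) \in cintegrable by exact: cintegrableZ.
have hs : (fun x => a * g x + h x) \in cintegrable by exact: rpredD hag hh.
have ig := secfun_int qn hg; have ih := secfun_int qn hh.
have iag : (fun x => a * secfun w n g x) \in cintegrable by exact: cintegrableZ.
by rewrite -L1classZ// -L1classD// !sec_class// -L1classZ// -L1classD// secfun_lin.
Qed.

Lemma nR_sec n h : q <= n.+1%:R -> nR (sec n h) = nR h.
Proof.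
move=> qn; move: h; apply: L1class_ind => h hh.
by rewrite sec_class// !nR_class// ?N1_secfun//; exact: secfun_int.
Qed.

Lemma cell_inj (i j : nat) y : cell q i y -> cell q j y -> i = j.
Proof.
move=> ci cj; have /trivIsetP := trivIset_cell q0.
move=> /(_ i j I I); have [-> //|ij /(_ isT)] := eqVneq i j.
by move=> /seteqP[h _]; have /h := conj ci cj.
Qed.

(** Only branch n meets the support of secfun n. *)
Lemma transfer_secfun n f x : q <= n.+1%:R -> D x ->
  transfer_series w q (secfun w n f) x = f x.
Proof.
move=> qn Dx; rewrite transfer_seriesE; apply: (@cvg_lim C^o hausdorffC).
have x0 : 0 <= x by move: Dx; rewrite /= in_itv/= => /andP[/ltW].
have tE k : tterm q w (secfun w n f) x k = if k == n then f x else 0.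
  rewrite /tterm; case: eqP => [->|kn].
    rewrite /patch mem_set; last exact: cell_sub_D qn _ (invbr_cell q0 n Dx).
    rewrite secfun_invbr// fmorphV/=.
    have t0 : (wt q n x)%:C != 0 :> C.
      by apply/eqP => /complexI/eqP; rewrite gt_eqF// wt_gt0.
    have W0 : w ^+ n.+1 != 0 by rewrite expf_neq0.
    move: ((wt q n x)%:C) (w ^+ n.+1) t0 W0 => t W t0 W0.
    by field; rewrite t0 W0.
  rewrite /patch; case: ifP => _; last by rewrite mulr0.
  rewrite /secfun ifF ?mulr0//; apply/negP => /set_mem h.
  apply: kn; exact: (cell_inj (invbr_cell q0 k Dx) h).
apply: (cvg_near_cst (f x : C^o)); exists n.+1 => // m /= nm.
rewrite /series/= (bigD1_seq n)/= ?mem_index_iota ?iota_uniq//.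
rewrite tE eqxx big1 ?addr0// => k kn.
by rewrite tE (negbTE kn).
Qed.

Lemma transfer_sec n h : q <= n.+1%:R -> transfer w q (sec n h) = h.
Proof.
move=> qn; move: h; apply: L1class_ind => h hh.
have hs := secfun_int qn hh.
rewrite sec_class// transfer_class//; apply/L1class_eq => //.
  exact: transfer_series_int.
by apply: aeW => x Dx; exact: transfer_secfun.
Qed.

End Sections.

Section Disjoint.
Context {R : realType}.
Local Notation C := R[i].
Variables (q : R) (q1 : 1 < q) (w w' : C) (w1 : normc w = 1) (w1' : normc w' = 1).

(** Sections along different branches have disjoint supports. *)
Lemma nR_sec3 (a b c : nat) (g h : L1 R) : q <= a.+1%:R -> q <= b.+1%:R ->
  q <= c.+1%:R -> a != b -> a != c -> b != c ->
  nR (sec q w a g - sec q w b g + sec q w' c h) = 2 * nR g + nR h.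
Proof.
move=> qa qb qc ab ac bc; move: g h; apply: L1class_ind => g hg.
apply: L1class_ind => h hh.
have ha := secfun_int q1 w1 qa hg; have hb := secfun_int q1 w1 qb hg.
have hc := secfun_int q1 w1' qc hh.
have hab : (fun x => secfun q w a g x - secfun q w b g x) \in cintegrable by exact: rpredB ha hb.
have habc : (fun x => secfun q w a g x - secfun q w b g x + secfun q w' c h x) \in cintegrable
  by exact: rpredD hab hc.
rewrite !sec_class// -L1classB// -L1classD// !nR_class//.
rewrite mulrDl mul1r -{1}(N1_secfun q1 w1 qa hg) -(N1_secfun q1 w1 qb hg).
rewrite -(N1_secfun q1 w1' qc hh) /N1.
have ia := integrable_normc ha; have ib := integrable_normc hb.
have ic := integrable_normc hc.
have mD := @measurable_D R.
rewrite -RintegralD// -RintegralD//; last exact: (integrableD mD ia ib).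
apply: eq_Rintegral => x _ /=.
have nz : normc (0 : C) = 0 by exact: normc0.
rewrite /secfun; case: ifPn => xa.
  have -> : (x \in cell q b) = false.
    apply/negP => /set_mem xb; move/eqP: ab; apply; apply: cell_inj xb => //; exact: set_mem.
  have -> : (x \in cell q c) = false.
    apply/negP => /set_mem xb; move/eqP: ac; apply; apply: cell_inj xb => //; exact: set_mem.
  by rewrite nz subr0 !addr0.
case: ifPn => xb.
  have -> : (x \in cell q c) = false.
    apply/negP => /set_mem xc; move/eqP: bc; apply; apply: cell_inj xc => //; exact: set_mem.
  by rewrite nz sub0r !addr0 normcN add0r.
by rewrite nz subr0 !add0r.
Qed.

End Disjoint.

(** * The spectrum of the composition *)

Section BoundedFunctions.
Context {R : realType}.
Local Notation C := R[i].
Local Notation mu := (@lebesgue_measure R).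
Local Notation D := (`]0, 1[%classic : set R).

Lemma mu_D : mu D = 1%E.
Proof. by rewrite lebesgue_measure_itv/= lte_fin ltr01 oppr0 adde0. Qed.

Lemma cintegrable_bounded (f : R -> C) (M : R) :
  measurable_fun D (fun x => complex.Re (f x)) ->
  measurable_fun D (fun x => complex.Im (f x)) ->
  (forall x, D x -> normc (f x) <= M) -> f \in cintegrable.
Proof.
move=> m1 m2 fM.
have M0 : 0 <= M.
  have D2 : D (2^-1) by rewrite /= in_itv/= invr_gt0 ltr0n/= invf_lt1// ltr1n.
  exact: le_trans (normc_ge0 _) (fM _ D2).
have mD := @measurable_D R.
apply: (cintegrable_dom (u := cst M%:E) m1 m2) => //.
apply/integrableP; split; first exact: measurable_cst.
rewrite integral_cst// [X in (_ * X)%E](_ : _ = 1%E); last exact: mu_D.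
by rewrite mule1 /= ltry.
Qed.

Lemma cintegrable_cst (c : C) : (fun=> c) \in @cintegrable R.
Proof. by apply: (@cintegrable_bounded _ (normc c)) => // x _. Qed.

Lemma N1_cst (c : C) : N1 (fun=> c) = normc c :> R.
Proof.
rewrite /N1 Rintegral_cst; last exact: measurable_D.
by rewrite [X in fine X](_ : _ = 1%E) ?mulr1//; exact: mu_D.
Qed.

End BoundedFunctions.

Section Spectrum.
Context {R : realType}.
Local Notation C := R[i].
Variables (q : R) (zeta eta : C).
Hypotheses (q1 : 1 < q) (z1 : normc zeta = 1) (e1 : normc eta = 1).

Let Q : L1 R -> L1 R := transfer zeta q \o transfer eta q.

Lemma Q_lin (a : C) g h : Q (a *: g + h) = a *: Q g + Q h.
Proof. by rewrite /Q /= !transferP. Qed.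

Lemma nR_Q h : nR (Q h) <= nR h.
Proof. by rewrite /Q/=; apply: le_trans (nR_transfer _ _ _) (nR_transfer _ _ _). Qed.

Lemma closed_discE :
  closure [set z : C^o | `|z| < 1] = [set z : C^o | normc (z : C) <= 1].
Proof.
apply/seteqP; split=> [z cz|z z1'].
  apply/ler_addgt0Pl => e e0.
  have e0' : (0 : C) < e%:C by rewrite ltcR.
  have [a [a1 ]] := cz _ (nbhsx_ballx z _ e0').
  rewrite -ball_normE/= normCE ltcR => za.
  move: a1; rewrite /= normCE -[1]/(1%:C) ltcR => a1.
  apply: (@le_trans _ _ (normc (z - a : C) + normc (a : C))).
    by apply: le_trans (le_normcD _ _); rewrite subrK.
  by apply: lerD; exact: ltW.
move=> B /nbhs_ballP[e /= e0 eB].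
move: (e0); rewrite ltcE/= => /andP[/eqP ei er].
have eE : e = (complex.Re e)%:C by move: ei; case: (e) => a' b /= ->.
pose d := Num.min (complex.Re e) 1 / 2.
have d0 : 0 < d by rewrite divr_gt0// lt_min er ltr01.
have d1 : d <= 1 / 2 by rewrite ler_pM2r ?invr_gt0// ge_min lexx orbT.
have de : d < complex.Re e.
  have : Num.min (complex.Re e) 1 <= complex.Re e by rewrite ge_min lexx.
  by rewrite /d; lra.
exists ((1 - d)%:C * z); split.
  rewrite /= normCE -[X in _ < X]/(1%:C) ltcR normcM normcR ger0_norm; last by lra.
  move: z1' => /= z1'.
  by apply: le_lt_trans (_ : (1 - d) * 1 < 1); [rewrite ler_wpM2l//; lra|lra].
apply: eB; rewrite -ball_normE/= normCE eE ltcR.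
have -> : z - (1 - d)%:C * z = d%:C * z by rewrite rmorphB; ring.
rewrite normcM normcR gtr0_norm//; apply: le_lt_trans de.
by rewrite ler_piMr// ltW.
Qed.

Let N := Num.bound q.

Let qN n : q <= (N + n).+1%:R.
Proof.
apply: le_trans (ltW (archi_boundP (ltW (lt_trans ltr01 q1)))) _.
by rewrite ler_nat -/N leqW// leq_addr.
Qed.

Let Dl (h : L1 R) := sec q eta (N + 1) h - sec q eta (N + 2) h.
Let S (h : L1 R) := sec q eta (N + 0) (sec q zeta (N + 0) h).

Let Dl_lin (a : C) g h : Dl (a *: g + h) = a *: Dl g + Dl h.
Proof. by rewrite /Dl !sec_lin// scalerBr opprD addrACA. Qed.

Let S_lin (a : C) g h : S (a *: g + h) = a *: S g + S h.
Proof. by rewrite /S !sec_lin. Qed.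

Let QS h : Q (S h) = h.
Proof. by rewrite /Q /S/= !transfer_sec. Qed.

Let QD0 h : Q (Dl h) = 0.
Proof.
rewrite /Q /Dl/= (opB (transferP q1 e1)) !transfer_sec// subrr.
exact: (op0 (transferP q1 z1)).
Qed.

Let DS g h : nR (Dl g + S h) = 2 * nR g + nR h.
Proof.
rewrite /Dl /S nR_sec3// ?eqn_add2l//; by rewrite nR_sec.
Qed.

Let u : L1 R := L1class (fun=> 1).

Let u0 : 0 < nR u.
Proof. by rewrite /u nR_class ?cintegrable_cst// N1_cst normc1 ltr01. Qed.

Lemma not_fredholm (l : C) : normc l <= 1 -> ~ fredholm (fun x => Q x - l *: x).
Proof.
rewrite le_eqVlt => /predU1P[l1 [_ cl _]|l1 [fd _ _]].
  exact: (range_not_closed Q_lin nR_Q S_lin Dl_lin QS QD0 DS u0 l1 cl).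
exact: (kernel_infinite Q_lin S_lin Dl_lin QS QD0 DS u0 l1 fd).
Qed.

Lemma fredholm_spectrumE : fredholm_spectrum Q = [set l | normc l <= 1].
Proof.
apply/seteqP; split=> l; last exact: not_fredholm.
move=> nf; rewrite /= leNgt; apply/negP => l1; apply: nf.
exact: invertible_fredholm (invertible_outside Q_lin nR_Q l1).
Qed.

Lemma spectrumE : spectrum Q = [set l | normc l <= 1].
Proof.
apply/seteqP; split=> l; last first.
  by move=> /not_fredholm nf /invertible_fredholm.
move=> ni; rewrite /= leNgt; apply/negP => l1; apply: ni.
exact (invertible_outside Q_lin nR_Q l1).
Qed.

Lemma range_IQ_not_closed : ~ closed (range (fun h => h - Q h)).
Proof.
have -> : range (fun h => h - Q h) = range (fun h => Q h - 1 *: h).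
  have QN h : Q (- h) = - Q h.
    by rewrite -[- h]sub0r (opB Q_lin) (op0 Q_lin) sub0r.
  by apply/seteqP; split=> _ [h _ <-]; exists (- h) => //;
    rewrite QN scale1r opprK addrC.
have n1 : normc (1 : C) = 1 by exact: normc1.
exact (range_not_closed Q_lin nR_Q S_lin Dl_lin QS QD0 DS u0 n1).
Qed.

End Spectrum.

(** * Functions of bounded variation *)

Section BoundedVariation.
Context {R : realType}.
Local Notation C := R[i].
Local Notation mu := (@lebesgue_measure R).
Local Notation D := (`]0, 1[%classic : set R).

(** The extension by zero.  The value 0 at the end point 1 makes the variation
on (0,1] bound the function itself. *)
Definition cut (f : R -> C) : R -> C := patch (fun=> 0) D f.

(** A bound a on the variation of f on (0,1], in the form of a majorant v that
increases by at least the oscillation of f on every interval.  Majorants add up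
and can be transported along monotone maps, which the proof of the Lasota-Yorke
inequality uses, and no partitions are needed. *)
Definition bvle (f : R -> C) (a : R) := exists v : R -> R,
  (forall x y, 0 < x -> x <= y -> y <= 1 ->
     normc (cut f y - cut f x) <= v y - v x) /\
  (forall x, 0 < x -> x <= 1 -> 0 <= v x /\ v x <= a).

Definition good (f : R -> C) (a : R) :=
  [/\ measurable_fun D (fun x => complex.Re (f x)),
      measurable_fun D (fun x => complex.Im (f x)) & bvle f a].

Lemma cutE (f : R -> C) x : D x -> cut f x = f x.
Proof. by move=> Dx; rewrite /cut /patch mem_set. Qed.

Lemma cut0 (f : R -> C) x : ~ D x -> cut f x = 0.
Proof. by move=> Dx; rewrite /cut /patch memNset. Qed.

Lemma cut_ge1 (f : R -> C) x : 1 <= x -> cut f x = 0.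
Proof.
move=> x1; apply: cut0; rewrite /= in_itv/= => /andP[_].
by rewrite ltNge x1.
Qed.

Lemma bvle_bound f a x : bvle f a -> D x -> normc (f x) <= a.
Proof.
move=> [v [dv bv]] Dx; have := Dx; rewrite /= in_itv/= => /andP[x0 x1].
have := dv x 1 x0 (ltW x1) (lexx _).
rewrite (cutE _ Dx) cut_ge1// sub0r normcN => h.
have [_ h2] := bv 1 ltr01 (lexx _); have [h3 _] := bv x x0 (ltW x1).
by lra.
Qed.

Lemma bvle_ge0 f a : bvle f a -> 0 <= a.
Proof. by move=> [v [_ bv]]; have [h1 h2] := bv 1 ltr01 (lexx _); exact: le_trans h2. Qed.

Lemma bvle_le f a b : a <= b -> bvle f a -> bvle f b.
Proof.
move=> ab [v [dv bv]]; exists v; split=> // x x0 x1.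
by have [h1 h2] := bv x x0 x1; split=> //; exact: le_trans ab.
Qed.

Lemma good_le f a b : a <= b -> good f a -> good f b.
Proof. by move=> ab [m1 m2 b1]; split=> //; exact: bvle_le b1. Qed.

Lemma good_int f a : good f a -> f \in cintegrable.
Proof.
by move=> [m1 m2 b]; apply: (cintegrable_bounded m1 m2) => x Dx; exact: bvle_bound b Dx.
Qed.

Lemma goodD f g a b : good f a -> good g b -> good (fun x => f x + g x) (a + b).
Proof.
move=> [m1 m2 [v [dv bv]]] [m3 m4 [w [dw bw]]]; split.
- rewrite (_ : (fun x => _) = (fun x => complex.Re (f x) + complex.Re (g x))).
    exact: measurable_funD.
  by apply/funext => x; case: (f x); case: (g x).
- rewrite (_ : (fun x => _) = (fun x => complex.Im (f x) + complex.Im (g x))).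
    exact: measurable_funD.
  by apply/funext => x; case: (f x); case: (g x).
- exists (fun x => v x + w x); split=> [x y x0 xy y1|x x0 x1].
    have -> : cut (fun x => f x + g x) y - cut (fun x => f x + g x) x =
        (cut f y - cut f x) + (cut g y - cut g x).
      rewrite addrACA -opprD; congr (_ - _); rewrite /cut /patch;
        by case: ifP => // _; rewrite addr0.
    apply: le_trans (le_normcD _ _) _.
    by have := dv x y x0 xy y1; have := dw x y x0 xy y1; lra.
  by have [? ?] := bv x x0 x1; have [? ?] := bw x x0 x1; split; lra.
Qed.

Lemma goodZ f a (c : C) : good f a -> good (fun x => c * f x) (normc c * a).
Proof.
move=> [m1 m2 [v [dv bv]]]; split.
- rewrite (_ : (fun x => _) = (fun x => complex.Re c * complex.Re (f x) -
     complex.Im c * complex.Im (f x))).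
    by apply: measurable_funB; apply: measurable_funM.
  by apply/funext => x; case: (c) => ? ?; case: (f x).
- rewrite (_ : (fun x => _) = (fun x => complex.Re c * complex.Im (f x) +
     complex.Im c * complex.Re (f x))).
    by apply: measurable_funD; apply: measurable_funM.
  by apply/funext => x; case: (c) => ? ?; case: (f x).
- exists (fun x => normc c * v x); split=> [x y x0 xy y1|x x0 x1].
    have cE z : cut (fun x => c * f x) z = c * cut f z.
      by rewrite /cut /patch; case: ifP => // _; rewrite mulr0.
    by rewrite !cE -mulrBr normcM -mulrBr ler_wpM2l ?normc_ge0// dv.
  have [? ?] := bv x x0 x1; have := normc_ge0 c => c0.
  by rewrite mulr_ge0//= ler_wpM2l.
Qed.

Lemma good_step (t : R) : good (fun x => if x < t then 1 else 0 : C) 1.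
Proof.
have mstep : measurable_fun D (fun x : R => if x < t then 1 else 0 : R).
  apply: measurable_fun_if => //.
  exact: measurable_fun_ltr.
split.
- by rewrite (_ : (fun x => _) = (fun x => if x < t then 1 else 0 : R))//;
     apply/funext => x; case: ifP.
- by rewrite (_ : (fun x => _) = cst (0 : R))//; apply/funext => x; case: ifP.
- exists (fun x => if (x < t) && (x < 1) then 0 else 1); split=> [x y x0 xy y1|x x0 x1].
    have cE z : 0 < z -> cut (fun x => if x < t then 1 else 0 : C) z =
        if (z < t) && (z < 1) then 1 else 0.
      move=> z0; rewrite /cut /patch; case: ifPn.
        by rewrite inE/= in_itv/= => /andP[_ ->]; rewrite andbT.
      by rewrite notin_setE/= in_itv/= z0/= => /negP/negbTE ->; rewrite andbF.
    rewrite !cE//; last exact: lt_le_trans xy.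
    have [/andP[yt yy]|_] := boolP ((y < t) && (y < 1)).
      have -> : (x < t) && (x < 1) by rewrite (le_lt_trans xy yt) (le_lt_trans xy yy).
      by rewrite !subrr [normc _]normc0.
    case: ifP => _; last by rewrite !subrr [normc _]normc0.
    by rewrite sub0r normcN [normc _]normc1 subr0.
  by case: ifP => _; split; rewrite ?ler01.
Qed.

Lemma good_cst (c : C) : good (fun=> c) (normc c).
Proof.
have := goodZ c (good_step 1); rewrite mulr1 => -[_ _ [v [dv bv]]].
split; [exact: measurable_cst|exact: measurable_cst|exists v; split=> //].
move=> x y x0 xy y1; have := dv x y x0 xy y1.
suff cE z : cut (fun x => c * (if x < 1 then 1 else 0)) z = cut (fun=> c) z by rewrite !cE.
rewrite /cut /patch; case: ifPn => //; rewrite inE/= in_itv/= => /andP[_ ->].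
by rewrite mulr1.
Qed.

(** F is the integral of |f| over (0,x].  The last property compares the value at y
with the mean over ]x,y]: they differ by at most the oscillation of f there. *)
Lemma primitive f a (v : R -> R) : good f a ->
  (forall x y, 0 < x -> x <= y -> y <= 1 ->
     normc (cut f y - cut f x) <= v y - v x) ->
  exists F : R -> R, [/\ forall x y, 0 < x -> x <= y -> F x <= F y,
    forall x, 0 <= F x /\ F x <= N1 f &
    forall x y, 0 < x -> x <= y -> y <= 1 ->
      (y - x) * normc (cut f y) <= F y - F x + (y - x) * (v y - v x)].
Proof.
move=> gf dv; have [m1 m2 _] := gf; have hf := good_int gf.
have mD := @measurable_D R.
have ci : mu.-integrable setT (fun x => (normc (cut f x))%:E).
  have := (@integrable_mkcond _ (measurableTypeR R) R mu D (nf f) mD).1 (integrable_normc hf).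
  apply: eq_integrable => // x _; rewrite /restrict /cut /patch.
  by case: ifP => // _; rewrite [normc _]normc0.
have cii A : measurable A -> mu.-integrable A (fun x => (normc (cut f x))%:E).
  by move=> mA; apply: integrableS ci => //; exact: measurableT.
pose F y := \int[mu]_(x in `]0, y]) normc (cut f x).
have FB x y : 0 < x -> x <= y -> F y - F x = \int[mu]_(z in `]x, y]) normc (cut f z).
  move=> x0 xy; rewrite /F Rintegral_itvB// ?bnd_simp ?(ltW x0)//.
  by apply: cii; exact: measurable_itv.
have Fm x y : 0 < x -> x <= y -> F x <= F y.
  by move=> x0 xy; rewrite -subr_ge0 FB//; apply: Rintegral_ge0 => z _; exact: normc_ge0.
exists F; split => //.
  move=> x; split; first by apply: Rintegral_ge0 => z _; exact: normc_ge0.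
  have -> : N1 f = \int[mu]_x normc (cut f x).
    rewrite /N1 Rintegral_mkcond; apply: eq_Rintegral => z _.
    by rewrite /restrict /cut /patch; case: ifP => // _; rewrite [normc _]normc0.
  rewrite /F /Rintegral fine_le//.
  - have mx : measurable (`]0, x]%classic : set (measurableTypeR R)) by exact: measurable_itv.
    exact: integrable_fin_num (cii _ mx).
  - exact: integrable_fin_num ci.
  - apply: ge0_subset_integral => //.
    + exact (measurable_int _ ci).
    + by move=> z _; rewrite lee_fin normc_ge0.
move=> x y x0 xy y1; rewrite FB//.
have mi : measurable (`]x, y]%classic : set (measurableTypeR R)) by exact: measurable_itv.
have muE : fine (mu `]x, y]) = y - x.
  rewrite lebesgue_measure_itv/= lte_fin; case: ltP => // yx.
  by rewrite (_ : x = y) ?subrr//; apply/eqP; rewrite eq_le xy yx.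
have Dv z : z \in `]x, y]%classic -> normc (cut f y) <= normc (cut f z) + (v y - v x).
  rewrite inE/= in_itv/= => /andP[xz zy].
  have z0 : 0 < z by exact: lt_trans xz.
  have h1 := dv z y z0 zy y1; have h2 := dv x z x0 (ltW xz) (le_trans zy y1).
  have h3 : normc (cut f y) <= normc (cut f y - cut f z) + normc (cut f z).
    by apply: le_trans (le_normcD _ _); rewrite subrK.
  by have := normc_ge0 (cut f z - cut f x); lra.
have ic (c : R) : mu.-integrable `]x, y] (fun=> c%:E).
  apply/integrableP; split; first exact: measurable_cst.
  rewrite integral_cst//= lebesgue_measure_itv/= lte_fin; case: ifP => _.
    by rewrite -EFinB -EFinM ltry.
  by rewrite mule0 ltry.
have -> : (y - x) * normc (cut f y) = \int[mu]_(z in `]x, y]) normc (cut f y).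
  by rewrite Rintegral_cst// muE mulrC.
have -> : (y - x) * (v y - v x) = \int[mu]_(z in `]x, y]) (v y - v x).
  by rewrite Rintegral_cst// muE mulrC.
rewrite -RintegralD//; [|exact (cii _ mi)|exact (ic _)].
apply: le_Rintegral => //.
- exact (ic _).
- exact (integrableD mi (cii _ mi) (ic _)).
- by move=> z zxy; apply: Dv; rewrite inE.
Qed.

End BoundedVariation.

(** * Lasota-Yorke inequality *)

Section LasotaYorke.
Context {R : realType}.
Local Notation C := R[i].
Local Notation mu := (@lebesgue_measure R).
Local Notation D := (`]0, 1[%classic : set R).
Variables (q : R) (q1 : 1 < q).

Let q0 : 0 < q. Proof. exact: lt_trans ltr01 q1. Qed.

(** The first integer n with q / n < 1: the cells to the left of q / n lie in (0,1). *)
Definition topn : nat := (Num.truncn q).+1.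
Local Notation N := topn.

Lemma topn_gt : q < N%:R.
Proof. by have /andP[] := truncn_itv (ltW q0). Qed.

Lemma topn_le : N.-1%:R <= q.
Proof. by have /andP[] := truncn_itv (ltW q0). Qed.

Lemma topn_ge2 : (2 <= N)%N.
Proof. by rewrite /topn ltnS truncn_gt0 ltW. Qed.

(** The contraction of the variation: the cells inside (0,1) have weights at most
q / topn^2, and the factor 2 comes from the jump at the end point 1; the
cell cut by 1 has weights below q^-1 and no jump. *)
Definition kappa : R := Num.max (2 * (q / N%:R ^+ 2)) q^-1.

Let N0 : (0 : R) < N%:R. Proof. exact: lt_trans q0 topn_gt. Qed.

Lemma kappa_lt1 : kappa < 1.
Proof.
rewrite gt_max invf_lt1// q1 andbT mulrA ltr_pdivrMr ?exprn_gt0// mul1r.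
have h1 := topn_gt; have h2 : (2 : R) <= N%:R by rewrite ler_nat topn_ge2.
rewrite expr2; apply: (@lt_le_trans _ _ (2 * N%:R)); first by rewrite ltr_pM2l.
by rewrite ler_pM2r.
Qed.

Lemma kappa_gt0 : 0 < kappa.
Proof. by rewrite lt_max invr_gt0 q0 orbT. Qed.

Section Fix.
Variables (f : R -> C) (a : R) (v F : R -> R).
Hypothesis dv : forall x y, 0 < x -> x <= y -> y <= 1 ->
  normc (cut f y - cut f x) <= v y - v x.
Hypothesis bv : forall x, 0 < x -> x <= 1 -> 0 <= v x /\ v x <= a.
Hypothesis Fm : forall x y, 0 < x -> x <= y -> F x <= F y.
Hypothesis Fb : forall x, 0 <= F x /\ F x <= N1 f.
Hypothesis Fk : forall x y, 0 < x -> x <= y -> y <= 1 ->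
  (y - x) * normc (cut f y) <= F y - F x + (y - x) * (v y - v x).

Let c : R := q / N%:R.
Let c0 : 0 < c. Proof. by rewrite divr_gt0. Qed.
Let c1 : c <= 1.
Proof. by rewrite ler_pdivrMr// mul1r ltW// topn_gt. Qed.

Let vm x y : 0 < x -> x <= y -> y <= 1 -> v x <= v y.
Proof. by move=> x0 xy y1; have := dv x0 xy y1; have := normc_ge0 (cut f y - cut f x); lra. Qed.

Let k1 : R := q / N%:R ^+ 2.
Let k1_ge0 : 0 <= k1. Proof. by rewrite divr_ge0 ?ltW// exprn_gt0. Qed.
Let qV0 : 0 < q^-1. Proof. by rewrite invr_gt0. Qed.

Let W y := k1 * v (Num.min y c) + q^-1 * (v (Num.min (Num.max y c) 1) - v c) + 2 * q^-1 * F y.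
Let U y := k1 * v (Num.min y c) + 2 * F y.
Let G y : C := (y ^+ 2 / q)%:C * cut f y.

Let minc_gt0 y : 0 < y -> 0 < Num.min y c.
Proof. by move=> y0; rewrite lt_min y0 c0. Qed.

Let minc_le1 y : Num.min y c <= 1.
Proof. by rewrite ge_min c1 orbT. Qed.

Let vmin x y : 0 < x -> x <= y -> v (Num.min x c) <= v (Num.min y c).
Proof.
move=> x0 xy; apply: vm; [exact: minc_gt0| |exact: minc_le1].
by rewrite le_min !ge_min xy lexx orbT.
Qed.

Let maxc_gt0 y : 0 < Num.min (Num.max y c) 1.
Proof. by rewrite lt_min lt_max c0 orbT ltr01. Qed.

Let vmax x y : x <= y -> v (Num.min (Num.max x c) 1) <= v (Num.min (Num.max y c) 1).
Proof.
move=> xy; apply: vm; [exact: maxc_gt0| |by rewrite ge_min lexx orbT].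
by rewrite le_min !ge_min !ge_max !le_max xy !lexx !orbT.
Qed.

Let Wm x y : 0 < x -> x <= y -> W x <= W y.
Proof.
move=> x0 xy; rewrite /W; apply: lerD; first apply: lerD.
- by rewrite ler_wpM2l// vmin.
- by rewrite ler_pM2l// lerD2r vmax.
- by rewrite ler_wpM2l ?Fm// mulr_ge0// ltW.
Qed.

Let Um x y : 0 < x -> x <= y -> U x <= U y.
Proof.
move=> x0 xy; rewrite /U; apply: lerD.
- by rewrite ler_wpM2l// vmin.
- by rewrite ler_wpM2l ?Fm.
Qed.

Let W_ge0 y : 0 < y -> 0 <= W y.
Proof.
move=> y0; rewrite /W !addr_ge0//.
- by rewrite mulr_ge0//; have [] := bv (minc_gt0 y0) (minc_le1 y).
- rewrite mulr_ge0 ?(ltW qV0)// subr_ge0; apply: vm => //.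
    by rewrite le_min le_max lexx orbT c1.
  by rewrite ge_min lexx orbT.
- by rewrite mulr_ge0 ?mulr_ge0 ?(ltW qV0)//; have [] := Fb y.
Qed.

Let U_ge0 y : 0 < y -> 0 <= U y.
Proof.
move=> y0; rewrite /U addr_ge0//.
- by rewrite mulr_ge0//; have [] := bv (minc_gt0 y0) (minc_le1 y).
- by rewrite mulr_ge0//; have [] := Fb y.
Qed.

Let WUq : W q + U q <= kappa * a + 4 * N1 f.
Proof.
rewrite /W /U.
have cq : c <= q by exact: le_trans c1 (ltW q1).
rewrite (min_idPr cq) (max_idPl cq) (min_idPr (ltW q1)).
have [_ F1] := Fb q; have [v0 _] := bv c0 c1; have vc1 := vm c0 c1 (lexx 1).
have [_ va] := bv ltr01 (lexx 1).
have kk1 : 2 * k1 <= kappa by rewrite le_max lexx.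
have kk2 : q^-1 <= kappa by rewrite le_max lexx orbT.
have h1 : 2 * k1 * v c <= kappa * v c by rewrite ler_wpM2r.
have h2 : q^-1 * (v 1 - v c) <= kappa * (v 1 - v c) by rewrite ler_wpM2r// subr_ge0.
have h3 : kappa * v 1 <= kappa * a by rewrite ler_pM2l// kappa_gt0.
have qV1 : q^-1 <= 1 by rewrite invf_le1// ltW.
have F0 : 0 <= F q by have [] := Fb q.
have h4 : q^-1 * F q <= 1 * F q by rewrite ler_wpM2r.
have h5 : kappa * (v 1 - v c) = kappa * v 1 - kappa * v c by rewrite mulrBr.
lra.
Qed.

(* The oscillation due to the factor y^2 in G is controlled by the primitive F. *)
Let key y y' : 0 < y -> y <= y' -> y' <= 1 ->
  normc (G y' - G y) <= q^-1 * (y' ^+ 2 * (v y' - v y) + 2 * (F y' - F y)).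
Proof.
move=> y0 yy' y1; have y'0 : 0 < y' by exact: lt_le_trans yy'.
have -> : G y' - G y = (q^-1)%:C * ((y ^+ 2)%:C * (cut f y' - cut f y) +
    ((y' + y) * (y' - y))%:C * cut f y').
  rewrite /G; have -> : (y' + y) * (y' - y) = y' ^+ 2 - y ^+ 2 by ring.
  by rewrite !rmorphM rmorphB; ring.
rewrite normcM normcR ger0_norm ?(ltW qV0)// ler_pM2l//.
apply: le_trans (le_normcD _ _) _; rewrite !normcM !normcR.
rewrite ger0_norm ?sqr_ge0// [`|_ * _|]ger0_norm; last first.
  by apply: mulr_ge0; [apply: addr_ge0; exact: ltW|rewrite subr_ge0].
have h1 : y ^+ 2 * normc (cut f y' - cut f y) <= y ^+ 2 * (v y' - v y).
  by rewrite ler_wpM2l ?sqr_ge0// dv.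
have h2 : (y' + y) * ((y' - y) * normc (cut f y')) <=
    (y' + y) * (F y' - F y + (y' - y) * (v y' - v y)).
  by apply: ler_wpM2l; [apply: addr_ge0; exact: ltW|exact: Fk].
have h3 : (y' + y) * (F y' - F y) <= 2 * (F y' - F y).
  by rewrite ler_wpM2r ?subr_ge0 ?Fm//; lra.
have -> : (y' + y) * (y' - y) * normc (cut f y') = (y' + y) * ((y' - y) * normc (cut f y')) by rewrite mulrA.
apply: le_trans (lerD h1 h2) _.
rewrite mulrDr; have -> : y' ^+ 2 * (v y' - v y) =
   y ^+ 2 * (v y' - v y) + (y' + y) * ((y' - y) * (v y' - v y)) by ring.
lra.
Qed.

Let G_ge1 y : 1 <= y -> G y = 0.
Proof. by move=> y1; rewrite /G cut_ge1// mulr0. Qed.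

Let GW1 y y' : 0 < y -> y <= y' -> y' <= 1 -> y' <= c \/ c <= y ->
  normc (G y' - G y) <= W y' - W y.
Proof.
move=> y0 yy' y'1 cy; apply: le_trans (key y0 yy' y'1) _.
have y'0 : 0 < y' by exact: lt_le_trans yy'.
have dv0 : 0 <= v y' - v y by rewrite subr_ge0 vm.
rewrite /W; case: cy => [y'c|cy].
  rewrite (min_idPl y'c) (min_idPl (le_trans yy' y'c)).
  rewrite (max_idPr y'c) (max_idPr (le_trans yy' y'c)).
  have : q^-1 * (y' ^+ 2 * (v y' - v y)) <= k1 * (v y' - v y).
    rewrite mulrA ler_wpM2r//.
    have -> : k1 = q^-1 * c ^+ 2 by rewrite /k1 /c; field; rewrite !gt_eqF.
    by rewrite ler_pM2l// ler_sqr ?nnegrE ?(ltW y'0) ?(ltW c0).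
  by lra.
rewrite (min_idPr cy) (min_idPr (le_trans cy yy')).
rewrite (max_idPl cy) (max_idPl (le_trans cy yy')).
rewrite (min_idPl y'1) (min_idPl (le_trans yy' y'1)).
have : q^-1 * (y' ^+ 2 * (v y' - v y)) <= q^-1 * (v y' - v y).
  by rewrite ler_pM2l// ler_piMl// expr_le1// ltW.
lra.
Qed.

Let GW y y' : 0 < y -> y <= y' -> y' <= c \/ c <= y ->
  normc (G y' - G y) <= W y' - W y.
Proof.
move=> y0 yy' cy; have [y'1|/ltW y'1] := leP y' 1; first exact: GW1.
have [y1|/ltW y1] := leP y 1; last first.
  rewrite !G_ge1// subrr [normc _]normc0 subr_ge0; exact: Wm.
have cy' : 1 <= c \/ c <= y.
  by case: cy => [h|]; [left; exact: le_trans h|right].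
apply: le_trans (_ : W 1 - W y <= _); last by rewrite lerD2r Wm.
by rewrite (G_ge1 y'1) -(G_ge1 (lexx 1)); exact: GW1.
Qed.

Let qn n : R := q / n%:R.

Let qn_gt0 n : (0 < n)%N -> 0 < qn n.
Proof. by move=> n0; rewrite divr_gt0// ltr0n. Qed.

Let qn_le n m : (0 < n)%N -> (n <= m)%N -> qn m <= qn n.
Proof.
move=> n0 nm; rewrite ler_pM2l// lef_pV2 ?posrE ?ltr0n ?ler_nat//.
exact: leq_trans nm.
Qed.

(* The branches map the end point 1 to the points q/(n+2): these values of G add up
   to a bound for the jump of the transferred function at 1. *)
Let GU n : normc (G (qn n.+2)) <= U (qn n.+2) - U (qn n.+3).
Proof.
have y0 : 0 < qn n.+2 by exact: qn_gt0.
have y0' : 0 < qn n.+3 by exact: qn_gt0.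
have yy : qn n.+3 <= qn n.+2 by exact: qn_le.
have [nN|Nn] := ltnP n.+2 N.
  rewrite G_ge1; first by rewrite [normc _]normc0 subr_ge0 Um.
  rewrite /qn ler_pdivlMr ?ltr0n// mul1r; apply: le_trans topn_le.
  by rewrite ler_nat -ltnS prednK.
have yc : qn n.+2 <= c by exact: qn_le.
have y1 : qn n.+2 <= 1 by exact: le_trans c1.
have h := Fk y0' yy y1.
rewrite /U (min_idPl yc) (min_idPl (le_trans yy yc)) /G normcM normcR.
set y := qn n.+2 in h *; set y' := qn n.+3 in h *.
rewrite ger0_norm; last by rewrite divr_ge0 ?sqr_ge0// ltW.
have dyE : y - y' = q / (n.+2%:R * n.+3%:R).
  rewrite /y /y' /qn; field.
  by rewrite -?natrD !pnatr_eq0.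
have dy0 : 0 < y - y' by rewrite dyE divr_gt0// mulr_gt0// ltr0n.
have dv0 : 0 <= v y - v y' by rewrite subr_ge0 vm.
have dF0 : 0 <= F y - F y' by rewrite subr_ge0 Fm.
have e1 : y ^+ 2 / q = (n.+3%:R / n.+2%:R) * (y - y').
  rewrite dyE /y /qn; field.
  by rewrite -?natrD !pnatr_eq0/= gt_eqF.
have e2 : n.+3%:R / n.+2%:R <= 2 :> R.
  by rewrite ler_pdivrMr ?ltr0n// -natrM ler_nat mul2n -addnn !addSn !addnS !ltnS; exact: leqW (leq_addr _ _).
have e3 : y ^+ 2 / q <= k1.
  have -> : k1 = c ^+ 2 / q by rewrite /k1 /c; field; rewrite !gt_eqF.
  by rewrite ler_pM2r ?invr_gt0// ler_sqr ?nnegrE ?(ltW y0) ?(ltW c0).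
have e4 : 0 <= n.+3%:R / n.+2%:R :> R by [].
apply: (@le_trans _ _ ((n.+3%:R / n.+2%:R) * (F y - F y' + (y - y') * (v y - v y')))).
  by rewrite e1 -[leLHS]mulrA ler_wpM2l.
rewrite mulrDr mulrA -e1.
have h1 : n.+3%:R / n.+2%:R * (F y - F y') <= 2 * (F y - F y') by rewrite ler_wpM2r.
have h2 : y ^+ 2 / q * (v y - v y') <= k1 * (v y - v y') by rewrite ler_wpM2r.
apply: le_trans (lerD h1 h2) _; rewrite le_eqVlt; apply/orP; left; apply/eqP.
by ring.
Qed.

Variables (w : C) (w1 : normc w = 1).

Let ttermE n x : 0 <= x -> tterm q w f x n = w ^+ n.+1 * G (invbr q n x).
Proof.
move=> x0; rewrite /tterm /G mulrA; congr (_ * _%:C * _).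
rewrite /wt /invbr; field.
by rewrite nat1r !gt_eqF// addS_gt0.
Qed.

Let inv_gt0 n x : 0 <= x -> 0 < invbr q n x.
Proof. by move=> x0; rewrite divr_gt0// addS_gt0. Qed.

Let inv_le n x x' : 0 <= x -> x <= x' -> invbr q n x' <= invbr q n x.
Proof.
move=> x0 xx'; rewrite ler_pM2l// lef_pV2 ?posrE ?addS_gt0 ?lerD2l//.
exact: le_trans xx'.
Qed.

Let inv0 n : invbr q n 0 = qn n.+1. Proof. by rewrite /invbr addr0. Qed.
Let inv1 n : invbr q n 1 = qn n.+2. Proof. by rewrite /invbr natr1. Qed.

Let inv_side n x x' : 0 <= x -> x <= x' -> x' <= 1 ->
  invbr q n x <= c \/ c <= invbr q n x'.
Proof.
move=> x0 xx' x'1; have [nN|Nn] := ltnP n.+1 N.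
  right; apply: le_trans (inv_le n (le_trans x0 xx') x'1).
  by rewrite inv1 /c -/(qn N) qn_le.
left; apply: le_trans (inv_le n (lexx 0) x0) _.
by rewrite inv0 qn_le.
Qed.

Let t n x := W (qn n.+1) - W (invbr q n x).

Let t_ge0 n x : 0 <= x -> 0 <= t n x.
Proof.
by move=> x0; rewrite subr_ge0 -inv0 Wm//; [exact: inv_gt0|exact: inv_le].
Qed.

Let t_le n x x' : 0 <= x -> x <= x' -> t n x <= t n x'.
Proof.
move=> x0 xx'; rewrite lerD2l lerN2 Wm//; last exact: inv_le.
by apply: inv_gt0; exact: le_trans xx'.
Qed.

Let sum_tele (H : R -> R) k : (forall y, 0 < y -> 0 <= H y) -> forall m : nat,
  \sum_(0 <= n < k) (H (qn (n + m).+1) - H (qn (n + m).+2)) <= H (qn m.+1).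
Proof.
move=> H0 m.
have -> : \sum_(0 <= n < k) (H (qn (n + m).+1) - H (qn (n + m).+2)) =
    H (qn m.+1) - H (qn (k + m).+1).
  elim: k => [|k IH]; first by rewrite big_geq// add0n subrr.
  by rewrite big_nat_recr//= IH addrA subrK.
by rewrite gerBl H0// qn_gt0.
Qed.

Let qn1 : qn 1 = q. Proof. by rewrite /qn divr1. Qed.

Let t_sum x k : 0 <= x -> x <= 1 -> series (t^~ x) k <= W q.
Proof.
move=> x0 x1; apply: le_trans (_ : series (t^~ 1) k <= _).
  by apply: ler_sum => n _; exact: t_le.
rewrite /series/= -qn1; apply: le_trans (@sum_tele W k W_ge0 0%N).
by apply: ler_sum => n _; rewrite /t inv1 addn0.
Qed.

Let t_cvg x : 0 <= x -> x <= 1 -> cvgn (series (t^~ x)).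
Proof.
move=> x0 x1; apply: nondecreasing_is_cvgn.
  by apply: nondecreasing_series => n _ _; exact: t_ge0.
by exists (W q) => _ [k _ <-]; exact: t_sum.
Qed.

Let diffle n x x' : 0 <= x -> x <= x' -> x' <= 1 ->
  normc (G (invbr q n x) - G (invbr q n x')) <= t n x' - t n x.
Proof.
move=> x0 xx' x'1.
have -> : t n x' - t n x = W (invbr q n x) - W (invbr q n x').
  by rewrite /t; ring.
apply: GW; [by apply: inv_gt0; exact: le_trans xx'|exact: inv_le|exact: inv_side].
Qed.

Let normc_tt n x : 0 <= x -> normc (tterm q w f x n : C) = normc (G (invbr q n x)).
Proof. by move=> x0; rewrite ttermE// normcM normcX w1 expr1n mul1r. Qed.

Let Gsum x k : 0 <= x -> x <= 1 ->
  \sum_(0 <= n < k) normc (G (invbr q n x)) <= U q + W q - series (t^~ x) k.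
Proof.
move=> x0 x1.
apply: (@le_trans _ _ (\sum_(0 <= n < k) (normc (G (qn n.+2)) + (t n 1 - t n x)))).
  apply: ler_sum => n _.
  have h := diffle n x0 x1 (lexx 1).
  have := le_normcD (G (invbr q n x) - G (invbr q n 1)) (G (invbr q n 1)).
  by rewrite subrK inv1 in h * => h2; apply: le_trans h2 _; rewrite addrC lerD2l.
rewrite big_split/= sumrB -addrA; apply: lerD; last first.
  by rewrite lerD2r; exact: t_sum.
apply: le_trans (_ : U (qn 2) <= _); last by rewrite -[q]qn1 Um ?qn_gt0 ?qn_le.
apply: le_trans (@sum_tele U k U_ge0 1%N).
by apply: ler_sum => n _; rewrite addn1; exact: GU.
Qed.

Let tt_cvg x : 0 <= x -> x <= 1 -> cvgn (series (tterm q w f x)).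
Proof.
move=> x0 x1; apply: (abs_cvgC _).1; apply: le_lt_trans (ltry (U q + W q)).
apply: nneseries_le => [n|k]; first exact: normc_ge0.
apply: le_trans (_ : U q + W q - series (t^~ x) k <= _).
  rewrite /series/=; under eq_bigr do rewrite normc_tt//.
  exact: Gsum.
by rewrite gerBl; apply: sumr_ge0 => n _; exact: t_ge0.
Qed.

(** Branch n turns the part of f on cell n into G along a decreasing map, where
G is the weight times f as a function of y.  By [key] the oscillation of G is
majorised by that of W, so that the sum over n of W(q/(n+1)) - W(y_n(x)) is a
majorant for the transferred function on (0,1).  It telescopes to at most W(q).
The jump to 0 at the point 1 costs U(q), obtained from the values of G at the
end points q/(n+2) by [GU]. *)
Lemma bvle_transfer_series : bvle (transfer_series w q f) (kappa * a + 4 * N1 f).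
Proof.
pose v' x := if x < 1 then limn (series (t^~ x)) else W q + U q.
have Uq0 : 0 <= U q by exact: U_ge0.
have v'b x : 0 < x -> x < 1 -> 0 <= limn (series (t^~ x)) /\ limn (series (t^~ x)) <= W q.
  move=> x0 x1; have cx := t_cvg (ltW x0) (ltW x1); split.
    by apply: limr_ge => //; apply: nearW => k; apply: sumr_ge0 => n _; apply: t_ge0; exact: ltW.
  by apply: limr_le => //; apply: nearW => k; apply: t_sum; exact: ltW.
apply: (bvle_le WUq); exists v'; split=> [x y x0 xy y1|x x0 x1]; last first.
  rewrite /v'; case: ltP => [x1'|_].
    by have [h1 h2] := v'b x x0 x1'; split=> //; apply: le_trans h2 _; rewrite lerDl.
  by split=> //; rewrite addr_ge0// W_ge0.
rewrite /v'; have [ylt1|yge1] := ltP y 1.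
  have xlt1 : x < 1 by exact: le_lt_trans ylt1.
  have y0 : 0 < y by exact: lt_le_trans xy.
  rewrite xlt1 !cutE; [|by rewrite /= in_itv/= x0|by rewrite /= in_itv/= y0].
  rewrite !transfer_seriesE.
  have cx := tt_cvg (ltW x0) (ltW xlt1); have cy := tt_cvg (ltW y0) y1.
  have hC := cvgC_lin (a := -1) cx cy; rewrite mulN1r addrC in hC.
  have hR : (fun k => series (t^~ y) k - series (t^~ x) k) @ \oo -->
      limn (series (t^~ y)) - limn (series (t^~ x)).
    by apply: cvgB; apply: t_cvg => //; exact: ltW.
  apply: (normc_lim_le hC hR) => k.
  rewrite mulN1r addrC /series/= -!sumrB.
  apply: le_trans (le_normc_sum _ _ _) _; apply: ler_sum => n _.
  rewrite !ttermE ?(ltW x0) ?(ltW y0)// -mulrBr normcM normcX w1 expr1n mul1r.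
  by rewrite normcBC; apply: diffle => //; exact: ltW.
have -> : y = 1 by apply/eqP; rewrite eq_le y1.
have [xlt1|xge1] := ltP x 1; last first.
  have -> : x = 1 by apply/eqP; rewrite eq_le xge1 (le_trans xy).
  by rewrite !subrr [normc _]normc0.
rewrite cut_ge1// cutE; last by rewrite /= in_itv/= x0.
rewrite sub0r normcN transfer_seriesE.
have hR : (fun k => U q + W q - series (t^~ x) k) @ \oo -->
    U q + W q - limn (series (t^~ x)).
  apply: cvgB; first exact: cvg_cst.
  by apply: t_cvg; exact: ltW.
rewrite [W q + _]addrC.
apply: (normc_lim_le (tt_cvg (ltW x0) (ltW xlt1)) hR) => k.
apply: le_trans (le_normc_sum _ _ _) _.
under eq_bigr do rewrite normc_tt ?(ltW x0)//.
by apply: Gsum; exact: ltW.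
Qed.

End Fix.

Theorem lasota_yorke (w : C) (f : R -> C) (a : R) : normc w = 1 -> good f a ->
  good (transfer_series w q f) (kappa * a + 4 * N1 f).
Proof.
move=> w1 gf; have [m1 m2 [v [dv bv]]] := gf.
have [m3 m4] := measurable_transfer_series q w m1 m2; split=> //.
have [F [Fm Fb Fk]] := primitive gf dv.
exact: (bvle_transfer_series dv bv Fm Fb Fk w1).
Qed.

End LasotaYorke.

(** * Covering *)

Section Covering.
Context {R : realType}.
Local Notation mu := (@lebesgue_measure R).
Local Notation D := (`]0, 1[%classic : set R).
Variables (q : R) (q1 : 1 < q).

Let q0 : 0 < q. Proof. exact: lt_trans ltr01 q1. Qed.

Local Open Scope ereal_scope.

Lemma Pe_iter_ge0 M (u : R -> \bar R) : (forall x, D x -> 0 <= u x) ->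
  forall x, D x -> 0 <= iter M (Pe q) u x.
Proof.
move=> u0; elim: M => [//|M IH] x Dx; rewrite iterS.
exact: Pe_ge0.
Qed.

Lemma le_Pe_iter M (u v : R -> \bar R) : (forall x, D x -> 0 <= u x) ->
  (forall x, D x -> u x <= v x) ->
  forall x, D x -> iter M (Pe q) u x <= iter M (Pe q) v x.
Proof.
move=> u0 uv; elim: M => [//|M IH] x Dx; rewrite !iterS.
by apply: le_Pe => //; exact: Pe_iter_ge0.
Qed.

Lemma Pe_scale (c : R) (u : R -> \bar R) x : (0 <= c)%R ->
  (forall x, D x -> 0 <= u x) ->
  Pe q (fun y => c%:E * u y) x = c%:E * Pe q u x.
Proof.
move=> c0 u0; rewrite /Pe -nneseriesZl//; last by move=> n _; exact: Pe_term_ge0.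
apply: eq_eseriesr => n _; rewrite muleCA; congr (_ * _).
by rewrite /restrict /patch; case: ifP => // _; rewrite mule0.
Qed.

Lemma Pe_ext (u v : R -> \bar R) x : (forall y, D y -> u y = v y) ->
  Pe q u x = Pe q v x.
Proof.
move=> uv; apply: eq_eseriesr => n _; congr (_ * _).
by rewrite /restrict /patch; case: ifP => // /set_mem; exact: uv.
Qed.

Lemma Pe_iter_scale M (c : R) (u : R -> \bar R) : (0 <= c)%R ->
  (forall x, D x -> 0 <= u x) ->
  forall x, D x -> iter M (Pe q) (fun y => c%:E * u y) x = c%:E * iter M (Pe q) u x.
Proof.
move=> c0 u0; elim: M => [//|M IH] x Dx; rewrite !iterS.
by rewrite (Pe_ext _ IH) Pe_scale//; exact: Pe_iter_ge0.
Qed.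

Definition ind (a b : R) : R -> \bar R :=
  fun y => (if (a < y) && (y < b) then 1 else 0)%R%:E.

Lemma ind_ge0 a b y : 0 <= ind a b y.
Proof. by rewrite lee_fin; case: ifP. Qed.

(** One branch that sends ]s,t[ into ]a,b[ already contributes its weight, which
is at least the value of the weight at x = 1. *)
Lemma Pe_ind n (a b s t : R) : (0 <= a)%R -> (b <= 1)%R ->
  (forall x, D x -> (s < x)%R -> (x < t)%R ->
     ((a < invbr q n x) && (invbr q n x < b))%R) ->
  forall x, D x -> (q / n.+2%:R ^+ 2)%:E * ind s t x <= Pe q (ind a b) x.
Proof.
move=> a0 b1 H x Dx; rewrite /ind; case: ifPn => [/andP[sx xt]|_]; last first.
  by rewrite mule0; apply: Pe_ge0 => // y _; exact: ind_ge0.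
apply: le_trans (Pe_ge_term q0 n x _); last by move=> y _; exact: ind_ge0.
have /andP[h1 h2] := H x Dx sx xt.
rewrite patchE mem_set; last first.
  by rewrite /= in_itv/= (le_lt_trans a0 h1) (lt_le_trans h2 b1).
rewrite h1 h2/= !mule1 lee_fin.
move: Dx; rewrite /= in_itv/= => /andP[x0 x1].
have p1 : (0 < n.+1%:R + x)%R by apply: addS_gt0; exact: ltW.
rewrite /wt ler_pM2l// lef_pV2 ?posrE ?exprn_gt0//.
rewrite ler_sqr ?nnegrE ?(ltW p1)//.
by rewrite -[leRHS]natr1 lerD2l ltW.
Qed.

Definition covers (a b : R) := exists M (c : R), (0 < c)%R /\
  forall x, D x -> c%:E <= iter M (Pe q) (ind a b) x.

Lemma covers_step (a b s t k : R) : (0 < k)%R ->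
  (forall x, D x -> k%:E * ind s t x <= Pe q (ind a b) x) ->
  covers s t -> covers a b.
Proof.
move=> k0 H [M [c [c0 Hc]]]; exists M.+1, (k * c)%R; split; first by rewrite mulr_gt0.
move=> x Dx; rewrite iterSr.
have k0' := ltW k0.
apply: le_trans (_ : iter M (Pe q) (fun y => k%:E * ind s t y) x <= _).
  rewrite Pe_iter_scale//; last by move=> y _; exact: ind_ge0.
  by rewrite EFinM lee_wpmul2l ?lee_fin// Hc.
by apply: le_Pe_iter => // y Dy; rewrite mule_ge0 ?lee_fin ?ind_ge0//; case: ifP.
Qed.

Lemma covers01 : covers 0 1.
Proof.
exists 0%N, 1%R; split=> // x; rewrite /= in_itv/= => /andP[x0 x1].
by rewrite /ind x0 x1.
Qed.

Let k_gt0 n : (0 < q / n.+2%:R ^+ 2)%R.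
Proof. by rewrite divr_gt0// exprn_gt0. Qed.

Lemma covers0 (d : R) : (0 < d)%R -> (d <= 1)%R -> covers 0 d.
Proof.
move=> d0 d1.
have [n nd] : exists n : nat, (q / n.+1%:R <= d)%R.
  exists (Num.bound (q / d)); rewrite ler_pdivrMr ?ltr0Sn// mulrC -ler_pdivrMr//.
  apply: le_trans (ltW (archi_boundP _)) _; first by rewrite divr_ge0 ?ltW.
  by rewrite ler_nat.
apply: covers_step (k_gt0 n) _ covers01; apply: Pe_ind => // x Dx _ _.
have := invbr_cell q0 n Dx; rewrite /cell/= in_itv/= => /andP[h1 h2].
by rewrite (lt_le_trans h2 nd) andbT; apply: lt_trans h1; rewrite divr_gt0.
Qed.

(** Just to the left of a point q/n lies the image under one branch of an interval
]0,d[, and ]0,d[ contains a whole cell. *)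
Lemma covers_cut n (a b : R) : (0 <= a)%R -> (a < q / n.+1%:R)%R ->
  (q / n.+1%:R <= b)%R -> (b <= 1)%R -> covers a b.
Proof.
move=> a0 an nb b1.
pose a' := (Num.max a (q / n.+2%:R))%R.
have a'0 : (0 < a')%R by rewrite lt_max divr_gt0 ?orbT.
have a'n : (a' < q / n.+1%:R)%R.
  by rewrite gt_max an/= ltr_pM2l// ltf_pV2 ?posrE// ltr_nat.
pose d := (q / a' - n.+1%:R)%R.
have d0 : (0 < d)%R by rewrite subr_gt0 ltr_pdivlMr// mulrC -ltr_pdivlMr.
have d1 : (d <= 1)%R.
  rewrite lerBlDr addrC natr1 ler_pdivrMr// mulrC -ler_pdivrMr//.
  by rewrite le_max lexx orbT.
apply: covers_step (k_gt0 n) _ (covers0 d0 d1); apply: Pe_ind => // x Dx x0 xd.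
have := invbr_cell q0 n Dx; rewrite /cell/= in_itv/= => /andP[_ h2].
rewrite (lt_le_trans h2 nb) andbT.
apply: (@le_lt_trans _ _ a'); first by rewrite le_max lexx.
have p := addS_gt0 n (ltW x0).
by rewrite /invbr ltr_pdivlMr// mulrC -ltr_pdivlMr// -ltrBrDl.
Qed.

(** If ]a,b[ contains no point q/n, it lies in one cell; the map expands it by
q/(ab) >= q.  So after finitely many steps the first case occurs. *)
Lemma covers_long j : forall (a b : R), (0 <= a)%R -> (a < b)%R -> (b <= 1)%R ->
  (q^-1 ^+ j <= b - a)%R -> covers a b.
Proof.
elim: j => [|j IH] a b a0 ab b1 len.
  rewrite expr0 in len.
  have -> : a = 0%R by apply/eqP; rewrite eq_le a0 andbT; lra.
  have -> : b = 1%R by apply/eqP; rewrite eq_le b1/=; lra.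
  exact: covers01.
have b0 : (0 < b)%R by exact: le_lt_trans ab.
have qb : (1 < q / b)%R by rewrite ltr_pdivlMr// mul1r (le_lt_trans b1).
have := truncn_itv (ltW (lt_trans ltr01 qb)).
set m := Num.truncn _ => /andP[h1 h2].
have m0 : (0 < m)%N by rewrite -ltnS -(ltr_nat R); exact: lt_trans qb h2.
have qmb : (q / m.+1%:R < b)%R.
  by rewrite ltr_pdivrMr// mulrC -ltr_pdivrMr.
have [am|ma] := ltP a (q / m.+1%:R)%R; first exact: covers_cut am (ltW qmb) b1.
have a0' : (0 < a)%R by apply: lt_le_trans ma; rewrite divr_gt0.
pose s := (q / b - m%:R)%R; pose t := (q / a - m%:R)%R.
have s0 : (0 <= s)%R by rewrite subr_ge0.
have st : (s < t)%R by rewrite ltrD2r ltr_pM2l// ltf_pV2.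
have t1 : (t <= 1)%R.
  by rewrite lerBlDr addrC natr1 ler_pdivrMr// mulrC -ler_pdivrMr.
have len' : (q^-1 ^+ j <= t - s)%R.
  have -> : (t - s = q * (b - a) / (a * b))%R.
    by rewrite /t /s; field; rewrite !gt_eqF.
  have ab1 : (a * b <= 1)%R.
    by apply: mulr_ile1 => //; [exact: ltW|exact: le_trans (ltW ab) b1].
  rewrite ler_pdivlMr ?mulr_gt0//.
  apply: (@le_trans _ _ (q^-1 ^+ j)%R); first by rewrite ler_piMr// exprn_ge0// invr_ge0 ltW.
  by rewrite -ler_pdivrMl// mulrC -exprSr.
apply: covers_step (k_gt0 m.-1) _ (IH _ _ s0 st t1 len'); apply: Pe_ind => // x Dx sx xt.
rewrite /invbr prednK//.
move: Dx; rewrite /= in_itv/= => /andP[x0 _].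
have p : (0 < m%:R + x)%R by rewrite ltr_wpDl.
rewrite ltr_pdivlMr// mulrC -ltr_pdivlMr// -ltrBrDl xt/=.
by rewrite ltr_pdivrMr// mulrC -ltr_pdivrMr// -ltrBlDl.
Qed.

Lemma covers_itv (a b : R) : (0 <= a)%R -> (a < b)%R -> (b <= 1)%R -> covers a b.
Proof.
move=> a0 ab b1.
have : (fun j => q^-1 ^+ j)%R @ \oo --> (0 : R)%R.
  apply: cvg_expr; rewrite ger0_norm ?invr_ge0 ?ltW//.
  by rewrite invf_lt1.
move/cvgrPdist_lt => /(_ (b - a)%R); rewrite subr_gt0 => /(_ ab)[j _ Hj].
apply: (covers_long a0 ab b1 (j := j)).
have := Hj j (leqnn _); rewrite /= sub0r normrN ger0_norm; last first.
  by rewrite exprn_ge0// invr_ge0 ltW.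
exact: ltW.
Qed.

Lemma Pe1_ge : exists2 k : R, (0 < k)%R & forall x, D x -> k%:E <= Pe q (fun=> 1) x.
Proof.
pose n := Num.bound q.
have qn : (q <= n.+1%:R)%R.
  apply: le_trans (ltW (archi_boundP (ltW q0))) _; by rewrite ler_nat.
exists (q / n.+2%:R ^+ 2)%R => // x Dx.
have := @Pe_ind n 0%R 1%R 0%R 1%R (lexx _) (lexx _) _ x Dx.
rewrite {1}/ind; move: (Dx); rewrite /= in_itv/= => -> ; rewrite mule1 => H.
apply: le_trans (H _) _.
  move=> y Dy _ _; have h := invbr_cell q0 n Dy.
  by have := cell_sub_D q1 qn h; rewrite /= in_itv/=.
apply: le_Pe => // y _; first exact: ind_ge0.
by rewrite lee_fin; case: ifP.
Qed.

(** The image of the constant 1 is bounded below by the weight of one branch whose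
whole cell lies in (0,1). *)
Lemma Pe_iter_extend r : exists2 k : R, (0 < k)%R &
  forall (u : R -> \bar R) (c : R), (0 <= c)%R -> (forall x, D x -> 0 <= u x) ->
    (forall x, D x -> c%:E <= u x) ->
    forall x, D x -> (k * c)%:E <= iter r (Pe q) u x.
Proof.
have [k k0 Hk] := Pe1_ge.
elim: r => [|r [k' k'0 IH]].
  by exists 1%R => // u c _ _ H x Dx; rewrite mul1r; exact: H.
exists (k * k')%R; first by rewrite mulr_gt0.
move=> u c c0 u0 uc x Dx; rewrite iterS.
have kc : (0 <= k' * c)%R by rewrite mulr_ge0// ltW.
apply: le_trans (_ : Pe q (fun y => (k' * c)%:E * 1) x <= _).
  rewrite Pe_scale// -mulrA EFinM muleC lee_wpmul2l ?lee_fin//; exact: Hk.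
apply: le_Pe => // y Dy; first by rewrite mule1 lee_fin.
by rewrite mule1; exact: IH.
Qed.

End Covering.

(** * Uniform lower bounds *)

Section LowerBound.
Context {R : realType}.
Local Notation mu := (@lebesgue_measure R).
Local Notation D := (`]0, 1[%classic : set R).
Variables (q : R) (q1 : 1 < q).

Let q0 : 0 < q. Proof. exact: lt_trans ltr01 q1. Qed.

(** A lower bound survives further iterations, so that the numbers of iterations
needed for finitely many intervals can be added up. *)
Lemma uniform_cover (a b : nat -> R) k :
  (forall i, (i < k)%N -> [/\ 0 <= a i, a i < b i & b i <= 1]) ->
  exists M (c : R), 0 < c /\ forall i, (i < k)%N -> forall x, D x ->
    (c%:E <= iter M (Pe q) (ind (a i) (b i)) x)%E.
Proof.
elim: k => [|k IH] H; first by exists 0%N, 1.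
have [|M [c [c0 Hc]]] := IH; first by move=> i ik; apply: H; exact: ltnW.
have [a0 ab b1] := H k (ltnSn k).
have [M' [c' [c'0 Hc']]] := covers_itv q1 a0 ab b1.
have [r r0 Hr] := Pe_iter_extend q1 M'.
have [r' r'0 Hr'] := Pe_iter_extend q1 M.
exists (M' + M)%N, (Num.min (r * c) (r' * c')); split.
  by rewrite lt_min !mulr_gt0.
move=> i; rewrite ltnS leq_eqVlt => /predU1P[->|ik] x Dx.
  rewrite addnC iterD; apply: le_trans (_ : ((r' * c')%:E <= _)%E).
    by rewrite lee_fin ge_min lexx orbT.
  apply: Hr' => //; first exact: ltW.
  by apply: (Pe_iter_ge0 q1) => y _; exact: ind_ge0.
rewrite iterD; apply: le_trans (_ : ((r * c)%:E <= _)%E).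
  by rewrite lee_fin ge_min lexx.
apply: Hr => //; [exact: ltW| |exact: Hc].
by apply: (Pe_iter_ge0 q1) => y _; exact: ind_ge0.
Qed.

(** Otherwise u would be below 1/4 somewhere in each of the k intervals, hence
below 1/4 plus the oscillation on all of it; the oscillations add up to at most K,
so that the integral would be at most 1/4 + K/k < 1/2. *)
Lemma large_cell (K : R) (k : nat) (u v : R -> R) : (0 < k)%N -> 4 * K < k%:R ->
  (forall x y, 0 < x -> x <= y -> y <= 1 -> `|u y - u x| <= v y - v x) ->
  (forall x, 0 < x -> x <= 1 -> 0 <= v x /\ v x <= K) ->
  mu.-integrable `]0, 1] (EFin \o u) -> 2^-1 <= \int[mu]_(x in `]0, 1]) u x ->
  exists2 i, (i < k)%N & forall x, i%:R / k%:R < x -> x <= i.+1%:R / k%:R -> 4^-1 <= u x.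
Proof.
move=> k0 Kk du bv iu intu; apply: contrapT => /forallPNP H.
have k0' : (0 : R) < k%:R by rewrite ltr0n.
pose p i : R := i%:R / k%:R.
have p0 : p 0%N = 0 by rewrite /p mul0r.
have pk : p k = 1 by rewrite /p divff// gt_eqF.
have pS i : p i < p i.+1 by rewrite /p ltr_pM2r ?invr_gt0// ltr_nat.
have pge0 i : 0 <= p i by rewrite divr_ge0.
have pgt0 i : 0 < p i.+1 by rewrite divr_gt0.
have ple1 i : (i <= k)%N -> p i <= 1 by move=> ik; rewrite ler_pdivrMr// mul1r ler_nat.
(* The majorant v is not controlled at 0, where its lower bound 0 replaces it. *)
pose V i := if i is 0%N then 0 else v (p i).
pose F y := \int[mu]_(z in `]0, y]) u z.
have vm x y : 0 < x -> x <= y -> y <= 1 -> v x <= v y.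
  by move=> x0 xy y1; rewrite -subr_ge0; exact: le_trans (normr_ge0 _) (du _ _ x0 xy y1).
have osc i x y : (i < k)%N -> p i < x -> x <= p i.+1 -> p i < y -> y <= p i.+1 ->
    u y <= u x + (V i.+1 - V i).
  move=> ik; have i1 := ple1 _ ik.
  have vV z : p i < z -> z <= p i.+1 -> V i <= v z /\ v z <= V i.+1.
    move=> iz zi; have z0 : 0 < z by exact: le_lt_trans iz.
    split; last exact: vm.
    case: i {ik} i1 iz zi => [|i] i1 iz zi; rewrite /V.
      by have [] := bv z z0 (le_trans zi i1).
    by apply: vm => //; [exact: ltW|exact: le_trans zi i1].
  move=> h1 h2 h3 h4; have [a1 a2] := vV x h1 h2; have [b1 b2] := vV y h3 h4.
  have x0 : 0 < x by exact: le_lt_trans h1.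
  have y0 : 0 < y by exact: le_lt_trans h3.
  have [xy|/ltW yx] := leP x y.
    have := du x y x0 xy (le_trans h4 i1); rewrite ler_norml => /andP[_]; lra.
  have := du y x y0 yx (le_trans h2 i1); rewrite ler_norml => /andP[]; lra.
have step i : (i < k)%N -> F (p i.+1) - F (p i) <= k%:R^-1 * (4^-1 + (V i.+1 - V i)).
  move=> ik; have i1 := ple1 _ ik.
  have /existsNP[xi /not_implyP[h1 /not_implyP[h2 /negP]]] := H i ik.
  rewrite -ltNge => h3.
  have mi : measurable (`]p i, p i.+1]%classic : set (measurableTypeR R)) by exact: measurable_itv.
  have sub1 : `]p i, p i.+1] `<=` `]0, 1]%classic.
    move=> z; rewrite /= !in_itv/= => /andP[z1 z2].
    by rewrite (le_lt_trans (pge0 i) z1) (le_trans z2 i1).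
  have ii : mu.-integrable `]p i, p i.+1] (EFin \o u).
    have m01 : measurable (`]0, 1]%classic : set (measurableTypeR R)) by exact: measurable_itv.
    exact: (integrableS m01 mi sub1 iu).
  have ic (c : R) : mu.-integrable `]p i, p i.+1] (EFin \o (fun=> c)).
    apply/integrableP; split; first exact: measurable_cst.
    rewrite integral_cst//= lebesgue_measure_itv/= lte_fin; case: ifP => _.
      by rewrite -EFinB -EFinM ltry.
    by rewrite mule0 ltry.
  have -> : F (p i.+1) - F (p i) = \int[mu]_(z in `]p i, p i.+1]) u z.
    rewrite /F Rintegral_itvB// ?bnd_simp ?(ltW (pS i))//.
    have m01 : measurable (`]0, 1]%classic : set (measurableTypeR R)) by exact: measurable_itv.
    have m0p : measurable (`]0, p i.+1]%classic : set (measurableTypeR R)) by exact: measurable_itv.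
    apply: (integrableS m01 m0p _ iu) => z; rewrite /= !in_itv/= => /andP[-> z2].
    exact: le_trans z2 i1.
  have -> : k%:R^-1 * (4^-1 + (V i.+1 - V i)) =
      \int[mu]_(z in `]p i, p i.+1]) (4^-1 + (V i.+1 - V i)).
    have muE : fine (mu `]p i, p i.+1]) = k%:R^-1.
      rewrite lebesgue_measure_itv/= lte_fin pS/=.
      by rewrite /p -mulrBl -natr1 addrAC subrr add0r mul1r.
    by rewrite Rintegral_cst// muE mulrC.
  apply: le_Rintegral => // z; rewrite /= in_itv/= => /andP[z1 z2].
  apply: le_trans (osc i xi z ik h1 h2 z1 z2) _.
  by rewrite lerD2r ltW.
have tele n : (n <= k)%N -> F (p n) - F (p 0%N) <= k%:R^-1 * (n%:R * 4^-1 + V n).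
  elim: n => [_|n IH nk]; first by rewrite subrr mul0r add0r mulr0.
  have := lerD (step n nk) (IH (ltnW nk)); rewrite addrA subrK => h.
  apply: le_trans h _; rewrite -mulrDr ler_pM2l ?invr_gt0//.
  by rewrite -natr1; lra.
have := tele k (leqnn _); rewrite p0 pk {2}/F set_itvoc0 Rintegral_set0 subr0.
rewrite mulrDr mulrA mulVf ?gt_eqF// mul1r -/(F 1) => h.
have VK : V k <= K.
  by case: (k) k0 pk => // n _ pk; rewrite /V pk; have [] := bv 1 ltr01 (lexx _).
have h2 : k%:R^-1 * V k <= k%:R^-1 * K by rewrite ler_pM2l ?invr_gt0.
have h3 : k%:R^-1 * K < 4^-1.
  by rewrite mulrC ltr_pdivrMr// mulrC -ltr_pdivrMr ?invr_gt0// invrK mulrC.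
have : F 1 < 2^-1 by lra.
by rewrite ltNge intu.
Qed.

(** Among finitely many intervals of a partition that depends only on K, one has
u >= 1/4 on it, and each of them is spread over (0,1) by the same iterate. *)
Lemma lower_bound (K : R) : exists M (c0 : R), 0 < c0 /\
  forall u v : R -> R, (forall x, 0 <= u x) ->
  (forall x y, 0 < x -> x <= y -> y <= 1 -> `|u y - u x| <= v y - v x) ->
  (forall x, 0 < x -> x <= 1 -> 0 <= v x /\ v x <= K) ->
  mu.-integrable `]0, 1] (EFin \o u) -> 2^-1 <= \int[mu]_(x in `]0, 1]) u x ->
  forall x, D x -> (c0%:E <= iter M (Pe q) (EFin \o u) x)%E.
Proof.
pose k := (Num.bound (4 * `|K|)).+1.
have k0 : (0 < k)%N by [].
have Kk : 4 * K < k%:R.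
  apply: (@le_lt_trans _ _ (4 * `|K|)); first by rewrite ler_pM2l// ler_norm.
  apply: lt_le_trans (archi_boundP _) _; first by rewrite mulr_ge0.
  by rewrite ler_nat.
have k0' : (0 : R) < k%:R by rewrite ltr0n.
have [|M [c [c0 Hc]]] := @uniform_cover (fun i => i%:R / k%:R) (fun i => i.+1%:R / k%:R) k.
  move=> i ik; split; first by rewrite divr_ge0.
    by rewrite ltr_pM2r ?invr_gt0// ltr_nat.
  by rewrite ler_pdivrMr// mul1r ler_nat.
exists M, (4^-1 * c); split; first by rewrite mulr_gt0 ?invr_gt0.
move=> u v u0 du bv iu intu x Dx.
have [i ik Hi] := large_cell k0 Kk du bv iu intu.
have c4 : (0 : R) <= 4^-1 by rewrite invr_ge0.
apply: le_trans (_ : (iter M (Pe q) (fun y => (4^-1)%:E * ind (i%:R / k%:R) (i.+1%:R / k%:R) y) x <= _)%E).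
  rewrite (Pe_iter_scale q1)//; last by move=> y _; exact: ind_ge0.
  by rewrite EFinM lee_wpmul2l ?lee_fin// Hc.
apply: (le_Pe_iter q1) => // y Dy; first by rewrite mule_ge0 ?ind_ge0.
rewrite /ind; case: ifPn => [/andP[h1 h2]|_]; last by rewrite mule0 lee_fin.
by rewrite mule1 lee_fin; apply: Hi => //; exact: ltW.
Qed.

End LowerBound.

(** * Loss of mass by interference of phases *)

Section Loss.
Context {R : realType}.
Local Notation C := R[i].
Local Notation mu := (@lebesgue_measure R).
Local Notation D := (`]0, 1[%classic : set R).
Variables (q : R) (q1 : 1 < q).

Let q0 : 0 < q. Proof. exact: lt_trans ltr01 q1. Qed.

Definition rind (a b y : R) : R := if (a < y) && (y < b) then 1 else 0.

Lemma measurable_rind a b : measurable_fun D (rind a b).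
Proof.
have -> : rind a b = \1_(`]a, b[%classic : set R).
  apply/funext => y; rewrite /rind indicE; case: ifPn => h.
    by rewrite mem_set//= in_itv/=.
  by rewrite memNset//= in_itv/=; exact/negP.
by apply: measurable_indic; exact: measurable_itv.
Qed.

Lemma rind_ge0 a b y : 0 <= rind a b y.
Proof. by rewrite /rind; case: ifP. Qed.

Lemma rind_le1 a b y : rind a b y <= 1.
Proof. by rewrite /rind; case: ifP. Qed.

Definition cind (a b y : R) : C := (rind a b y)%:C.

Lemma cind_int a b : cind a b \in cintegrable.
Proof.
apply: (@cintegrable_bounded _ _ 1).
- exact: measurable_rind.
- exact: measurable_cst.
- by move=> x _; rewrite normcR ger0_norm ?rind_ge0// rind_le1.
Qed.

Lemma integrable_rind a b : mu.-integrable D (EFin \o rind a b).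
Proof. by have /cintegrableP[] := cind_int a b. Qed.

Lemma int_rind a b : 0 <= a -> a <= b -> b <= 1 -> \int[mu]_(x in D) rind a b x = b - a.
Proof.
move=> a0 ab b1.
transitivity (fine (mu `]a, b[)).
  rewrite /Rintegral; congr fine.
  transitivity (\int[mu]_(x in D) (\1_(`]a, b[%classic : set R) x)%:E)%E.
    apply: eq_integral => y _; congr EFin; rewrite /rind indicE; case: ifPn => h.
      by rewrite mem_set//= in_itv/=.
    by rewrite memNset//= in_itv/=; exact/negP.
  rewrite integral_indic//=.
  congr (mu _); apply/seteqP; split=> y; first by case.
  move=> h; split=> //; move: h; rewrite /= !in_itv/= => /andP[h1 h2].
  by rewrite (le_lt_trans a0 h1) (lt_le_trans h2 b1).
rewrite lebesgue_measure_itv/= lte_fin; case: ltP => // ba.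
by rewrite (_ : a = b) ?subrr//; apply/eqP; rewrite eq_le ab.
Qed.

Lemma normc_1D_lt2 (w : C) : normc w = 1 -> w != 1 -> normc (1 + w) < 2.
Proof.
case: w => a b w1 wn1.
have ab : a ^+ 2 + b ^+ 2 = 1.
  move: w1; rewrite /normc => /(congr1 (fun x => x ^+ 2)).
  by rewrite sqr_sqrtr ?addr_ge0 ?sqr_ge0// expr1n.
have a1 : a < 1.
  rewrite ltNge; apply/negP => a1; move/eqP: wn1; apply.
  have b0 : b ^+ 2 = 0.
    apply/eqP; rewrite eq_le sqr_ge0 andbT.
    have : 1 <= a ^+ 2 by rewrite expr_ge1// (le_trans ler01).
    by lra.
  have aa : a ^+ 2 = 1 by rewrite -ab b0 addr0.
  have bb : b = 0 by apply/eqP; rewrite -sqrf_eq0 b0.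
  have a2 : a = 1.
    apply/eqP; rewrite -(@eqrXn2 _ 2)// ?aa ?expr1n//.
    exact: le_trans ler01 a1.
  by rewrite a2 bb.
have -> : (2 : R) = Num.sqrt (2 ^+ 2) by rewrite sqrtr_sqr ger0_norm.
rewrite /normc/= ltr_sqrt ?exprn_gt0//.
have -> : (1 + a) ^+ 2 + (0 + b) ^+ 2 = 1 + 2 * a + (a ^+ 2 + b ^+ 2) by ring.
by rewrite ab; lra.
Qed.

(** On the union of the cells n and n+1 the two branches contribute with
consecutive powers of w. *)
Lemma transfer_cind (w : C) n x : D x -> q <= n.+1%:R ->
  transfer_series w q (cind (q / n.+3%:R) (q / n.+1%:R)) x =
  w ^+ n.+1 * ((wt q n x)%:C + w * (wt q n.+1 x)%:C).
Proof.
move=> Dx qn; rewrite transfer_seriesE; apply: (@cvg_lim C^o hausdorffC).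
have tE k : tterm q w (cind (q / n.+3%:R) (q / n.+1%:R)) x k =
    if k == n then w ^+ n.+1 * (wt q n x)%:C else
    if k == n.+1 then w ^+ n.+2 * (wt q n.+1 x)%:C else 0.
  have := invbr_cell q0 k Dx; rewrite /cell/= in_itv/= => /andP[h1 h2].
  rewrite /tterm /cind /rind /patch.
  have le_q (i j : nat) : (i <= j)%N -> q / j.+1%:R <= q / i.+1%:R.
    by move=> ij; rewrite ler_pM2l// lef_pV2 ?posrE ?ltr0Sn// ler_nat.
  have inD j : (n <= j)%N -> k = j -> invbr q k x \in D.
    move=> nj kj; rewrite inE/= in_itv/=; apply/andP; split.
      by apply: lt_trans h1; rewrite divr_gt0.
    apply: lt_le_trans h2 _; rewrite ler_pdivrMr// mul1r; apply: le_trans qn _.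
    by rewrite ler_nat kj.
  case: eqP => [kn|kn].
    rewrite (inD n)// -kn h2 (le_lt_trans _ h1)/= ?mulr1//.
    by apply: le_q; rewrite kn.
  case: eqP => [kn1|kn1].
    rewrite (inD n.+1)//; move: h1; rewrite kn1 => -> /=.
    move: h2; rewrite kn1 => h2; rewrite (lt_le_trans h2)/= ?mulr1//.
    exact: le_q.
  case: ifP => _; last by rewrite mulr0.
  rewrite ifF ?mulr0//; apply/negP => /andP[h3 h4].
  have /orP[kn2|nk2] : (k < n)%N || (n.+1 < k)%N.
    by move/eqP: kn; move/eqP: kn1; lia.
    by move: h4; rewrite ltNge (le_trans _ (ltW h1))//; exact: (le_q k.+1 n).
  by move: h3; rewrite ltNge (le_trans (ltW h2))//; exact: (le_q n.+2 k).
apply: (cvg_near_cst (_ : C^o)); exists n.+2 => // m /= nm.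
have tE2 k : tterm q w (cind (q / n.+3%:R) (q / n.+1%:R)) x k =
    (if k == n then w ^+ n.+1 * (wt q n x)%:C else 0) +
    (if k == n.+1 then w ^+ n.+2 * (wt q n.+1 x)%:C else 0).
  rewrite tE; case: eqP => [->|_]; last by rewrite add0r.
  by rewrite ltn_eqF// addr0.
rewrite /series/=; under eq_bigr do rewrite tE2.
rewrite big_split/= -!big_mkcond/= !big_nat1_eq/= nm (ltnW nm).
by rewrite mulrDr mulrA -exprSr.
Qed.

Lemma integrable_wt n : mu.-integrable D (EFin \o wt q n).
Proof.
apply/integrableP; split; first by apply/measurable_EFinP; exact: measurable_wt.
under eq_integral do rewrite /= ger0_norm ?wt_ge0//.
by rewrite integral_wt// ltry.
Qed.

Lemma int_wt n : \int[mu]_(x in D) wt q n x = q / n.+1%:R - q / n.+2%:R.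
Proof. by rewrite /Rintegral integral_wt//= natr1. Qed.

(** The smaller of the two weights interferes with an equal part of the larger
one, and |1 + w| < 2. *)
Lemma N1_transfer_cind (w : C) n : normc w = 1 -> q <= n.+1%:R ->
  N1 (transfer_series w q (cind (q / n.+3%:R) (q / n.+1%:R))) <=
  (q / n.+1%:R - q / n.+3%:R) - (2 - normc (1 + w)) * (q / n.+2%:R - q / n.+3%:R).
Proof.
move=> w1 qn; set r := normc (1 + w).
have iw := integrable_wt n; have iw' := integrable_wt n.+1.
have mD := @measurable_D R.
have i2 : mu.-integrable D (fun x => ((r - 1) * wt q n.+1 x)%:E).
  by have := integrableZl mD (r - 1) iw'; apply: eq_integrable.
apply: (@le_trans _ _ (\int[mu]_(x in D) (wt q n x + (r - 1) * wt q n.+1 x))).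
  apply: le_Rintegral => //.
  - by apply: integrable_normc; apply: transfer_series_int => //; exact: cind_int.
  - exact: (integrableD mD iw i2).
  - move=> x Dx; rewrite transfer_cind// normcM normcX w1 expr1n mul1r.
    have x0 : 0 < x by move: Dx; rewrite /= in_itv/= => /andP[].
    have h1 : wt q n.+1 x <= wt q n x.
      have p1 : 0 < n.+1%:R + x by apply: addS_gt0; exact: ltW.
      have p2 : 0 < n.+2%:R + x by apply: addS_gt0; exact: ltW.
      rewrite /wt ler_pM2l// lef_pV2 ?posrE ?exprn_gt0//.
      by rewrite ler_sqr ?nnegrE ?(ltW p1) ?(ltW p2)// lerD2r ler_nat.
    have h2 : 0 <= wt q n.+1 x by exact: wt_ge0.
    have -> : (wt q n x)%:C + w * (wt q n.+1 x)%:C =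
      (wt q n x - wt q n.+1 x)%:C + (1 + w) * (wt q n.+1 x)%:C.
      by rewrite rmorphB; ring.
    apply: le_trans (le_normcD _ _) _; rewrite normcM !normcR -/r.
    by rewrite ger0_norm ?subr_ge0// (ger0_norm h2); lra.
have e1 := RintegralD mD iw i2; have e2 := RintegralZl (r - 1) mD iw'.
have e3 := int_wt n; have e4 := int_wt n.+1.
have -> : \int[mu]_(x in D) (wt q n x + (r - 1) * wt q n.+1 x) =
    (q / n.+1%:R - q / n.+2%:R) + (r - 1) * (q / n.+2%:R - q / n.+3%:R).
  by rewrite -e3 -e4 -e2; exact: e1.
by rewrite le_eqVlt; apply/orP; left; apply/eqP; ring.
Qed.

(** Consider k disjoint pairs of consecutive cells.  The variation of g is
at most K, so that on one pair g stays within eps of a constant z.  If |z| < c0/2,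
then g is below its majorant U by a fixed amount on that pair, and the mass of g
is already less than 1.  If |z| >= c0/2, the two branches interfere by
[N1_transfer_cind]. *)
Lemma loss (w : C) (K c0 : R) : normc w = 1 -> w != 1 -> 0 < c0 ->
  exists2 d : R, 0 < d & forall (g : R -> C) (U : R -> \bar R),
    good g K -> measurable_fun D U -> (forall x, D x -> (0 <= U x)%E) ->
    (forall x, D x -> (nf g x <= U x)%E) -> (forall x, D x -> (c0%:E <= U x)%E) ->
    (\int[mu]_(x in D) U x <= 1)%E ->
    N1 (transfer_series w q g) <= 1 - d.
Proof.
move=> w1 wn1 c00; pose tau := 2 - normc (1 + w).
have tau0 : 0 < tau by rewrite subr_gt0 normc_1D_lt2.
have tau2 : tau <= 2 by rewrite lerBlDr lerDl normc_ge0.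
(* Small against the gain c0 * tau / 8 of the interference. *)
pose eps := c0 * tau / 64.
have eps0 : 0 < eps by rewrite divr_gt0// mulr_gt0.
pose n0 := Num.bound q.
have qn0 i : q <= (n0 + i).+1%:R.
  apply: le_trans (ltW (archi_boundP (ltW q0))) _.
  by rewrite ler_nat -/n0 leqW// leq_addr.
pose k := (Num.bound (`|K| / eps)).+1.
have Kk : K < k%:R * eps.
  rewrite -ltr_pdivrMr//; apply: (@le_lt_trans _ _ (`|K| / eps)).
    by rewrite ler_pM2r ?invr_gt0// ler_norm.
  apply: lt_le_trans (archi_boundP _) _; first by rewrite divr_ge0// ltW.
  by rewrite ler_nat.
(* Even steps make the pairs of cells disjoint; from n0 on they lie in (0,1). *)
pose m i := (n0 + i.*2)%N.
pose al i : R := q / (m i).+3%:R; pose be i : R := q / (m i).+1%:R.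
pose lmin : R := 2 * q / ((m k).+1%:R * (m k).+3%:R).
have lmin0 : 0 < lmin by rewrite divr_gt0 ?mulr_gt0.
have lenE i : be i - al i = 2 * q / ((m i).+1%:R * (m i).+3%:R).
  rewrite /be /al; field.
  by rewrite ?andbT !lt0r_neq0// ltr_wpDr.
have len_ge i : (i <= k)%N -> lmin <= be i - al i.
  move=> ik; rewrite lenE /lmin ler_pM2l ?mulr_gt0//.
  rewrite lef_pV2 ?posrE ?mulr_gt0// -!natrM ler_nat.
  by apply: leq_mul; rewrite !ltnS /m leq_add2l leq_double.
have al0 i : 0 < al i by rewrite divr_gt0.
have be1 i : be i <= 1 by rewrite ler_pdivrMr// mul1r qn0.
have albe i : al i < be i by rewrite ltr_pM2l// ltf_pV2 ?posrE// ltr_nat.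
pose d := lmin * (c0 * tau / 16).
have d0 : 0 < d by rewrite mulr_gt0// divr_gt0// mulr_gt0.
exists d => // g U gg mU U0 gU cU intU.
have hg := good_int gg; have [_ _ [v [dv bv]]] := gg.
have mD := @measurable_D R.
have N1g1 : N1 g <= 1.
  rewrite -lee_fin N1E//; apply: le_trans intU; apply: ge0_le_integral => //.
  - by move=> x _; exact: nf_ge0.
  - exact: measurable_nf.
(* The increments of v over the k pairs add up to at most K < k * eps. *)
have vm x y : 0 < x -> x <= y -> y <= 1 -> v x <= v y.
  by move=> x0 xy y1; have := dv _ _ x0 xy y1; have := normc_ge0 (cut g y - cut g x); lra.
have [i ik osc] : exists2 i, (i < k)%N & v (be i) - v (al i) <= eps.
  apply: contrapT => /forallPNP H.
  have ab i : be i.+1 <= al i.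
    rewrite /be /al ler_pM2l// lef_pV2 ?posrE// ler_nat.
    by rewrite /m doubleS !addnS.
  have sums n : (n <= k)%N -> n%:R * eps <= v 1 - (if n is n'.+1 then v (al n') else v 1).
    elim: n => [_|n IH nk]; first by rewrite mul0r subrr.
    have h1 := IH (ltnW nk); have /negP := H n nk; rewrite -ltNge => h2.
    rewrite -natr1 mulrDl mul1r.
    case: n {IH} nk h1 h2 => [|n] nk h1 h2.
      rewrite mul0r add0r; apply: le_trans (ltW h2) _; rewrite lerD2r.
      exact: vm (lt_trans (al0 0%N) (albe 0%N)) (be1 _) (lexx _).
    have h3 : v (be n.+1) <= v (al n).
      apply: vm (ab n) _; first exact: lt_trans (al0 _) (albe _).
      exact: le_trans (ltW (albe _)) (be1 _).
    by lra.
  have := sums k (leqnn _); rewrite /k => h.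
  have [_ h1] := bv 1 ltr01 (lexx _).
  have [h2 _] := bv (al (Num.bound (`|K| / eps))) (al0 _) (le_trans (ltW (albe _)) (be1 _)).
  by move: Kk; rewrite /k ltNge => /negP; apply; lra.
pose n := m i; set a := al i; set b := be i.
have qn : q <= n.+1%:R by exact: qn0.
pose y0 := q / n.+2%:R.
have ay0 : a < y0 by rewrite ltr_pM2l// ltf_pV2 ?posrE// ltr_nat.
have y0b : y0 < b by rewrite ltr_pM2l// ltf_pV2 ?posrE// ltr_nat.
have subD y : a < y -> y < b -> D y.
  move=> h1 h2; rewrite /= in_itv/= (lt_trans (al0 i) h1)/=.
  exact: lt_le_trans h2 (be1 i).
pose z := g y0.
have gz y : a < y -> y < b -> normc (g y - z) <= eps.
  move=> h1 h2; apply: le_trans osc.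
  rewrite /z -(cutE g (subD _ h1 h2)) -(cutE g (subD _ ay0 y0b)).
  have pos x : a < x -> 0 < x by exact: lt_trans (al0 i).
  have vab x : a < x -> x < b -> v a <= v x /\ v x <= v b.
    move=> h3 h4; split; apply: vm => //; try exact: ltW; try exact: pos; try exact: al0.
      exact: le_trans (ltW h4) (be1 i).
    exact: be1.
  have [v1 v2] := vab _ h1 h2; have [v3 v4] := vab _ ay0 y0b.
  have [yy|/ltW yy] := leP y0 y.
    by have := dv _ _ (pos _ ay0) yy (le_trans (ltW h2) (be1 i)); lra.
  by rewrite normcBC; have := dv _ _ (pos _ h1) yy (le_trans (ltW y0b) (be1 i)); lra.
pose l := b - a.
have ll : lmin <= l by apply: len_ge; exact: ltnW.
have l0 : 0 < l by exact: lt_le_trans ll.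
have ig := integrable_normc hg.
have iIi := integrable_rind a b.
have icI (c : R) : mu.-integrable D (fun x => (c * rind a b x)%:E).
  by have := integrableZl mD c iIi; apply: eq_integrable.
have intI : \int[mu]_(x in D) rind a b x = l.
  by apply: int_rind; [exact: ltW (al0 i)|exact: ltW (albe i)|exact: be1].
have [zsmall|zbig] := ltP (normc z) (c0 / 2).
  (* g is small on the cell pair, hence far below U there *)
  apply: le_trans (N1_transfer_series q1 w1 hg) _.
  have e4 : eps <= c0 / 32.
    rewrite /eps; have : c0 * tau <= c0 * 2 by rewrite ler_pM2l.
    lra.
  have : N1 g + c0 / 4 * l <= 1.
    rewrite -intI -RintegralZl// /N1 -RintegralD//; last exact: (icI _).
    rewrite -lee_fin /Rintegral fineK; last first.
      exact: integrable_fin_num (integrableD mD ig (icI _)).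
    apply: le_trans intU; apply: ge0_le_integral => //.
    - by move=> x _; rewrite lee_fin addr_ge0 ?normc_ge0// mulr_ge0 ?rind_ge0// divr_ge0// ltW.
    - exact: measurable_int (integrableD mD ig (icI (c0 / 4))).
    - move=> x Dx; rewrite /rind; case: ifPn => [/andP[h1 h2]|_]; last first.
        by rewrite mulr0 addr0; exact: gU.
      apply: le_trans (cU x Dx); rewrite lee_fin mulr1.
      have := gz x h1 h2; have := le_normcD (g x - z) z; rewrite subrK.
      by lra.
  have : d <= c0 / 4 * l.
    rewrite /d mulrC; apply: ler_pM => //; [|exact: ltW|].
      by rewrite divr_ge0// mulr_ge0// ltW.
    have : c0 * tau <= c0 * 2 by rewrite ler_pM2l.
    lra.
  lra.
(* g is almost a nonzero constant there, and the two branches interfere *)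
have hI := cind_int a b.
have hzI := cintegrableZ z hI.
have hr : (fun x => g x - z * cind a b x) \in cintegrable by exact: rpredB hg hzI.
have split_norm : N1 (transfer_series w q g) <=
    normc z * N1 (transfer_series w q (cind a b)) + N1 (fun x => g x - z * cind a b x).
  have -> : N1 (transfer_series w q g) = nR (transfer w q (L1class g)).
    by rewrite transfer_class// nR_class//; exact: transfer_series_int.
  have -> : L1class g = z *: L1class (cind a b) + L1class (fun x => g x - z * cind a b x).
    by rewrite -L1classZ// -L1classD//; congr L1class; apply/funext => x; rewrite addrC subrK.
  rewrite transferP//; apply: le_trans (nR_triangle _ _) _; rewrite nRZ.
  apply: lerD; last by apply: le_trans (nR_transfer q1 w1 _) _; rewrite nR_class.
  by rewrite transfer_class// nR_class//; exact: transfer_series_int.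
have rest : N1 (fun x => g x - z * cind a b x) <= N1 g + (2 * eps - normc z) * l.
  rewrite -intI -RintegralZl// /N1 -RintegralD//; last exact: (icI _).
  apply: le_Rintegral => //.
  - exact: integrable_normc hr.
  - exact: (integrableD mD ig (icI _)).
  - move=> x Dx; rewrite /cind /rind; case: ifPn => [/andP[h1 h2]|_]; last first.
      by rewrite mulr0 subr0 mulr0 addr0.
    rewrite !mulr1; have := gz x h1 h2.
    have := le_normcD (z - g x) (g x); rewrite subrK normcBC.
    by lra.
have cancel_I := N1_transfer_cind w1 qn.
rewrite -/tau -[q / n.+3%:R]/a -[q / n.+1%:R]/b -/l in cancel_I.
have quarter : l / 4 <= q / n.+2%:R - a.
  have -> : l = 2 * q / (n.+1%:R * n.+3%:R) by exact: lenE.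
  have -> : q / n.+2%:R - a = q / (n.+2%:R * n.+3%:R).
    rewrite /a /al -/n; field.
    by rewrite ?andbT !lt0r_neq0// ltr_wpDr.
  have n2 : (2 * q / (n.+1%:R * n.+3%:R)) / 4 = q / (2 * n.+1%:R * n.+3%:R).
    by field; rewrite ?andbT !lt0r_neq0// ltr_wpDr.
  rewrite n2 ler_pM2l// lef_pV2 ?posrE ?mulr_gt0// ler_pM2r//.
  rewrite -natrM ler_nat mul2n -addnn !addSn ltnS addnS ltnS; exact: leq_addr.
have z0 : 0 <= normc z by exact: normc_ge0.
have c1 : tau * (l / 4) <= tau * (q / n.+2%:R - a) by rewrite ler_pM2l.
have c2 : normc z * N1 (transfer_series w q (cind a b)) <= normc z * (l - tau * (l / 4)).
  by rewrite ler_wpM2l//; apply: le_trans cancel_I _; rewrite lerD2l lerN2.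
have c3 : N1 (transfer_series w q g) <= 1 + l * (2 * eps - normc z * tau / 4).
  apply: le_trans split_norm _; apply: le_trans (lerD c2 rest) _.
  have -> : normc z * (l - tau * (l / 4)) + (N1 g + (2 * eps - normc z) * l) =
     N1 g + l * (2 * eps - normc z * tau / 4) by field.
  by rewrite lerD2r.
have c4 : c0 / 2 * tau <= normc z * tau by rewrite ler_pM2r.
have c5 : 2 * eps - normc z * tau / 4 <= - (c0 * tau / 16).
  have e5 : c0 / 2 * tau = 32 * eps by rewrite /eps; field.
  have e6 : c0 * tau / 16 = 4 * eps by rewrite /eps; field.
  rewrite e6; move: c4; rewrite e5 => c4.
  by clear -c4 eps0; lra.
have c6 : l * (2 * eps - normc z * tau / 4) <= l * - (c0 * tau / 16) by rewrite ler_pM2l.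
have c7 : d <= l * (c0 * tau / 16) by rewrite /d ler_pM2r// divr_gt0// mulr_gt0.
rewrite mulrN in c6; apply: le_trans c3 _; rewrite lerD2l.
by apply: le_trans c6 _; rewrite lerN2.
Qed.

End Loss.

(** * Words in the transfer operators *)

Section Decay.
Context {R : realType}.
Local Notation C := R[i].
Local Notation mu := (@lebesgue_measure R).
Local Notation D := (`]0, 1[%classic : set R).
Variables (q : R) (q1 : 1 < q).

Let q0 : 0 < q. Proof. exact: lt_trans ltr01 q1. Qed.
Let mD := @measurable_D R.

(** [lower_bound] applied to |f|, whose oscillation is at most that of f. *)
Lemma lower_bound_good (K : R) : exists M (c0 : R), 0 < c0 /\
  forall f : R -> C, good f K -> 2^-1 <= N1 f ->
  forall x, D x -> (c0%:E <= iter M (Pe q) (nf f) x)%E.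
Proof.
have [M [c0 [c00 H]]] := lower_bound q1 K; exists M, c0; split=> // f gf Nf x Dx.
have hf := good_int gf; have [_ _ [v [dv bv]]] := gf.
pose u x := normc (cut f x).
have uE y : D y -> u y = normc (f y) by move=> Dy; rewrite /u cutE.
have resE y : (u \_ (`]0, 1]%classic : set R)) y = ((fun x => normc (f x)) \_ D) y.
  rewrite /restrict /patch; case: ifPn => [|/negP h1].
    rewrite inE/= in_itv/= => /andP[y0 y1]; case: ifPn => [/set_mem /uE //|].
    rewrite notin_setE/= in_itv/= y0/= => /negP; rewrite -leNgt => y1'.
    by rewrite /u cut_ge1// [normc _]normc0.
  rewrite ifF//; apply/negP; rewrite inE/= in_itv/= => /andP[y0 y1].
  by apply: h1; rewrite inE/= in_itv/= y0 ltW.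
have m01 : measurable (`]0, 1]%classic : set (measurableTypeR R)) by exact: measurable_itv.
apply: le_trans (H u v _ _ bv _ _ x Dx) _.
- by move=> y; exact: normc_ge0.
- move=> y z y0 yz z1; apply: le_trans (dv y z y0 yz z1).
  have h1 := le_normcD (cut f z - cut f y) (cut f y).
  have h2 := le_normcD (cut f y - cut f z) (cut f z).
  rewrite !subrK in h1 h2; rewrite [X in _ <= X + _]normcBC in h2.
  by rewrite ler_norml /u; apply/andP; split; lra.
- have := (@integrable_mkcond _ (measurableTypeR R) R mu D (nf f) mD).1 (integrable_normc hf).
  move=> iT; apply/(@integrable_mkcond _ (measurableTypeR R) R mu _ (EFin \o u) m01).
  move: iT; apply: eq_integrable => // y _.
  have := resE y; rewrite /restrict /patch /nf/=.
  by case: ifP => _; case: ifP => _ // h; apply: (congr1 EFin); exact: esym h.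
- rewrite Rintegral_mkcond; apply: le_trans Nf _; rewrite /N1 Rintegral_mkcond.
  rewrite le_eqVlt; apply/orP; left; apply/eqP; apply: eq_Rintegral => y _; exact: esym (resE y).
- apply: (le_Pe_iter q1) => // y Dy; first by rewrite lee_fin normc_ge0.
  by rewrite /= uE.
Qed.

Definition word (ws : seq C) (f : R -> C) : R -> C :=
  foldr (fun w g => transfer_series w q g : R -> C) f ws.

Definition unimodular (ws : seq C) := all (fun w => normc w == 1) ws.

(** The fixed point of the recursion c = kappa c + 4 from the Lasota-Yorke
inequality. *)
Definition bvC : R := 4 / (1 - kappa q).

Lemma bvC_ge0 : 0 <= bvC.
Proof. by rewrite divr_ge0// subr_ge0 ltW// kappa_lt1. Qed.

Lemma word_int ws f : unimodular ws -> f \in cintegrable -> word ws f \in cintegrable.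
Proof.
move=> u hf; elim: ws u => [//|w ws IH] /= /andP[/eqP w1 u].
by apply: transfer_series_int => //; exact: IH.
Qed.

Lemma N1_word ws f : unimodular ws -> f \in cintegrable -> N1 (word ws f) <= N1 f.
Proof.
move=> u hf; elim: ws u => [//|w ws IH] /= /andP[/eqP w1 u].
by apply: le_trans (IH u); apply: N1_transfer_series => //; exact: word_int.
Qed.

(** Along a word the norm does not increase, and the bound a + bvC |f| is
reproduced by each letter. *)
Lemma good_word ws f a : unimodular ws -> good f a ->
  good (word ws f) (a + bvC * N1 f).
Proof.
move=> u gf; have hf := good_int gf; have k1 := kappa_lt1 q1.
have N0 : 0 <= N1 f by rewrite -nR_class// nR_ge0.
have [_ _ /bvle_ge0 a0] := gf.
elim: ws u => [_|w ws IH /andP[/eqP w1 u]] /=.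
  by apply: good_le gf; rewrite lerDl mulr_ge0// bvC_ge0.
apply: good_le (lasota_yorke q1 w1 (IH u)).
have h1 : N1 (word ws f) <= N1 f by exact: N1_word.
have h2 : bvC * N1 f = kappa q * (bvC * N1 f) + 4 * N1 f.
  by rewrite /bvC; field; rewrite gt_eqF// subr_gt0.
have h3 : kappa q * a <= a by rewrite ler_piMl// ltW.
by rewrite mulrDr; lra.
Qed.

Lemma nf_word ws f x : unimodular ws -> D x ->
  (nf (word ws f) x <= iter (size ws) (Pe q) (nf f) x)%E.
Proof.
move=> u; elim: ws u x => [//|w ws IH] /= /andP[/eqP w1 u] x Dx.
apply: le_trans (transfer_series_le q0 _ _ w1) _.
by apply: le_Pe => // y Dy; [exact: nf_ge0|exact: IH].
Qed.

Lemma measurable_Pe_iter M (u : R -> \bar R) : (forall x, D x -> (0 <= u x)%E) ->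
  measurable_fun D u -> measurable_fun D (iter M (Pe q) u).
Proof.
move=> u0 mu'; elim: M => [//|M IH]; rewrite iterS.
by apply: measurable_Pe => // x Dx; apply: Pe_iter_ge0.
Qed.

Lemma integral_Pe_iter M (u : R -> \bar R) : (forall x, D x -> (0 <= u x)%E) ->
  measurable_fun D u ->
  (\int[mu]_(x in D) iter M (Pe q) u x = \int[mu]_(x in D) u x)%E.
Proof.
move=> u0 mu'; elim: M => [//|M IH]; rewrite iterS integral_Pe//.
  by move=> x Dx; exact: Pe_iter_ge0.
exact: measurable_Pe_iter.
Qed.

(** After M letters the positive majorant of |f| is bounded below, and it stays so
for s more letters; then one letter w <> 1 loses mass. *)
Lemma word_loss (w : C) (K : R) : normc w = 1 -> w != 1 ->
  exists M : nat, forall s, exists2 d : R, 0 < d &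
  forall ws f, unimodular ws -> size ws = (s + M)%N -> good f K -> N1 f = 1 ->
    N1 (transfer_series w q (word ws f)) <= 1 - d.
Proof.
move=> w1 wn1; have [M [c0 [c00 H]]] := lower_bound_good K.
exists M => s; have [k k0 Hk] := Pe_iter_extend q1 s.
have [d d0 Hd] := loss q1 (K + bvC) w1 wn1 (mulr_gt0 k0 c00).
exists d => // ws f u sz gf Nf; have hf := good_int gf.
have n0 x : D x -> (0 <= nf f x)%E by move=> _; exact: nf_ge0.
apply: (Hd _ (iter (s + M) (Pe q) (nf f))).
- by have := good_word u gf; rewrite Nf mulr1.
- by apply: measurable_Pe_iter => //; exact: measurable_nf.
- by move=> x Dx; exact: Pe_iter_ge0.
- by move=> x Dx; rewrite -sz; exact: nf_word.
- move=> x Dx; rewrite iterD; apply: Hk => //; first exact: ltW.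
    by move=> y Dy; exact: Pe_iter_ge0.
  by move=> y Dy; apply: H => //; rewrite Nf; lra.
- by rewrite integral_Pe_iter//; [rewrite -N1E// Nf|exact: measurable_nf].
Qed.

(** The real linear functionals on the complex numbers.  The untwisted operator
commutes with all of them, so that real and imaginary parts, and both signs, are
treated together. *)
Definition rlf (s t : R) (z : C) : R := s * complex.Re z + t * complex.Im z.

Lemma rlf0 s t : rlf s t 0 = 0.
Proof. by rewrite /rlf /= !mulr0 addr0. Qed.

Lemma rlfMR s t (r : R) (z : C) : rlf s t (r%:C * z) = r * rlf s t z.
Proof. by rewrite /rlf; case: z => a b /=; ring. Qed.

Lemma rlf_le s t z : `|rlf s t z| <= (`|s| + `|t|) * normc z.
Proof.
apply: le_trans (ler_normD _ _) _; rewrite !normrM mulrDl.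
by apply: lerD; rewrite ler_wpM2l// ?normc_Re ?normc_Im.
Qed.

Lemma rlf_cvg s t (u : nat -> C^o) : cvgn u ->
  (fun n => rlf s t (u n)) @ \oo --> rlf s t (limn u).
Proof.
move=> cu; have /cvgC_ReImP[h1 h2] : u @ \oo --> limn u by [].
by apply: cvgD; apply: cvgMr.
Qed.

Lemma rlf_series s t (f : R -> C) x n :
  rlf s t (series (tterm q 1 f x) n) =
  series (fun k => wt q k x * rlf s t (patch (fun=> 0) D f (invbr q k x))) n.
Proof.
rewrite /series/=; elim: n => [|n IH]; first by rewrite !big_geq// rlf0.
rewrite !big_nat_recr//= -IH /tterm expr1n mul1r -rlfMR.
by rewrite /rlf !raddfD/=; ring.
Qed.

(** The inequality holds at every point: where the series diverges, the left side
is the default value 0.  This makes it possible to iterate it. *)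
Lemma transfer_series_real s t (f : R -> C) (A : R -> \bar R) x :
  (forall x, D x -> (0 <= A x)%E) ->
  (forall x, D x -> ((rlf s t (f x))%:E <= A x)%E) ->
  ((rlf s t (transfer_series 1 q f x))%:E <= Pe q A x)%E.
Proof.
move=> A0 fA; rewrite transfer_seriesE.
have P0 : (0 <= Pe q A x)%E by exact: Pe_ge0.
have [c|nc] := pselect (cvgn (series (tterm q 1 f x))); last first.
  by rewrite (dvgP nc) [rlf _ _ _]rlf0.
have S n : ((rlf s t (series (tterm q 1 f x) n))%:E <= Pe q A x)%E.
  rewrite rlf_series; apply: le_trans; last first.
    by apply: (nneseries_lim_ge n) => k _ _; exact: Pe_term_ge0.
  rewrite /series/= -sumEFin; apply: lee_sum => k _.
  rewrite EFinM lee_wpmul2l ?lee_fin ?wt_ge0// /restrict /patch.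
  by case: ifPn => [/set_mem|_]; [exact: fA|rewrite rlf0].
have [PT|/eqP PT] := eqVneq (Pe q A x) +oo%E; first by rewrite PT leey.
have PE : (fine (Pe q A x))%:E = Pe q A x by rewrite fineK// ge0_fin_numE// ltey; exact/eqP.
have cv := @rlf_cvg s t _ c.
rewrite -PE lee_fin -(cvg_lim (@Rhausdorff R) cv).
apply: limr_le; first by apply/cvg_ex; eexists; exact: cv.
by near=> n; rewrite -lee_fin PE; exact: S.
Unshelve. all: by end_near.
Qed.

(** The series of the functional splits into those of its positive and negative
parts, which converge separately. *)
Lemma transfer_series_rlfE s t (f : R -> C) x : (Pe q (nf f) x < +oo)%E ->
  ((rlf s t (transfer_series 1 q f x))%:E +
   Pe q (fun y => (Num.max (- rlf s t (f y)) 0)%:E) x =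
   Pe q (fun y => (Num.max (rlf s t (f y)) 0)%:E) x)%E.
Proof.
move=> fin; have w1 : normc (1 : C) = 1 by exact: normc1.
have c := transfer_series_cvg q0 w1 fin; rewrite transfer_seriesE.
have st0 : 0 <= `|s| + `|t| by exact: addr_ge0.
have bnd (p : R -> R) : (forall y, 0 <= p y) -> (forall y, p y <= `|rlf s t (f y)|) ->
    (Pe q (fun y => (p y)%:E) x < +oo)%E.
  move=> p0 pb; apply: le_lt_trans (_ : (Pe q (fun y => (`|s| + `|t|)%:E * nf f y) x < +oo)%E).
    apply: le_Pe => // y _; first by rewrite lee_fin.
    by rewrite /nf -EFinM lee_fin; exact: le_trans (pb y) (rlf_le _ _ _).
  rewrite (Pe_scale q1)//; last by move=> y _; exact: nf_ge0.
  by apply: lte_mul_pinfty => //; rewrite lee_fin.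
pose pp := fun y => Num.max (rlf s t (f y)) 0.
pose mm := fun y => Num.max (- rlf s t (f y)) 0.
have serE (r : R -> R) : (forall y, 0 <= r y) -> (Pe q (fun y => (r y)%:E) x < +oo)%E ->
    let u k := wt q k x * (r \_ D) (invbr q k x) in
    cvgn (series u) /\ Pe q (fun y => (r y)%:E) x = (limn (series u))%:E.
  move=> r0 rf u; have E : Pe q (fun y => (r y)%:E) x = (\sum_(n <oo) (u n)%:E)%E.
    apply: eq_eseriesr => k _; rewrite /u /restrict /patch.
    by case: ifP => _; rewrite EFinM.
  rewrite E in rf *; apply: nneseries_fin => // k.
  by rewrite mulr_ge0 ?wt_ge0// /restrict /patch; case: ifP.
have p0 y : 0 <= pp y by rewrite le_max lexx orbT.
have m0 y : 0 <= mm y by rewrite le_max lexx orbT.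
have pb y : pp y <= `|rlf s t (f y)| by rewrite ge_max ler_norm normr_ge0.
have mb y : mm y <= `|rlf s t (f y)| by rewrite -normrN ge_max ler_norm normr_ge0.
have [cp ->] := serE pp p0 (bnd pp p0 pb); have [cm ->] := serE mm m0 (bnd mm m0 mb).
rewrite -EFinD; congr EFin; apply/eqP; rewrite eq_sym -subr_eq; apply/eqP.
have cpm := @cvgB _ _ _ _ eventually_filter _ _ _ _ cp cm.
rewrite -(cvg_lim (@Rhausdorff R) cpm).
apply: (cvg_lim (@Rhausdorff R)).
have := @rlf_cvg s t _ c; apply: cvg_trans; apply: near_eq_cvg; near=> n.
rewrite rlf_series fctE /series/= -sumrB; apply: eq_bigr => k _.
rewrite -mulrBr; congr (_ * _); rewrite /restrict /patch /pp /mm.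
case: ifP => _; last by rewrite rlf0 subrr.
move: (rlf _ _ _) => z; have /orP[h|h] := le_total 0 z.
  have -> : Num.max z 0 = z by exact/max_idPl.
  have -> : Num.max (- z) 0 = 0 by apply/max_idPr; rewrite oppr_le0.
  by rewrite subr0.
have -> : Num.max z 0 = 0 by exact/max_idPr.
have -> : Num.max (- z) 0 = - z by apply/max_idPl; rewrite oppr_ge0.
by rewrite sub0r opprK.
Unshelve. all: by end_near.
Qed.

Lemma transfer_series_Im0 (f : R -> C) x : (forall x, D x -> complex.Im (f x) = 0) ->
  complex.Im (transfer_series 1 q f x : C) = 0.
Proof.
move=> f0; rewrite transfer_seriesE.
have [c|nc] := pselect (cvgn (series (tterm q 1 f x))); last first.
  by rewrite (dvgP nc).
rewrite limC// [complex.Im _]/=.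
rewrite (_ : (fun n => _) = (fun=> 0)); first by rewrite lim_cst.
apply/funext => n; rewrite Im_series /series/= big1// => k _.
rewrite /tterm expr1n mul1r /patch; case: ifPn => [/set_mem Dy|_]; last by rewrite mulr0.
by move: (f0 _ Dy); case: (f _) => a b /= ->; rewrite mulr0 mul0r addr0.
Qed.

End Decay.

(** * Loss of mass by interference of signs *)

Section Untwisted.
Context {R : realType}.
Local Notation C := R[i].
Local Notation mu := (@lebesgue_measure R).
Local Notation D := (`]0, 1[%classic : set R).
Variables (q : R) (q1 : 1 < q).

Let q0 : 0 < q. Proof. exact: lt_trans ltr01 q1. Qed.
Let mD := @measurable_D R.
Let normc1' : normc (1 : C) = 1. Proof. exact: normc1. Qed.

#[local] Instance ae_filter20 : Filter (nbhs (almost_everywhere mu)).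
Proof. exact: (ae_filter_ringOfSetsType mu). Qed.

Lemma integrable_rlf s t (f : R -> C) : f \in cintegrable ->
  mu.-integrable D (fun x => (rlf s t (f x))%:E).
Proof.
move=> /cintegrableP[f1 f2].
have := integrableD mD (integrableZl mD s f1) (integrableZl mD t f2).
by apply: eq_integrable.
Qed.

Lemma integrable_max0 (r : R -> R) : mu.-integrable D (fun x => (r x)%:E) ->
  mu.-integrable D (fun x => (Num.max (r x) 0)%:E).
Proof.
move=> ir; apply: (le_integrable mD _ _ ir).
  apply/measurable_EFinP; apply: measurable_maxr; last exact: measurable_cst.
  by apply/measurable_EFinP; exact: (measurable_int _ ir).
move=> x _; rewrite /= lee_fin ger0_norm ?le_max ?lexx ?orbT//.
by rewrite ge_max ler_norm normr_ge0.
Qed.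

Lemma integrable_Pe_nneg (u : R -> \bar R) : (forall x, D x -> (0 <= u x)%E) ->
  mu.-integrable D u -> mu.-integrable D (Pe q u).
Proof.
move=> u0 iu; have mu' := measurable_int _ iu.
apply/integrableP; split; first exact: measurable_Pe.
under eq_integral do rewrite gee0_abs ?Pe_ge0//.
rewrite integral_Pe//; case/integrableP: iu => _; apply: le_lt_trans.
by apply: ge0_le_integral => //; [exact: measurableT_comp|move=> x Dx; exact: lee_abs].
Qed.

(** The positive and negative parts are transported by Pe, which preserves
integrals. *)
Lemma int_rlf_transfer s t (f : R -> C) : f \in cintegrable ->
  \int[mu]_(x in D) rlf s t (transfer_series 1 q f x) = \int[mu]_(x in D) rlf s t (f x).
Proof.
move=> hf; have hL := transfer_series_int q1 normc1' hf.
pose p := fun y => (Num.max (rlf s t (f y)) 0)%:E.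
pose m := fun y => (Num.max (- rlf s t (f y)) 0)%:E.
have i1 := integrable_rlf s t hf; have i2 := integrable_rlf s t hL.
have ip : mu.-integrable D p by exact: integrable_max0.
have im : mu.-integrable D m.
  by apply: integrable_max0; have := integrableN i1; apply: eq_integrable.
have p0 x : D x -> (0 <= p x)%E by move=> _; rewrite lee_fin le_max lexx orbT.
have m0 x : D x -> (0 <= m x)%E by move=> _; rewrite lee_fin le_max lexx orbT.
have iPp := integrable_Pe_nneg p0 ip; have iPm := integrable_Pe_nneg m0 im.
rewrite /Rintegral; congr fine.
have fm := integrable_fin_num mD im.
rewrite -[LHS](@addeK _ (\int[mu]_(x in D) m x)%E)// -[RHS](@addeK _ (\int[mu]_(x in D) m x)%E)//; congr (_ - _)%E.
have eL : (\int[mu]_(x in D) (rlf s t (transfer_series 1 q f x))%:E + \int[mu]_(x in D) m x =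
    \int[mu]_(x in D) p x)%E.
  rewrite -(integral_Pe q0 q1 m0 (measurable_int _ im)) -(integral_Pe q0 q1 p0 (measurable_int _ ip)).
  rewrite -integralD//; apply: ae_eq_integral => //.
  - exact: (measurable_int _ (integrableD mD i2 iPm)).
  - exact: (measurable_int _ iPp).
  - have := ae_Pe_fin q1 hf; apply: filterS => x /[apply] fin.
    exact: transfer_series_rlfE.
rewrite eL -integralD//; apply: eq_integral => x _.
rewrite /p /m -EFinD; congr EFin; move: (rlf _ _ _) => z.
have /orP[h|h] := le_total 0 z.
  have -> : Num.max z 0 = z by exact/max_idPl.
  have -> : Num.max (- z) 0 = 0 by apply/max_idPr; rewrite oppr_le0.
  by rewrite addr0.
have -> : Num.max z 0 = 0 by exact/max_idPr.
have -> : Num.max (- z) 0 = - z by apply/max_idPl; rewrite oppr_ge0.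
by rewrite subrr.
Qed.

Lemma rlf10 (z : C) : rlf 1 0 z = complex.Re z.
Proof. by rewrite /rlf mul1r mul0r addr0. Qed.

Lemma rlfN10 (z : C) : rlf (-1) 0 z = - complex.Re z.
Proof. by rewrite /rlf mulN1r mul0r addr0. Qed.

Lemma rlf01 (z : C) : rlf 0 1 z = complex.Im z.
Proof. by rewrite /rlf mul1r mul0r add0r. Qed.

(** A contraction of the complex numbers into the reals does not increase
oscillations. *)
Lemma good_comp (psi : C -> R) f a :
  (forall z z', `|psi z - psi z'| <= normc (z - z')) -> psi 0 = 0 ->
  measurable_fun D (fun x => psi (f x)) -> good f a ->
  good (fun x => (psi (f x))%:C) a.
Proof.
move=> lip psi0 mp [_ _ [v [dv bv]]]; split=> //.
exists v; split=> // x y x0 xy y1; apply: le_trans (dv x y x0 xy y1).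
have cE z : cut (fun x => (psi (f x))%:C) z = (psi (cut f z))%:C.
  by rewrite /cut /patch; case: ifP => // _; rewrite psi0.
by rewrite !cE -rmorphB normcR.
Qed.

Lemma max0_lip (a b : R) : `|Num.max a 0 - Num.max b 0| <= `|a - b|.
Proof.
have H (c d : R) : c <= d -> `|Num.max c 0 - Num.max d 0| <= d - c.
  move=> cd; have h1 : c <= Num.max c 0 by rewrite le_max lexx.
  have h2 : 0 <= Num.max c 0 by rewrite le_max lexx orbT.
  have h3 : d <= Num.max d 0 by rewrite le_max lexx.
  have h4 : 0 <= Num.max d 0 by rewrite le_max lexx orbT.
  have m0E (e : R) : Num.max e 0 = e \/ Num.max e 0 = 0.
    by have /orP[h|h] := le_total e 0; [right; exact/max_idPr|left; exact/max_idPl].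
  by have [h5|h5] := m0E c; have [h6|h6] := m0E d;
    rewrite h5 h6 in h1 h2 h3 h4 *; rewrite ler_norml; apply/andP; split; lra.
have /orP[ab|ba] := le_total a b.
  by apply: le_trans (H _ _ ab) _; rewrite distrC ler_norm.
by rewrite distrC; apply: le_trans (H _ _ ba) _; rewrite ler_norm.
Qed.

Lemma measurable_max0 (r : R -> R) : measurable_fun D r ->
  measurable_fun D (fun x => Num.max (r x) 0).
Proof. by move=> mr; apply: measurable_maxr => //; exact: measurable_cst. Qed.

Lemma word_nseq_real s t n (f : R -> C) (u : R -> \bar R) :
  (forall x, D x -> (0 <= u x)%E) ->
  (forall x, D x -> ((rlf s t (f x))%:E <= u x)%E) ->
  forall x, D x -> ((rlf s t (word q (nseq n 1) f x))%:E <= iter n (Pe q) u x)%E.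
Proof.
move=> u0 fu; elim: n => [//|n IH] x Dx; rewrite iterS /=.
by apply: transfer_series_real => // y Dy; exact: Pe_iter_ge0.
Qed.

Lemma word_nseq_Im n (f : R -> C) : (forall x, D x -> complex.Im (f x) = 0) ->
  forall x, D x -> complex.Im (word q (nseq n 1) f x) = 0.
Proof.
move=> f0; elim: n => [//|n IH] x Dx.
exact: transfer_series_Im0.
Qed.

Lemma unimodular_nseq n : unimodular (nseq n (1 : C)).
Proof. by rewrite /unimodular all_nseq normc1' eqxx orbT. Qed.

(** Let p and m be the positive and negative parts of f, each of norm 1/2.  Their
M-th iterates A and B are at least c0.  The M-th iterate of f lies between -B and
A, so that its modulus is at most max(A,B) <= A + B - c0. *)
Lemma real_contraction (K : R) : exists M (d : R), 0 < d /\
  forall f : R -> C, (forall x, D x -> complex.Im (f x) = 0) ->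
    \int[mu]_(x in D) complex.Re (f x) = 0 -> good f K -> N1 f = 1 ->
    N1 (word q (nseq M 1) f) <= 1 - d.
Proof.
have [M [c0 [c00 H]]] := lower_bound_good q1 K.
exists M, c0; split=> // f f0 intf gf Nf; have [m1 m2 _] := gf.
have hf := good_int gf.
pose p x : C := (Num.max (complex.Re (f x)) 0)%:C.
pose m x : C := (Num.max (- complex.Re (f x)) 0)%:C.
have ReB (z z' : C) : complex.Re z - complex.Re z' = complex.Re (z - z') by rewrite raddfB.
have gp : good p K.
  apply: (@good_comp (fun z => Num.max (complex.Re z) 0)) => //.
  - move=> z z'; apply: le_trans (max0_lip _ _) _.
    by rewrite ReB; exact: normc_Re.
  - by rewrite /= maxxx.
  - exact: measurable_max0.
have gm : good m K.
  apply: (@good_comp (fun z => Num.max (- complex.Re z) 0)) => //.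
  - move=> z z'; apply: le_trans (max0_lip _ _) _.
    by rewrite -opprD normrN ReB; exact: normc_Re.
  - by rewrite /= oppr0 maxxx.
  - by apply: measurable_max0; exact: measurableT_comp.
have hp := good_int gp; have hm := good_int gm.
have np x : normc (p x) = Num.max (complex.Re (f x)) 0.
  by rewrite normcR ger0_norm// le_max lexx orbT.
have nm x : normc (m x) = Num.max (- complex.Re (f x)) 0.
  by rewrite normcR ger0_norm// le_max lexx orbT.
have ip := integrable_normc hp; have im := integrable_normc hm.
have maxE (z : R) : Num.max z 0 + Num.max (- z) 0 = `|z| /\
    Num.max z 0 - Num.max (- z) 0 = z.
  have /orP[h|h] := le_total 0 z.
    have -> : Num.max z 0 = z by exact/max_idPl.
    have -> : Num.max (- z) 0 = 0 by apply/max_idPr; rewrite oppr_le0.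
    by rewrite addr0 subr0 ger0_norm.
  have -> : Num.max z 0 = 0 by exact/max_idPr.
  have -> : Num.max (- z) 0 = - z by apply/max_idPl; rewrite oppr_ge0.
  by rewrite add0r sub0r opprK ler0_norm.
have sumN : N1 p + N1 m = 1.
  rewrite -Nf /N1 -RintegralD//; apply: eq_Rintegral => x Dx.
  rewrite np nm (maxE _).1 -normcR; congr normc.
  by move: (f0 x (set_mem Dx)); case: (f x) => a b /= ->.
have difN : N1 p - N1 m = 0.
  rewrite -intf /N1 -RintegralB//; apply: eq_Rintegral => x Dx.
  by rewrite np nm (maxE _).2.
have Np : 2^-1 <= N1 p by lra.
have Nm : 2^-1 <= N1 m by lra.
have p0 x : D x -> (0 <= nf p x)%E by move=> _; exact: nf_ge0.
have m0 x : D x -> (0 <= nf m x)%E by move=> _; exact: nf_ge0.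
have mp := measurable_nf hp; have mm := measurable_nf hm.
set g := word q (nseq M 1) f.
have hg : g \in cintegrable by apply: word_int => //; exact: unimodular_nseq.
pose A := iter M (Pe q) (nf p); pose B := iter M (Pe q) (nf m).
have gA x : D x -> ((complex.Re (g x))%:E <= A x)%E.
  move=> Dx; rewrite -rlf10; apply: word_nseq_real => // y Dy.
  by rewrite rlf10 lee_fin np le_max lexx.
have gB x : D x -> ((- complex.Re (g x))%:E <= B x)%E.
  move=> Dx; rewrite -rlfN10; apply: word_nseq_real => // y Dy.
  by rewrite rlfN10 lee_fin nm le_max lexx.
have key x : D x -> (nf g x + c0%:E <= A x + B x)%E.
  move=> Dx; have -> : nf g x = (`|complex.Re (g x)|)%:E.
    rewrite -normcR; congr (normc _)%:E; have := word_nseq_Im M f0 Dx.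
    by rewrite -/g; case: (g x) => a b /= ->.
  have hA := H p gp Np x Dx; have hB := H m gm Nm x Dx.
  have /orP[h|h] := le_total 0 (complex.Re (g x)).
    by rewrite ger0_norm//; apply: leeD => //; exact: gA.
  by rewrite ler0_norm// addeC; apply: leeD => //; exact: gB.
have mA : measurable_fun D A by exact: measurable_Pe_iter.
have mB : measurable_fun D B by exact: measurable_Pe_iter.
have A0 x : D x -> (0 <= A x)%E by move=> Dx; exact: Pe_iter_ge0.
have B0 x : D x -> (0 <= B x)%E by move=> Dx; exact: Pe_iter_ge0.
have intAB : (\int[mu]_(x in D) (A x + B x) = 1)%E.
  rewrite ge0_integralD// !integral_Pe_iter// -!N1E//.
  by rewrite -EFinD sumN.
suff : N1 g + c0 <= 1 by lra.
rewrite -lee_fin EFinD N1E// -intAB.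
have -> : c0%:E = (\int[mu]_(x in D) (cst c0%:E x))%E.
  by rewrite integral_cst// [X in (_ * X)%E]mu_D mule1.
rewrite -ge0_integralD//; last 3 first.
- by move=> x _; exact: nf_ge0.
- exact: measurable_nf.
- by move=> x _; rewrite lee_fin ltW.
apply: ge0_le_integral => //.
- by move=> x _; rewrite adde_ge0 ?nf_ge0// lee_fin ltW.
- by apply: emeasurable_funD => //; exact: measurable_nf.
- exact: emeasurable_funD.
Qed.

End Untwisted.

(** * Decay of the iterates on functions of bounded variation *)

Section Iterates.
Context {R : realType}.
Local Notation C := R[i].
Local Notation mu := (@lebesgue_measure R).
Local Notation D := (`]0, 1[%classic : set R).
Variables (q : R) (zeta eta : C).
Hypotheses (q1 : 1 < q) (z1 : normc zeta = 1) (e1 : normc eta = 1).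

Let q0 : 0 < q. Proof. exact: lt_trans ltr01 q1. Qed.
Let mD := @measurable_D R.
Let Q : L1 R -> L1 R := transfer zeta q \o transfer eta q.

Definition qword n : seq C := flatten (nseq n [:: zeta; eta]).

Lemma qwordS n : qword n.+1 = zeta :: eta :: qword n.
Proof. by []. Qed.

Lemma qwordD m n : qword (m + n) = qword m ++ qword n.
Proof. by elim: m => [//|m IH]; rewrite addSn !qwordS IH. Qed.

Lemma size_qword n : size (qword n) = n.*2.
Proof. by elim: n => [//|n IH]; rewrite qwordS /= IH doubleS. Qed.

Lemma unimodular_qword n : unimodular (qword n).
Proof. by elim: n => [//|n IH]; rewrite qwordS /= z1 e1 eqxx. Qed.

Lemma word_cat (s1 s2 : seq C) (f : R -> C) :
  word q (s1 ++ s2) f = word q s1 (word q s2 f).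
Proof. by rewrite /word foldr_cat. Qed.

Lemma iter_Q_class n (f : R -> C) : f \in cintegrable ->
  iter n Q (L1class f) = L1class (word q (qword n) f).
Proof.
move=> hf; elim: n => [//|n IH]; rewrite iterS IH qwordS /= /Q /=.
have h1 : word q (qword n) f \in cintegrable.
  by apply: word_int => //; exact: unimodular_qword.
by rewrite !transfer_class//; exact: transfer_series_int.
Qed.

Lemma iter_Q_lin n (a : C) g h : iter n Q (a *: g + h) = a *: iter n Q g + iter n Q h.
Proof. by elim: n => [//|n IH]; rewrite !iterS IH; exact: Q_lin. Qed.

Lemma N1_qwordZ n (c : C) (f : R -> C) : f \in cintegrable ->
  N1 (word q (qword n) (fun x => c * f x)) = normc c * N1 (word q (qword n) f).
Proof.
move=> hf; have hcf : (fun x => c * f x) \in cintegrable by exact: cintegrableZ.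
have u := unimodular_qword n.
rewrite -!nR_class ?word_int// -!iter_Q_class// L1classZ// -nRZ; congr nR.
have := iter_Q_lin n c (L1class f) 0; rewrite addr0 => ->.
suff -> : iter n Q 0 = 0 by rewrite addr0.
by have := iter_Q_lin n (-1) 0 0; rewrite scaler0 addr0 scaleN1r addNr.
Qed.

(** The norms N n of the iterates decrease.  If they stayed above e, all iterates
would have variation at most A / e relative to their norm, so that one contraction
rate 1 - d would serve for all blocks of M iterations; then N (j M) would tend to 0. *)
Lemma decay (P : (R -> C) -> Prop) :
  (forall f n, f \in cintegrable -> P f -> P (word q (qword n) f)) ->
  (forall (c : R) f, f \in cintegrable -> P f -> P (fun x => c%:C * f x)) ->
  (forall K, exists M (d : R), 0 < d /\ forall f, P f -> good f K -> N1 f = 1 ->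
      N1 (word q (qword M) f) <= 1 - d) ->
  forall f a, P f -> good f a -> forall e : R, 0 < e ->
    exists n, N1 (word q (qword n) f) <= e.
Proof.
move=> Pword PZ Hc f a Pf gf e e0; apply: contrapT => /forallNP Hn.
have hf := good_int gf.
pose N n := N1 (word q (qword n) f).
have Ne n : e < N n by rewrite ltNge; apply/negP; exact: Hn.
(* A bound on the variation that is valid for all iterates. *)
pose A := a + bvC q * N1 f.
have gA n : good (word q (qword n) f) A by apply: good_word => //; exact: unimodular_qword.
have A0 : 0 <= A by have [_ _ /bvle_ge0] := gA 0%N.
have [M [d [d0 H]]] := Hc (A / e).
have step n : N (n + M)%N <= (1 - d) * N n.
  have Nn0 : 0 < N n by exact: lt_trans (Ne n).
  set g := word q (qword n) f; have hg : g \in cintegrable by exact: good_int (gA n).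
  have cc : normc ((N n)^-1)%:C = (N n)^-1 by rewrite normcR ger0_norm// invr_ge0 ltW.
  have := H (fun x => ((N n)^-1)%:C * g x).
  rewrite N1_qwordZ// cc -word_cat -qwordD addnC -/(N _) ler_pdivrMl// [N n * _]mulrC.
  apply.
  - by apply: PZ => //; exact: Pword.
  - have := goodZ ((N n)^-1)%:C (gA n); apply: good_le.
    by rewrite cc mulrC ler_wpM2l// lef_pV2 ?posrE// ltW.
  - have := N1_qwordZ 0 ((N n)^-1)%:C hg; rewrite cc /= => ->.
    by rewrite mulVf// gt_eqF.
have r0 : 0 < 1 - d.
  have h := lt_le_trans (lt_trans e0 (Ne _)) (step 0%N).
  by move: h; rewrite pmulr_lgt0//; exact: lt_trans (Ne 0%N).
have geo j : N (j * M)%N <= (1 - d) ^+ j * N 0%N.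
  elim: j => [|j IH]; first by rewrite mul0n expr0 mul1r.
  rewrite mulSn addnC; apply: le_trans (step _) _.
  by rewrite exprS -mulrA ler_pM2l.
have N00 : 0 < N 0%N by exact: lt_trans (Ne 0%N).
have : (fun j => (1 - d) ^+ j) @ \oo --> (0 : R).
  by apply: cvg_expr; rewrite gtr0_norm//; lra.
move/cvgrPdist_lt => /(_ (e / N 0%N)); rewrite divr_gt0// => /(_ isT)[j _ Hj].
have := Hj j (leqnn _); rewrite /= sub0r normrN ger0_norm ?exprn_ge0 ?(ltW r0)//.
rewrite ltr_pdivlMr// => h; have := le_lt_trans (geo j) h.
by rewrite ltNge ltW.
Qed.

(** The loss is caught at a letter different from 1: the last one of a block if
zeta <> 1, the last but one if only eta <> 1. *)
Lemma twisted_contraction (K : R) : (zeta != 1) || (eta != 1) ->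
  exists M (d : R), 0 < d /\ forall f, good f K -> N1 f = 1 ->
    N1 (word q (qword M) f) <= 1 - d.
Proof.
move=> /orP[zn|en].
  have [M H] := word_loss q1 K z1 zn; have [d d0 Hd] := H M.+1.
  exists M.+1, d; split=> // f gf Nf; rewrite qwordS.
  apply: (Hd (eta :: qword M)) => //=.
    by rewrite e1 eqxx unimodular_qword.
  by rewrite size_qword addSn addnn.
have [M H] := word_loss q1 K e1 en; have [d d0 Hd] := H M.
exists M.+1, d; split=> // f gf Nf; have hf := good_int gf.
have u := unimodular_qword M; rewrite qwordS.
apply: le_trans (_ : N1 (word q (eta :: qword M) f) <= _).
  apply: N1_transfer_series => //; apply: (@word_int _ _ q1 (eta :: qword M)) => //=.
  by rewrite e1 eqxx.
by apply: Hd => //; rewrite size_qword addnn.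
Qed.

Lemma twisted_decay f a : (zeta != 1) || (eta != 1) -> good f a ->
  forall e : R, 0 < e -> exists n, nR (iter n Q (L1class f)) <= e.
Proof.
move=> tw gf e e0; have hf := good_int gf.
have [|||n Hn] := @decay (fun=> True) _ _ _ f a I gf e e0 => //.
  move=> K; have [M [d [d0 H]]] := twisted_contraction K tw.
  by exists M, d; split=> // g _; exact: H.
exists n; rewrite iter_Q_class// nR_class//.
by apply: word_int => //; exact: unimodular_qword.
Qed.

Lemma untwisted_decay f a : zeta = 1 -> eta = 1 ->
  (forall x, D x -> complex.Im (f x) = 0) ->
  \int[mu]_(x in D) complex.Re (f x) = 0 -> good f a ->
  forall e : R, 0 < e -> exists n, nR (iter n Q (L1class f)) <= e.
Proof.
move=> ze ee f0 intf gf e e0; have hf := good_int gf.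
have qE n : qword n = nseq n.*2 1.
  by elim: n => [//|n IH]; rewrite qwordS IH doubleS ze ee.
pose P (g : R -> C) := (forall x, D x -> complex.Im (g x) = 0) /\
  \int[mu]_(x in D) complex.Re (g x) = 0.
have [|||n Hn] := @decay P _ _ _ f a (conj f0 intf) gf e e0.
- move=> g n hg [g0 ig]; rewrite qE; split; first exact: word_nseq_Im.
  elim: (n.*2) => [//|k IH]; apply: etrans IH; rewrite /=.
  have E (u : R -> C) : \int[mu]_(x in D) complex.Re (u x) =
      \int[mu]_(x in D) rlf 1 0 (u x) by apply: eq_Rintegral => x _; rewrite rlf10.
  rewrite !E; apply: int_rlf_transfer => //.
  by apply: word_int => //; exact: unimodular_nseq.
- move=> c g hg [g0 ig]; split=> [x Dx|].
    by move: (g0 x Dx); case: (g x) => u v /= ->; rewrite mulr0 mul0r addr0.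
  have /cintegrableP[ir _] := hg.
  apply: (@etrans _ _ (c * \int[mu]_(x in D) complex.Re (g x))); last by rewrite ig mulr0.
  rewrite -RintegralZl//.
  apply: eq_Rintegral => x Dx; move: (g0 x (set_mem Dx)).
  by case: (g x) => u v /= ->; rewrite mul0r subr0.
- move=> K; have [M [d [d0 H]]] := real_contraction q1 K.
  exists M, d; split=> // g [g0 ig] gg Ng; rewrite qE -addnn nseqD word_cat.
  apply: le_trans (H g g0 ig gg Ng); apply: N1_word => //.
    exact: unimodular_nseq.
  by apply: word_int => //; [exact: unimodular_nseq|exact: good_int gg].
exists n; rewrite iter_Q_class// nR_class//.
by apply: word_int => //; exact: unimodular_qword.
Qed.

End Iterates.

(** * Density of step functions *)

Section Density.
Context {R : realType}.
Local Notation C := R[i].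
Local Notation mu := (@lebesgue_measure R).
Local Notation D := (`]0, 1[%classic : set R).

Let mD := @measurable_D R.

(** The argument by signs in the case zeta = eta = 1 needs real functions. *)
Definition rgood (s : R -> R) := exists a, good (fun x => (s x)%:C) a.

Lemma rgoodD (s t : R -> R) : rgood s -> rgood t -> rgood (fun x => s x + t x).
Proof.
move=> [a ga] [b gb]; exists (a + b); have := goodD ga gb.
by congr good; apply/funext => x; rewrite rmorphD.
Qed.

Lemma rgoodZ (c : R) (s : R -> R) : rgood s -> rgood (fun x => c * s x).
Proof.
move=> [a ga]; exists (normc c%:C * a); have := goodZ c%:C ga.
by congr good; apply/funext => x; rewrite rmorphM.
Qed.

Lemma rgood_cst (c : R) : rgood (fun=> c).
Proof. by exists (normc c%:C); exact: good_cst. Qed.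

Lemma rgood_step (t : R) : rgood (fun x => if x < t then 1 else 0).
Proof.
exists 1; have := good_step t; congr good; apply/funext => x.
by case: ifP.
Qed.

Lemma rgood_int (s : R -> R) : rgood s -> (fun x => (s x)%:C) \in cintegrable.
Proof. by move=> [a /good_int]. Qed.

Lemma rgood_itv (u v : R) : u <= v ->
  rgood (fun x => if (u <= x) && (x < v) then 1 else 0).
Proof.
move=> uv; have := rgoodD (rgood_step v) (rgoodZ (-1) (rgood_step u)).
congr rgood; apply/funext => x; rewrite mulN1r.
have [xu|ux] := ltP x u; first by rewrite (lt_le_trans xu uv) subrr.
by rewrite subr0.
Qed.

(** Real induction on t: A t says that the approximation exists on [0,t[.  Near
the supremum of these t the function differs from its value there by at most e, so
that the approximation extends beyond, unless the supremum is 1. *)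
Lemma continuous_step (g : R -> R) (e : R) : continuous g -> 0 < e ->
  exists2 s, rgood s & forall x, D x -> `|g x - s x| <= e.
Proof.
move=> cg e0.
pose A t := exists s, [/\ rgood s, forall x, 0 <= x -> x < t -> `|g x - s x| <= e &
  forall x, t <= x -> s x = 0].
have ext t v c : t <= v -> (forall x, t <= x -> x < v -> `|g x - c| <= e) -> A t -> A v.
  move=> tv Hc [s [gs Hs s0]].
  exists (fun x => s x + c * (if (t <= x) && (x < v) then 1 else 0)); split.
  - by apply: rgoodD => //; apply: rgoodZ; exact: rgood_itv.
  - move=> x x0 xv; have [xt|tx] := ltP x t; first by rewrite mulr0 addr0; exact: Hs.
    by rewrite xv mulr1 s0// add0r; exact: Hc.
  - by move=> x vx; rewrite s0 ?(le_trans tv)// ltNge vx andbF mulr0 addr0.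
have A0 : A 0.
  exists (fun=> 0); split=> //; first exact: rgood_cst.
  by move=> x x0; rewrite ltNge x0.
have loc (T : R) : exists2 d, 0 < d & forall x, `|T - x| < d -> `|g x - g T| <= e.
  have /cvgrPdist_le/(_ _ e0)/nbhs_ballP[d /= d0 Hd] := cg T.
  by exists d => // x Tx; rewrite distrC; exact: Hd.
pose S := [set t | t <= 1 /\ A t].
have S0 : S 0 by [].
have ubS : ubound S 1 by move=> t [].
have hS : has_sup S by split; [exists 0|exists 1].
have T0 : 0 <= sup S by exact: (ub_le_sup hS.2 S0).
have T1 : sup S <= 1 by apply: ge_sup ubS; exists 0.
have [d d0 Hd] := loc (sup S).
have [t [t1 At] tT] := sup_adherent d0 hS.
have tS : t <= sup S by exact: (ub_le_sup hS.2 (conj t1 At)).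
pose v := Num.min (sup S + d / 2) 1.
have tv : t <= v by rewrite le_min t1 andbT; lra.
have Av : A v.
  apply: (ext t v (g (sup S))) => // x tx; rewrite lt_min => /andP[xv _].
  by apply: Hd; rewrite ltr_norml; apply/andP; split; lra.
have : v <= sup S by apply: (ub_le_sup hS.2); split=> //; rewrite ge_min lexx orbT.
rewrite ge_min => /orP[h|h]; first by lra.
have v1 : v = 1 by apply/min_idPr; lra.
rewrite v1 in Av; have [s [gs Hs _]] := Av; exists s => // x.
by rewrite /= in_itv/= => /andP[x0 x1]; exact: Hs (ltW x0) x1.
Qed.

Lemma rgood_dense (u : R -> R) (e : R) : mu.-integrable D (EFin \o u) -> 0 < e ->
  exists2 s, rgood s & N1 (fun x => (u x)%:C - (s x)%:C) <= e.
Proof.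
move=> iu e0; have e2 : 0 < e / 2 by rewrite divr_gt0.
have [|g_ [cg ig /fine_cvgP[[N1_ _ fin] /cvgrPdist_le]]] :=
  approximation_continuous_integrable mD _ iu.
  by rewrite [X in (X < _)%E]mu_D ltry.
move=> /(_ _ e2)[N2 _ HN].
pose n := maxn N1_ N2; pose g := g_ n.
have gn : \int[mu]_(x in D) `|u x - g x| <= e / 2.
  have := HN n (leq_maxr _ _); rewrite sub0r normrN => h.
  by apply: le_trans h; exact: ler_norm.
have [s gs Hs] := continuous_step (cg n) e2.
have hs := rgood_int gs; have /cintegrableP[is_ _] := hs.
have iu' : (fun x => (u x)%:C) \in cintegrable.
  by apply/cintegrableP; split; [exact: iu|exact: integrable0].
have ig' : (fun x => (g x)%:C) \in cintegrable.
  by apply/cintegrableP; split; [exact: ig|exact: integrable0].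
exists s => //.
have h1 : (fun x => (u x)%:C - (g x)%:C) \in cintegrable by exact: rpredB iu' ig'.
have h2 : (fun x => (g x)%:C - (s x)%:C) \in cintegrable by exact: rpredB ig' hs.
have h3 : (fun x => (u x)%:C - (s x)%:C) \in cintegrable by exact: rpredB iu' hs.
rewrite -nR_class// L1classB//; apply: le_trans (nR_dist (L1class (fun x => (g x)%:C)) _ _) _.
rewrite -!L1classB// !nR_class// [leRHS](splitr e); apply: lerD.
  apply: le_trans gn; rewrite le_eqVlt; apply/orP; left; apply/eqP.
  by apply: eq_Rintegral => x _; rewrite -rmorphB normcR.
have -> : e / 2 = N1 (fun=> (e / 2)%:C).
  by rewrite N1_cst normcR ger0_norm// ltW.
apply: le_Rintegral => //.
- exact: integrable_normc h2.
- by apply: integrable_normc; exact: cintegrable_cst.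
- by move=> x Dx; rewrite -rmorphB !normcR (ger0_norm (ltW e2)); exact: Hs.
Qed.

End Density.

(** * The closure of the range *)

Section ClosureOfRange.
Context {R : realType}.
Local Notation C := R[i].
Local Notation mu := (@lebesgue_measure R).
Local Notation D := (`]0, 1[%classic : set R).
Variables (q : R) (zeta eta : C).
Hypotheses (q1 : 1 < q) (z1 : normc zeta = 1) (e1 : normc eta = 1).

Let mD := @measurable_D R.
Let Q : L1 R -> L1 R := transfer zeta q \o transfer eta q.
Let Qlin := Q_lin q1 z1 e1 : forall a g h, Q (a *: g + h) = a *: Q g + Q h.
Let Ran : set (L1 R) := range (fun h => h - Q h).

#[local] Instance ae_filter23 : Filter (nbhs (almost_everywhere mu)).
Proof. exact: (ae_filter_ringOfSetsType mu). Qed.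

Lemma subspace_Ran : Defs.subspace Ran.
Proof.
split; first by exists 0 => //; rewrite (op0 Qlin) subr0.
move=> a _ _ [g _ <-] [h _ <-]; exists (a *: g + h) => //.
by rewrite Qlin scalerBr opprD addrACA.
Qed.

(** The telescoping sum h - Q^n h = (1 - Q) (h + Q h + ... + Q^(n-1) h). *)
Lemma Ran_iter n h : Ran (h - iter n Q h).
Proof.
elim: n => [|n [g _ gE]]; first by exists 0 => //; rewrite (op0 Qlin) !subrr.
rewrite iterS; set k := iter n Q h in gE *.
exists (g + k); first by [].
by rewrite (opD Qlin) opprD addrACA gE addrA subrK.
Qed.

Definition decays h := forall e : R, 0 < e -> exists n, nR (iter n Q h) <= e.

Lemma decays_closure h : decays h -> closure Ran h.
Proof.
move=> dh; apply/closureL1P => e e0; have e2 : 0 < e / 2 by rewrite divr_gt0.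
have [n Hn] := dh _ e2; exists (h - iter n Q h); first exact: Ran_iter.
by rewrite opprB addrC subrK; apply: le_lt_trans Hn _; lra.
Qed.

Lemma nR_iter n h : nR (iter n Q h) <= nR h.
Proof. by elim: n => [//|n IH]; rewrite iterS; apply: le_trans (nR_Q q1 z1 e1 _) IH. Qed.

Lemma decaysZD a g h : decays g -> decays h -> decays (a *: g + h).
Proof.
move=> dg dh e e0; have e2 : 0 < e / 2 by rewrite divr_gt0.
have a1 : 0 < normc a + 1 by apply: ltr_wpDl => //; exact: normc_ge0.
have [n Hn] := dg _ (divr_gt0 e2 a1); have [m Hm] := dh _ e2.
exists (n + m)%N; rewrite (iter_Q_lin q1 z1 e1).
apply: le_trans (nR_triangle _ _) _; rewrite nRZ [leRHS](splitr e); apply: lerD.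
  rewrite addnC iterD; apply: (@le_trans _ _ (normc a * (e / 2 / (normc a + 1)))).
    by rewrite ler_wpM2l ?normc_ge0//; apply: le_trans (nR_iter _ _) Hn.
  rewrite mulrCA ler_piMr ?(ltW e2)// ler_pdivrMr// mul1r lerDl.
  exact: ler01.
by rewrite iterD; apply: le_trans (nR_iter _ _) Hm.
Qed.

(** The iterates are contractions, so that decay passes to limits in norm. *)
Lemma decays_lim h :
  (forall e : R, 0 < e -> exists2 g, decays g & nR (h - g) <= e) -> decays h.
Proof.
move=> H e e0; have e2 : 0 < e / 2 by rewrite divr_gt0.
have [g dg hg] := H _ e2; have [n Hn] := dg _ e2; exists n.
have -> : h = 1 *: (h - g) + g by rewrite scale1r subrK.
rewrite (iter_Q_lin q1 z1 e1) scale1r; apply: le_trans (nR_triangle _ _) _.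
by rewrite [leRHS](splitr e); apply: lerD => //; apply: le_trans (nR_iter _ _) hg.
Qed.

Lemma L1int_class (f : R -> C) : f \in cintegrable ->
  L1int (L1class f) = ((\int[mu]_(x in D) complex.Re (f x)) +i*
                       (\int[mu]_(x in D) complex.Im (f x)))%C.
Proof.
move=> hf; rewrite /L1int.
have [r1 r2] := cintegrable_measurable hf.
have [r3 r4] := cintegrable_measurable (L1val_int (L1class f)).
have ae := L1classK hf.
by congr (_ +i* _)%C; congr fine; apply: ae_eq_integral => //;
  try (exact/measurable_EFinP); apply: filterS ae => x /[apply] ->.
Qed.

Lemma L1intB (g h : L1 R) : L1int (g - h) = L1int g - L1int h.
Proof.
move: g h; apply: L1class_ind => g hg; apply: L1class_ind => h hh.
have hb : (fun x => g x - h x) \in cintegrable by exact: rpredB hg hh.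
rewrite -L1classB// !L1int_class//.
have /cintegrableP[g1 g2] := hg; have /cintegrableP[h1 h2] := hh.
have E (a b c d : R) : (a +i* b)%C - (c +i* d)%C = ((a - c) +i* (b - d))%C by [].
rewrite E -!RintegralB//; congr (_ +i* _)%C; apply: eq_Rintegral => x _.
  by rewrite raddfB.
by rewrite raddfB.
Qed.

Lemma normc_L1int (h : L1 R) : `|complex.Re (L1int h)| <= nR h /\ `|complex.Im (L1int h)| <= nR h.
Proof.
move: h; apply: L1class_ind => h hh; rewrite L1int_class// nR_class//=.
have /cintegrableP[h1 h2] := hh; have ih := integrable_normc hh.
split; apply: le_trans (le_normr_Rintegral _ _) _ => //; apply: le_Rintegral => //.
- exact: integrable_norm.
- by move=> x _; exact: normc_Re.
- exact: integrable_norm.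
- by move=> x _; exact: normc_Im.
Qed.

Lemma L1int_transfer (h : L1 R) : L1int (transfer 1 q h) = L1int h.
Proof.
move: h; apply: L1class_ind => f hf.
have w1 : normc (1 : C) = 1 by exact: normc1.
rewrite transfer_class// !L1int_class//; last exact: transfer_series_int.
have E1 (u : R -> C) : \int[mu]_(x in D) complex.Re (u x) =
    \int[mu]_(x in D) rlf 1 0 (u x) by apply: eq_Rintegral => x _; rewrite rlf10.
have E2 (u : R -> C) : \int[mu]_(x in D) complex.Im (u x) =
    \int[mu]_(x in D) rlf 0 1 (u x) by apply: eq_Rintegral => x _; rewrite rlf01.
by rewrite !E1 !E2 !int_rlf_transfer.
Qed.

Let V : set (L1 R) := if (zeta == 1) && (eta == 1) then [set g | L1int g = 0] else setT.

(** If zeta = eta = 1, the integral vanishes on the range and is continuous. *)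
Lemma Ran_sub : closure Ran `<=` V.
Proof.
rewrite /V; case: ifPn => [/andP[/eqP ze /eqP ee]|//] h /closureL1P ch.
have R0 a : Ran a -> L1int a = 0.
  by move=> [g _ <-]; rewrite L1intB /Q /= ze ee !L1int_transfer subrr.
have B e : 0 < e -> `|complex.Re (L1int h)| <= e /\ `|complex.Im (L1int h)| <= e.
  move=> e0; have [a Ra ha] := ch e e0; have := normc_L1int (h - a).
  rewrite L1intB (R0 a Ra) subr0 => -[h1 h2].
  by split; [apply: le_trans h1 (ltW ha)|apply: le_trans h2 (ltW ha)].
have r0 : `|complex.Re (L1int h)| <= 0.
  by apply/ler_addgt0Pl => e e0; rewrite addr0; have [] := B e e0.
have i0 : `|complex.Im (L1int h)| <= 0.
  by apply/ler_addgt0Pl => e e0; rewrite addr0; have [] := B e e0.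
move: r0 i0; rewrite !normr_le0 => /eqP r0 /eqP i0 /=.
by rewrite [L1int h]complexE r0 i0 mulr0 addr0.
Qed.

(** A step function s approximates u in norm.  If zeta = eta = 1, then s has to be
corrected by the constant c = int s, which is as small as u - s since int u = 0. *)
Lemma decays_real (u : R -> R) : mu.-integrable D (EFin \o u) ->
  (zeta = 1 -> eta = 1 -> \int[mu]_(x in D) u x = 0) ->
  decays (L1class (fun x => (u x)%:C)).
Proof.
move=> iu u0; apply: decays_lim => e e0; have e2 : 0 < e / 2 by rewrite divr_gt0.
have hu : (fun x => (u x)%:C) \in cintegrable.
  by apply/cintegrableP; split; [exact: iu|exact: integrable0].
have [s gs] := rgood_dense iu e2; have hs := rgood_int gs.
have hus : (fun x => (u x)%:C - (s x)%:C) \in cintegrable by exact: rpredB hu hs.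
move=> Hs; have [/andP[/eqP ze /eqP ee]|tw] := boolP ((zeta == 1) && (eta == 1)); last first.
  exists (L1class (fun x => (s x)%:C)); last first.
    by rewrite -L1classB// nR_class//; apply: le_trans Hs _; lra.
  case: gs => a ga d d0; apply: (twisted_decay q1 z1 e1 _ ga d0).
  by rewrite -negb_and.
have /cintegrableP[is_ _] := hs.
pose c := \int[mu]_(x in D) s x.
have gt : rgood (fun x => s x + - c) by apply: rgoodD => //; exact: rgood_cst.
have ht := rgood_int gt.
exists (L1class (fun x => (s x + - c)%:C)).
  case: gt => a ga d d0; apply: (untwisted_decay q1 z1 e1 ze ee _ _ ga d0) => //=.
  rewrite RintegralD//; last first.
    by have /cintegrableP[] := @cintegrable_cst R (- c)%:C.
  by rewrite Rintegral_cst// [X in fine X](_ : _ = 1%E) ?mulr1 ?subrr//; exact: mu_D.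
have -> : L1class (fun x => (s x + - c)%:C) = L1class (fun x => (s x)%:C) - L1class (fun=> c%:C).
  rewrite -L1classB//; last exact: cintegrable_cst.
  by congr L1class; apply/funext => x; rewrite rmorphB.
rewrite opprB addrA addrAC; apply: le_trans (nR_triangle _ _) _.
rewrite [leRHS](splitr e); apply: lerD; first by rewrite -L1classB// nR_class.
rewrite nR_class ?cintegrable_cst// N1_cst normcR.
have := (normc_L1int (L1class (fun x => (u x)%:C - (s x)%:C))).1.
rewrite nR_class// L1classB// L1intB !L1int_class//= u0//.
by rewrite sub0r normrN => h; exact: le_trans h Hs.
Qed.

Lemma decays_V h : V h -> decays h.
Proof.
move: h; apply: L1class_ind => f hf Vf; have /cintegrableP[f1 f2] := hf.
have V0 : zeta = 1 -> eta = 1 ->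
    \int[mu]_(x in D) complex.Re (f x) = 0 /\ \int[mu]_(x in D) complex.Im (f x) = 0.
  move=> ze ee; move: Vf; rewrite /V ze ee eqxx /= L1int_class//.
  by move=> /eqP; rewrite eq_complex /= => /andP[/eqP -> /eqP ->].
have hr : (fun x => (complex.Re (f x))%:C) \in cintegrable.
  by apply/cintegrableP; split; [exact: f1|exact: integrable0].
have hi : (fun x => (complex.Im (f x))%:C) \in cintegrable.
  by apply/cintegrableP; split; [exact: f2|exact: integrable0].
have -> : L1class f = 'i%C *: L1class (fun x => (complex.Im (f x))%:C) +
    L1class (fun x => (complex.Re (f x))%:C).
  rewrite -L1classZ// -L1classD//; last exact: cintegrableZ.
  by congr L1class; apply/funext => x; rewrite addrC -complexE.
by apply: decaysZD; apply: decays_real => // ze ee; have [] := V0 ze ee.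
Qed.

Lemma closure_Ran : closure Ran = V.
Proof.
by apply/seteqP; split; [exact: Ran_sub|move=> h /decays_V /decays_closure].
Qed.

(** The range is proper because it is not closed whereas its closure is. *)
Lemma proper_dense_Ran : proper_dense_subspace Ran V.
Proof.
split; [exact: subspace_Ran| |by rewrite closure_Ran].
split; first by rewrite -closure_Ran; exact: subset_closure.
move=> VR; apply: (range_IQ_not_closed q1 z1 e1); rewrite -/Q -/Ran.
suff -> : Ran = closure Ran by exact: closed_closure.
by apply/seteqP; split; [exact: subset_closure|rewrite closure_Ran].
Qed.

Lemma ker_Pi (rho : L1 R) : L1int rho = 1 -> ker (Pi zeta eta rho) = V.
Proof.
move=> r1; rewrite /ker /Pi /V; case: ifP => _; last by apply/seteqP; split.
have rho0 : rho <> 0.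
  have h : L1int (rho - rho) = 0 by rewrite L1intB subrr.
  by move=> r0; move: h; rewrite subrr -r0 r1 => /eqP; rewrite oner_eq0.
apply/seteqP; split=> h /=; last by move=> ->; rewrite scale0r.
by move=> /eqP; rewrite scaler_eq0 => /orP[/eqP //|/eqP].
Qed.

End ClosureOfRange.

(** * Spectrum and range of the composition *)

Theorem proposition5p5 (R : realType) (q : R) (zeta eta : R[i]) :
  1 < q -> `|zeta| = 1 -> `|eta| = 1 ->
  let Q : L1 R -> L1 R := transfer zeta q \o transfer eta q in
  let RanIQ : set (L1 R) := range (fun h => h - Q h) in
  let V : set (L1 R) :=
    if (zeta == 1) && (eta == 1) then [set g | L1int g = 0] else setT in
  let closed_disc : set R[i]^o := closure [set z : R[i]^o | `|z| < 1] in
  [/\ spectrum Q = fredholm_spectrum Q,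
      fredholm_spectrum Q = closed_disc,
      ~ closed RanIQ,
      closure RanIQ = V /\
      (forall rho : L1 R, invariant_density q rho ->
         closure RanIQ = ker (Pi zeta eta rho)) &
      proper_dense_subspace RanIQ V].
Proof.
move=> q1 zn en Q RanIQ V closed_disc.
have z1 : normc zeta = 1 by apply: complexI; rewrite -normCE.
have e1 : normc eta = 1 by apply: complexI; rewrite -normCE.
split.
- by rewrite (spectrumE q1 z1 e1) (fredholm_spectrumE q1 z1 e1).
- by rewrite (fredholm_spectrumE q1 z1 e1) /closed_disc closed_discE.
- exact: range_IQ_not_closed.
- split; first exact: closure_Ran.
  by move=> rho [_ _ _ rho1]; rewrite ker_Pi//; exact: closure_Ran.
- exact: proper_dense_Ran.
Qed.
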